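(* Let $\mathbb{X}$ be a Banach space with a basis $\mathcal{B}$ and suppose that either $\mathbb{S}=\ell_1$ or $\mathbb{S}$ is a subsymmetric sequence space with nontrivial type. Assume that $\mathbb{S}$ is isomorphic to a complemented subspace of $\mathbb{X}$ and that $L_m[\mathcal{B},\mathbb{X}]\gtrsim\delta(m)$ for $m\in\mathbb{N}$ for some doubling non-decreasing function $\delta\colon[0,\infty)\to[0,\infty)$. Then there is an almost greedy basis $\mathcal{B}_\kappa$ for $\mathbb{X}$ whose fundamental function is equivalent to $\left(\left\Vert\sum_{j=1}^m e_j\right\Vert_{\mathbb{S}}\right)_{m=1}^\infty$ and such that $L_m[\mathcal{B}_\kappa,\mathbb{X}]\gtrsim\delta(\log m)$ for $m\in\mathbb{N}$.
   Context: Banach spaces are real or complex, over the field $\mathbb{F}$. A basis $\mathcal{B}=(x_j)_{j=1}^\infty$ of a Banach space $\mathbb{X}$ is a Schauder basis, always assumed semi-normalized, i.e. $0<\inf_j\Vert x_j\Vert\le\sup_j\Vert x_j\Vert<\infty$; $(x_j^* )_{j=1}^\infty$ are its coordinate functionals. For $A\subseteq\mathbb{N}$, $S_A(f)=\sum_{j\in A}x_j^*(f)x_j$ (when well defined), and $\operatorname{supp}(f)=\{j: x_j^*(f)\ne0\}$. Define $$L_m[\mathcal{B},\mathbb{X}]=\sup\left\{\frac{\Vert S_A(f)\Vert}{\Vert f\Vert}: f\in\mathbb{X}\setminus\{0\},\ \max(\operatorname{supp}(f))\le m,\ A\subseteq\mathbb{N}\right\}.$$ The basis is almost greedy if there is a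 constant $C$ with $\Vert f-S_F(f)\Vert\le C\Vert f-S_A(f)\Vert$ whenever $f\in\mathbb{X}$, $|A|\le|F|<\infty$, and $|x_j^*(f)|\le|x_k^*(f)|$ for all $j\in\mathbb{N}\setminus F$, $k\in F$. Its fundamental function is $\varphi_m[\mathcal{B},\mathbb{X}]=\sup_{|A|\le m}\Vert\sum_{j\in A}x_j\Vert$, $m\in\mathbb{N}$. A subsymmetric sequence space is a Banach space $\mathbb{S}\subseteq\mathbb{F}^{\mathbb{N}}$ for which the unit-vector system $(e_j)_{j=1}^\infty$ is a basis satisfying $\Vert\sum_j\varepsilon_ja_je_{\phi(j)}\Vert_{\mathbb{S}}=\Vert\sum_ja_je_j\Vert_{\mathbb{S}}$ for all $\sum_ja_je_j\in\mathbb{S}$, all sequences of signs $(\varepsilon_j)$ and all increasing maps $\phi\colon\mathbb{N}\to\mathbb{N}$. A function $\delta\colon[0,\infty)\to[0,\infty)$ is doubling if for some constant $C\ge0$, $\delta(2t)\le C\delta(t)$ for all $t\ge0$. For families of non-negative numbers, $\alpha_i\lesssim\beta_i$ means there is a constant $C$ with $\alpha_i\le C\beta_i$ for all $i$; $\alpha_i\gtrsim\beta_i$ means $\beta_i\lesssim\alpha_i$; two sequences are equivalent if both relations hold. *)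

(* Defs.v *)
From HB Require Import structures.
From mathcomp Require Import all_boot all_order all_algebra.
From mathcomp Require Import finmap.
From mathcomp Require Import all_classical all_reals all_analysis.
From mathcomp.real_closed Require Import -(notations) complex.

Set Implicit Arguments.
Unset Strict Implicit.
Unset Printing Implicit Defensive.
Import Order.TTheory GRing.Theory Num.Theory.
Import numFieldNormedType.Exports.
Local Open Scope classical_set_scope.
Local Open Scope ring_scope.

(* Sequences are indexed from 0: the index j here is the index j + 1 of the
   usual notation, so that the initial segment {1, ..., m} becomes [`I_m].    *)

Variant scalar_kind := RealScalars | ComplexScalars.

Definition scalars (R : realType) (k : scalar_kind) : numFieldType :=
  match k with
  | RealScalars => R : numFieldType
  | ComplexScalars => complex R : numFieldType
  end.

(* The norm of a normed module over K has its values in K; they are real, and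
   [real_part] brings them back to R.                                         *)
Definition real_part (R : realType) (k : scalar_kind) : scalars R k -> R :=
  match k return scalars R k -> R with
  | RealScalars => fun a => a
  | ComplexScalars => fun a => complex.Re a
  end.

Section Bases.
Context {R : realType} {k : scalar_kind}.
Notation F := (scalars R k).

Definition abs (a : F) : R := real_part `|a|.

Definition nrm {V : normedModType F} (f : V) : R := real_part `|f|.

Definition expands_to {X : normedModType F} (x : nat -> X) (a : nat -> F)
    (f : X) : Prop :=
  series (fun j => a j *: x j) @ \oo --> f.

Definition schauder_basis {X : normedModType F} (x : nat -> X) : Prop :=
  forall f : X, exists! a : nat -> F, expands_to x a f.

Definition seminormalized {X : normedModType F} (x : nat -> X) : Prop :=
  (0 < ereal_inf (range (fun j => (nrm (x j))%:E)))%E /\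
  (ereal_sup (range (fun j => (nrm (x j))%:E)) < +oo)%E.

Definition banach_basis {X : normedModType F} (x : nat -> X) : Prop :=
  schauder_basis x /\ seminormalized x.

(* [coordinate x f j] is x_j^*(f); meaningful when x is a Schauder basis. *)
Definition coordinate {X : normedModType F} (x : nat -> X) (f : X) : nat -> F :=
  xget (fun=> 0) [set a | expands_to x a f].

Definition supp {X : normedModType F} (x : nat -> X) (f : X) : set nat :=
  [set j | coordinate x f j != 0].

(* S_A(f); an arbitrary value if the series diverges, which does not happen
   when A or the support of f is finite.                                      *)
Definition coord_proj {X : normedModType F} (x : nat -> X) (A : set nat)
    (f : X) : X :=
  limn (series (fun j => if j \in A then coordinate x f j *: x j else 0)).

Definition Lconst {X : normedModType F} (x : nat -> X) (m : nat) : \bar R :=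
  ereal_sup [set r | exists (f : X) (A : set nat),
    [/\ f != 0, supp x f `<=` `I_m & r = (nrm (coord_proj x A f) / nrm f)%:E]].

Definition almost_greedy {X : normedModType F} (x : nat -> X) : Prop :=
  exists C : R, forall (f : X) (A G : {fset nat}),
    (#|` A| <= #|` G|)%N ->
    (forall i j, i \notin G -> j \in G ->
      abs (coordinate x f i) <= abs (coordinate x f j)) ->
    nrm (f - coord_proj x [set` G] f) <= C * nrm (f - coord_proj x [set` A] f).

Definition fundamental_function {X : normedModType F} (x : nat -> X) (m : nat) :
    \bar R :=
  ereal_sup [set r | exists2 A : {fset nat}, (#|` A| <= m)%N &
    r = (nrm (\sum_(j <- A) x j))%:E].

(* Rademacher type p > 1. The average runs over all choices of signs.         *)
Definition has_type (X : normedModType F) (p : R) : Prop :=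
  exists C : R, forall (n : nat) (f : 'I_n -> X),
    ((2 ^+ n)^-1 * \sum_(s : {ffun 'I_n -> bool})
        nrm (\sum_(i < n) (-1) ^+ s i *: f i) `^ p) `^ p^-1
    <= C * (\sum_(i < n) nrm (f i) `^ p) `^ p^-1.

Definition nontrivial_type (X : normedModType F) : Prop :=
  exists p : R, [/\ 1 < p, p <= 2 & has_type X p].

(* T is an isomorphism of S onto the range of the bounded projection P.       *)
Definition isomorphic_to_complemented_subspace (S X : normedModType F) : Prop :=
  exists (P : {linear X -> X}) (T : {linear S -> X}),
    [/\ continuous P, forall f, P (P f) = P f, range T = range P &
      exists c C : R, 0 < c /\
        forall f : S, c * nrm f <= nrm (T f) /\ nrm (T f) <= C * nrm f].

(* A Banach space S included in F^N as a vector space; [seq_of] is the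
   inclusion.                                                                 *)
Record sequence_space := SequenceSpace {
  seq_space :> completeNormedModType F;
  seq_of : seq_space -> nat -> F;
  seq_of_linear : forall (a : F) (f g : seq_space) (j : nat),
    seq_of (a *: f + g) j = a * seq_of f j + seq_of g j;
  seq_of_inj : injective seq_of
}.

Definition unit_seq (i : nat) : nat -> F := fun j => (j == i)%:R.

(* The element of S whose underlying sequence is [unit_seq i], if any.        *)
Definition unit_vector (S : sequence_space) (i : nat) : S :=
  xget 0 [set f : S | seq_of f = unit_seq i].

Definition subsymmetric (S : sequence_space) : Prop :=
  [/\ forall i, seq_of (unit_vector S i) = unit_seq i,
      banach_basis (unit_vector S) &
      forall (a : nat -> F) (f : S) (eps : nat -> F) (phi : nat -> nat),
        expands_to (unit_vector S) a f ->
        (forall j, eps j = 1 \/ eps j = -1) ->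
        {homo phi : i j / (i < j)%N} ->
        exists2 g : S,
          expands_to (fun j => unit_vector S (phi j)) (fun j => eps j * a j) g &
          nrm g = nrm f].

Definition is_ell1 (S : sequence_space) : Prop :=
  (forall a : nat -> F,
    (exists f : S, seq_of f = a) <->
    (\sum_(0 <= j <oo) (abs (a j))%:E < +oo)%E) /\
  (forall f : S, (nrm f)%:E = (\sum_(0 <= j <oo) (abs (seq_of f j))%:E)%E).

End Bases.

Arguments sequence_space : clear implicits.

Definition doubling (R : realType) (delta : R -> R) : Prop :=
  exists2 C : R, 0 <= C & forall t, 0 <= t -> delta (2 * t) <= C * delta t.

(* Families indexed by the positive integers.                                 *)
Definition lesssim (R : realType) (alpha beta : nat -> \bar R) : Prop :=
  exists C : R, forall m, (0 < m)%N -> (alpha m <= C%:E * beta m)%E.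

Definition equivalent (R : realType) (alpha beta : nat -> \bar R) : Prop :=
  lesssim alpha beta /\ lesssim beta alpha.

(* Main.v *)
Require Import Defs.
From HB Require Import structures.
From mathcomp Require Import all_boot all_order all_algebra.
From mathcomp Require Import finmap.
From mathcomp Require Import all_classical all_reals all_analysis.
From mathcomp.real_closed Require Import -(notations) complex.
From mathcomp Require Import zify ring lra.

(** Let e_j be the unit vectors of S, let lam(m) be the norm of
e_0 + ... + e_(m-1), and cut the indices into dyadic blocks: the block of
level l has 2^l elements.  The basis is the one of the method of Dilworth,
Kalton and Kutzarova.  A finitely supported sequence a is given the norm
[mixed_norm]: the norm in S of a minus its block means, plus the norm in X of
the sum over l of lam(2^l) (mean of a on block l) x_l.  The completion is
Q(S) + X, where Q subtracts the block means.

This norm is almost greedy because a large threshold t can meet a block mean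
only at low levels.  Coordinates with respect to x are bounded, so a mean of
size at least t/2 at level l forces t lam(2^l) to be at most a multiple of the
norm; all blocks up to that one have fewer than 2^(l+1) indices, hence
everything of size at most t there is negligible.  In the later blocks an entry
of size at least t differs from its mean by at least half of itself, so these
entries are controlled by the unconditional norm of S
([core_decomposition]).  It remains to see that they do not make the X-part
large, and this is where the assumption on S enters: the X-part of a sequence
is bounded, even with the triangle inequality, by the norm in S as soon as the
sequence lives on blocks that are at least as long as its support
([sparse_summable]).  In l_1 it is always so.  If S has type
p > 1 then lam(m)/m decreases geometrically along powers of 2, which gives
summability; moreover lam itself increases geometrically, since otherwise S
would contain uniformly isomorphic copies of l_infinity^n, hence of l_1^n
([type_regular]); this makes the levels below a given one add up to at most a
multiple of the last one.

The completion Q(S) + X has to be isomorphic to X, and X is S + Z.  So it is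
enough that Q(S) + S is isomorphic to S ([absorb_centered]).  The indices
j > 0 split into two increasing copies of all the indices, j -> skip0 j and
j -> skip1 j, and there is an interval partition that skip1 preserves and
whose intervals in the skip0 copy are the images of the dyadic blocks.  Moving
only the means along skip1 maps S onto the sequences that vanish at 0 and have
mean zero on the blocks of the skip0 copy, that is, onto S + Q(S).

Finally the map W below sends the sum of the b_l x_l to a sequence that is
constant on blocks, and commutes with projections onto coordinates.  Vectors
supported on the first m elements of x become vectors supported on the first
2^m - 1 elements of the new basis, so the conditionality constants of the new
basis at 2^m - 1 dominate those of x at m ([Lconst_transfer]).

The bounded coordinates of x, that is the finiteness of the basis constant,
come from a category argument ([basis_constant]). *)

Set Implicit Arguments.
Unset Strict Implicit.
Unset Printing Implicit Defensive.
Import Order.TTheory GRing.Theory Num.Theory.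
Import numFieldNormedType.Exports.
Local Open Scope classical_set_scope.
Local Open Scope ring_scope.

(** * Real or complex scalars and norms with real values *)

Section Scalars.
Context {R : realType} {k : scalar_kind}.
Notation F := (scalars R k).

Definition emb (r : R) : F :=
  match k return scalars R k with
  | RealScalars => r
  | ComplexScalars => Complex r 0
  end.

Lemma real_part_emb r : real_part (emb r) = r.
Proof. by rewrite /emb; case: k. Qed.

Lemma emb_zmod_morphism : zmod_morphism emb.
Proof. by rewrite /emb; case: k => r s //=; congr Complex; rewrite subr0. Qed.

Lemma emb_monoid_morphism : monoid_morphism emb.
Proof.
rewrite /emb; case: k; split => // r s /=.
by congr Complex; rewrite !(mulr0, mul0r) ?subr0 ?addr0.
Qed.

HB.instance Definition _ := GRing.isZmodMorphism.Build R F emb emb_zmod_morphism.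
HB.instance Definition _ := GRing.isMonoidMorphism.Build R F emb emb_monoid_morphism.

Lemma emb_le r s : (emb r <= emb s) = (r <= s).
Proof. by rewrite /emb; case: k => //=; rewrite lecE /= eqxx. Qed.

Lemma emb_lt r s : (emb r < emb s) = (r < s).
Proof. by rewrite /emb; case: k => //=; rewrite ltcE /= eqxx. Qed.

Lemma emb_ge0 (z : F) : 0 <= z -> z = emb (real_part z).
Proof.
rewrite /emb; case: k z => //= -[a b]; rewrite lecE /= => /andP[/eqP-> _] //.
Qed.

Lemma emb_gt0 (z : F) : 0 < z -> exists2 r, 0 < r & z = emb r.
Proof.
move=> z0; exists (real_part z); last exact/emb_ge0/ltW.
by rewrite -emb_lt rmorph0 -emb_ge0 // ltW.
Qed.

Section Norm.
Context {V : normedModType F}.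
Implicit Types f g : V.

Lemma norm_emb f : `|f| = emb (nrm f).
Proof. exact: emb_ge0. Qed.

Lemma nrm_ge0 f : 0 <= nrm f.
Proof. by rewrite -emb_le rmorph0 -norm_emb. Qed.

Lemma ler_nrmD f g : nrm (f + g) <= nrm f + nrm g.
Proof. by have := ler_normD f g; rewrite !norm_emb -rmorphD emb_le. Qed.

Lemma nrm0 : nrm (0 : V) = 0.
Proof. by rewrite /nrm normr0 -[0 in LHS](rmorph0 emb) real_part_emb. Qed.

Lemma nrm_eq0 f : (nrm f == 0) = (f == 0).
Proof.
apply/eqP/eqP => [f0|->]; last exact: nrm0.
by apply/eqP; rewrite -normr_eq0 norm_emb f0 rmorph0.
Qed.

Lemma nrm_gt0 f : (0 < nrm f) = (f != 0).
Proof. by rewrite lt_neqAle nrm_ge0 andbT eq_sym nrm_eq0. Qed.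

Lemma nrmN f : nrm (- f) = nrm f.
Proof. by rewrite /nrm normrN. Qed.

Lemma nrmB f g : nrm (f - g) = nrm (g - f).
Proof. by rewrite -nrmN opprB. Qed.

Lemma ler_nrmB f g : nrm (f - g) <= nrm f + nrm g.
Proof. by rewrite -(nrmN g) ler_nrmD. Qed.

Lemma ler_nrm_sum (I : Type) (r : seq I) (P : pred I) (f : I -> V) :
  nrm (\sum_(i <- r | P i) f i) <= \sum_(i <- r | P i) nrm (f i).
Proof.
elim/big_rec2: _ => [|i y1 y2 _ H]; first by rewrite nrm0.
by rewrite (le_trans (ler_nrmD _ _))// lerD2l.
Qed.

End Norm.

Section Abs.
Implicit Types a b : F.

Lemma norm_abs a : `|a| = emb (abs a).
Proof. exact: emb_ge0. Qed.

Lemma nrmZ (V : normedModType F) a (f : V) : nrm (a *: f) = abs a * nrm f.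
Proof.
by rewrite {1}/nrm normrZ norm_abs norm_emb -rmorphM real_part_emb.
Qed.

Lemma abs_ge0 a : 0 <= abs a.
Proof. by rewrite -emb_le rmorph0 -norm_abs. Qed.

Lemma ler_absD a b : abs (a + b) <= abs a + abs b.
Proof. by have := ler_normD a b; rewrite !norm_abs -rmorphD emb_le. Qed.

Lemma abs_emb r : abs (emb r) = `|r|.
Proof.
rewrite /abs; have [r0|r0] := leP 0 r.
  by rewrite ger0_norm ?real_part_emb ?ger0_norm// -(rmorph0 emb) emb_le.
by rewrite ler0_norm -?rmorphN ?real_part_emb ?ltr0_norm// -(rmorph0 emb) emb_le ltW.
Qed.

Lemma abs0 : abs (0 : F) = 0. Proof. by rewrite -(rmorph0 emb) abs_emb normr0. Qed.
Lemma abs1 : abs (1 : F) = 1. Proof. by rewrite -(rmorph1 emb) abs_emb normr1. Qed.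

Lemma absN a : abs (- a) = abs a.
Proof. by rewrite /abs normrN. Qed.

Lemma ler_absB a b : abs (a - b) <= abs a + abs b.
Proof. by rewrite -(absN b) ler_absD. Qed.

Lemma absM a b : abs (a * b) = abs a * abs b.
Proof. by rewrite {1}/abs normrM !norm_abs -rmorphM real_part_emb. Qed.

Lemma abs_eq0 a : (abs a == 0) = (a == 0).
Proof.
apply/eqP/eqP => [a0|->]; last exact: abs0.
by apply/eqP; rewrite -normr_eq0 norm_abs a0 rmorph0.
Qed.

Lemma abs_gt0 a : (0 < abs a) = (a != 0).
Proof. by rewrite lt_neqAle abs_ge0 andbT eq_sym abs_eq0. Qed.

Lemma ler_abs_sum (I : Type) (r : seq I) (P : pred I) (f : I -> F) :
  abs (\sum_(i <- r | P i) f i) <= \sum_(i <- r | P i) abs (f i).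
Proof.
elim/big_rec2: _ => [|i y1 y2 _ H]; first by rewrite abs0.
by rewrite (le_trans (ler_absD _ _))// lerD2l.
Qed.

Lemma emb_neq0 r : r != 0 -> emb r != 0.
Proof. by rewrite -abs_eq0 abs_emb normr_eq0. Qed.

(** Over the reals the second component vanishes; over the complex numbers i is
the imaginary unit.  One fixed i serves all scalars, so that multipliers can be
split into two real ones. *)
Lemma scalar_decomposition : exists2 i : F, abs i <= 1 &
  forall a, exists r s,
    [/\ a = emb r + i * emb s, `|r| <= abs a & `|s| <= abs a].
Proof.
rewrite /abs /emb; case: k => /=.
  exists 0; first by rewrite normr0.
  by move=> a; exists a, 0; rewrite normr0 mul0r addr0; split.
exists (Complex 0 1); first by rewrite /= !(expr0n, expr1n) /= add0r sqrtr1.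
move=> [r s]; exists r, s; split=> /=.
- by congr Complex; rewrite ?(mul0r, mulr0, mul1r, addr0, add0r, subr0).
- by rewrite -sqrtr_sqr ler_wsqrtr// lerDl sqr_ge0.
- by rewrite -sqrtr_sqr ler_wsqrtr// lerDr sqr_ge0.
Qed.

End Abs.

Section Limits.
Context {V : normedModType F}.

(** Convergence measured by the real-valued norm, which is the same over both
fields. *)
Definition tends (u : nat -> V) (l : V) :=
  forall e : R, 0 < e -> exists N, forall n, (N <= n)%N -> nrm (u n - l) < e.

Lemma tendsP (u : nat -> V) (l : V) : u @ \oo --> l <-> tends u l.
Proof.
split=> [/cvgrPdistC_lt ul e e0|ul].
  have := ul (emb e); rewrite -(rmorph0 emb) emb_lt => /(_ e0) [N _ NP].
  by exists N => n Nn; have := NP n Nn; rewrite /= norm_emb emb_lt.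
apply/cvgrPdistC_lt => z /emb_gt0[e e0 ->]; have [N NP] := ul e e0.
by exists N => // n Nn; rewrite /= norm_emb emb_lt NP.
Qed.

Lemma tends_unique u (l l' : V) : tends u l -> tends u l' -> l = l'.
Proof. by move=> /tendsP ul /tendsP; apply: cvg_unique ul. Qed.

End Limits.

Lemma cauchy_tends (V : completeNormedModType F) (u : nat -> V) :
  (forall e : R, 0 < e -> exists N, forall m n, (N <= m)%N -> (m <= n)%N ->
     nrm (u n - u m) < e) -> exists l, tends u l.
Proof.
move=> uC; suff /cauchy_cvgP/cvg_ex[l /tendsP ul] : cauchy (u @ \oo) by exists l.
apply: cauchy_exP => z /emb_gt0[e e0 ->]; have [N NP] := uC _ e0.
exists (u N); exists N => // n Nn.
by rewrite -ball_normE /= norm_emb emb_lt nrmB NP.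
Qed.

End Scalars.

(** * Finite sums along a spreading sequence *)

Section FiniteSums.
Context {R : realType} {k : scalar_kind} {V : normedModType (scalars R k)}.
Notation F := (scalars R k).
Variable e : nat -> V.

Definition snorm (n : nat) (a : nat -> F) : R := nrm (\sum_(j < n) a j *: e j).

Lemma snorm_ge0 n a : 0 <= snorm n a.
Proof. exact: nrm_ge0. Qed.

Lemma eq_snorm n a b : (forall j, (j < n)%N -> a j = b j) -> snorm n a = snorm n b.
Proof. by move=> ab; congr nrm; apply: eq_bigr => j _; rewrite ab. Qed.

Lemma snormD n a b : snorm n (fun j => a j + b j) <= snorm n a + snorm n b.
Proof.
rewrite /snorm (le_trans _ (ler_nrmD _ _))// -big_split /=.
by under [X in nrm X <= _]eq_bigr do rewrite scalerDl.
Qed.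

Lemma snormZ n c a : snorm n (fun j => c * a j) = abs c * snorm n a.
Proof.
rewrite /snorm -nrmZ scaler_sumr; congr nrm.
by apply: eq_bigr => j _; rewrite scalerA.
Qed.

Lemma snormB n a b : snorm n (fun j => a j - b j) <= snorm n a + snorm n b.
Proof.
rewrite (le_trans (snormD n a (fun j => - b j)))// lerD2l.
rewrite (eq_snorm (b := fun j => (-1) * b j)); last by move=> *; rewrite mulN1r.
by rewrite snormZ absN abs1 mul1r.
Qed.

Lemma snorm_sum n (I : Type) (r : seq I) (P : pred I) (f : I -> nat -> F) :
  snorm n (fun j => \sum_(i <- r | P i) f i j) <= \sum_(i <- r | P i) snorm n (f i).
Proof.
rewrite /snorm (le_trans _ (ler_nrm_sum _ _ _))// exchange_big /=.
by under [X in nrm X <= _]eq_bigr do rewrite scaler_suml.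
Qed.

Lemma snorm0 n : snorm n (fun=> 0) = 0.
Proof. by rewrite /snorm big1 ?nrm0// => j _; rewrite scale0r. Qed.

(** The defining isometries of a subsymmetric basis, on finite sums. *)
Definition sign_invariant_spreading :=
  forall n (a : nat -> F) (s : nat -> bool) (phi : nat -> nat),
    {homo phi : i j / (i < j)%N} ->
    nrm (\sum_(j < n) ((-1) ^+ s j * a j) *: e (phi j)) = snorm n a.

Hypothesis eS : sign_invariant_spreading.

Lemma snorm_sign n a (s : nat -> bool) : snorm n (fun j => (-1) ^+ s j * a j) = snorm n a.
Proof. by rewrite -(eS n a s (phi := id)). Qed.

Lemma snorm_spread n (a : nat -> F) (phi : nat -> nat) : {homo phi : i j / (i < j)%N} ->
  nrm (\sum_(j < n) a j *: e (phi j)) = snorm n a.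
Proof.
move=> /(eS n a (fun=> false)) <-; congr nrm.
by apply: eq_bigr => j _; rewrite expr0 mul1r.
Qed.

(** Changing the coordinates one at a time: for r in [-1, 1] the new vector is a
convex combination of the old one and of the old one with one sign flipped. *)
Lemma snorm_contract n a (r : nat -> R) :
  (forall j, (j < n)%N -> `|r j| <= 1) -> snorm n (fun j => emb (r j) * a j) <= snorm n a.
Proof.
move=> r1.
pose b m j := if (j < m)%N then emb (r j) * a j else a j.
suff /(_ n (leqnn n)) H : forall m, (m <= n)%N -> snorm n (b m) <= snorm n a.
  by rewrite (le_trans _ H)// le_eqVlt; apply/orP; left; apply/eqP/eq_snorm => j jn;
    rewrite /b jn.
elim=> [|m IH] mn; first by rewrite le_eqVlt; apply/orP; left; apply/eqP/eq_snorm.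
apply: le_trans (IH (ltnW mn)).
have /ler_normlP[rm1 rm2] := r1 m mn.
pose b' j := (-1) ^+ (j == m) * b m j.
rewrite (@eq_snorm _ _ (fun j => emb ((1 + r m) / 2) * b m j + emb ((1 - r m) / 2) * b' j)).
  rewrite (le_trans (snormD _ _ _))// !snormZ snorm_sign !abs_emb.
  rewrite !ger0_norm; [|lra|lra].
  by rewrite -mulrDl (_ : (1 + r m) / 2 + (1 - r m) / 2 = 1) ?mul1r//; lra.
move=> j jn; rewrite /b' /b ltnS leq_eqVlt; have [->|jm] /= := eqVneq j m.
  rewrite ltnn expr1 mulN1r mulrN -mulrBl -rmorphB; congr (emb _ * _); lra.
rewrite expr0 mul1r -mulrDl -rmorphD (_ : (1 + r m) / 2 + (1 - r m) / 2 = 1); last lra.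
by rewrite rmorph1 mul1r.
Qed.

Lemma snorm_mask n a (J : pred nat) : snorm n (fun j => if J j then a j else 0) <= snorm n a.
Proof.
rewrite (@eq_snorm _ _ (fun j => emb (J j)%:R * a j)) ?snorm_contract//.
  by move=> j _; case: (J j); rewrite ?normr1 ?normr0.
by move=> j _; case: (J j); rewrite ?rmorph1 ?mul1r ?rmorph0 ?mul0r.
Qed.

(** The factor 2 comes from complex multipliers, whose real and imaginary parts
are handled separately: the isometries only involve the signs 1 and -1. *)
Lemma snorm_dominated n a b C : 0 <= C ->
  (forall j, (j < n)%N -> abs (b j) <= C * abs (a j)) -> snorm n b <= 2 * C * snorm n a.
Proof.
move=> C0 ab; have [i i1 dec] := @scalar_decomposition R k.
pose m j := b j / a j.
have mC j : (j < n)%N -> abs (m j) <= C.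
  move=> jn; have := ab _ jn; rewrite /m; have [->|aj] := eqVneq (a j) 0.
    by rewrite invr0 mulr0 abs0.
  rewrite -ler_pdivrMr ?abs_gt0// => /(le_trans _)-> //.
  have {2}-> : b j = b j / a j * a j by rewrite mulfVK.
  by rewrite (absM (b j / a j)) mulfK // abs_eq0.
have bE j : (j < n)%N -> b j = m j * a j.
  move=> jn; have := ab _ jn; rewrite /m; have [->|aj] := eqVneq (a j) 0.
    by rewrite abs0 !mulr0 => bj; apply/eqP; rewrite -abs_eq0 eq_le bj abs_ge0.
  by rewrite mulfVK.
have /choice[rs rsP] : forall j, exists q : R * R,
    [/\ m j = emb q.1 + i * emb q.2, `|q.1| <= abs (m j) & `|q.2| <= abs (m j)].
  by move=> j; have [r [s]] := dec (m j); exists (r, s).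
have half (r' : nat -> R) : (forall j, `|r' j| <= abs (m j)) ->
    snorm n (fun j => emb (r' j) * a j) <= C * snorm n a.
  move=> r'm; have [C00|C00] := eqVneq C 0.
    rewrite C00 mul0r (@eq_snorm _ _ (fun=> 0)) ?snorm0// => j jn.
    have := le_trans (r'm j) (mC j jn); rewrite C00 normr_le0 => /eqP->.
    by rewrite rmorph0 mul0r.
  rewrite (@eq_snorm _ _ (fun j => emb C * (emb (r' j / C) * a j))).
    rewrite snormZ abs_emb ger0_norm// ler_wpM2l// snorm_contract// => j jn.
    by rewrite normrM normfV (ger0_norm C0) ler_pdivrMr ?mul1r ?lt0r ?C00//
      (le_trans (r'm j))// mC.
  by move=> j jn; rewrite mulrA -rmorphM mulrC [_ / C]mulrC mulrA divff// mul1r mulrC.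
rewrite (@eq_snorm _ _ (fun j => emb (rs j).1 * a j + i * (emb (rs j).2 * a j))).
  rewrite (le_trans (snormD _ _ _))// -mulrA mulr_natl mulr2n lerD//.
    by apply: half => j; case: (rsP j).
  rewrite snormZ -[leRHS]mul1r ler_pM ?abs_ge0 ?snorm_ge0//.
  by apply: half => j; case: (rsP j).
by move=> j jn; rewrite bE//; case: (rsP j) => -> _ _; rewrite mulrDl mulrA.
Qed.

(** An increasing finite sequence of indices extends to an increasing map. *)
Lemma snorm_sorted (s : seq nat) (b : nat -> F) : sorted ltn s ->
  nrm (\sum_(i < size s) b i *: e (nth 0%N s i)) = snorm (size s) b.
Proof.
move=> s_sorted.
pose phi i := if (i < size s)%N then nth 0%N s i else (last 0 s + i).+1.
rewrite -(@snorm_spread _ _ phi); last first.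
  move=> i j ij; rewrite /phi; case: (ltnP j (size s)) => js.
    by rewrite (ltn_trans ij js); apply: (sorted_ltn_nth ltn_trans 0%N s_sorted) => //;
      rewrite inE (ltn_trans ij js).
  case: ifPn => [iS|_]; last by rewrite ltnS ltn_add2l.
  rewrite ltnS (leq_trans _ (leq_addr _ _))// -nth_last.
  have s0 : (0 < size s)%N by exact: leq_ltn_trans iS.
  apply: (sorted_leq_nth leq_trans leqnn); rewrite ?inE ?prednK//.
    by apply: sub_sorted s_sorted => x y; exact: ltnW.
  by rewrite -ltnS prednK.
by congr nrm; apply: eq_bigr => i _; rewrite /phi ltn_ord.
Qed.

(** Both sides are the norm of the same list of coefficients placed on
consecutive indices. *)
Lemma snorm_relocate n m a (c : nat -> nat) (J : pred nat) :
  (forall i j, (i < j < n)%N -> J i -> J j -> (c i < c j)%N) ->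
  (forall j, (j < n)%N -> J j -> (c j < m)%N) ->
  snorm n (fun j => if J j then a (c j) else 0) =
  snorm m (fun i => if i \in [seq c j | j <- iota 0 n & J j] then a i else 0).
Proof.
move=> cI cm; set s := [seq j <- iota 0 n | J j].
have s_sorted : sorted ltn s by apply: sorted_filter (iota_ltn_sorted _ _); exact: ltn_trans.
have sn j : j \in s -> (j < n)%N && J j.
  by rewrite mem_filter mem_iota add0n => /andP[-> /andP[_ ->]].
have nths i : (i < size s)%N -> nth 0%N s i \in s by exact: mem_nth.
have cs_sorted : sorted ltn (map c s).
  rewrite sorted_map; apply: (@sub_in_sorted _ (mem s) ltn) s_sorted; last exact/allP.
  move=> i j /sn/andP[i_n Ji] /sn/andP[jn Jj] ij /=; apply: cI => //.
  by rewrite [X in X && _]ij.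
transitivity (snorm (size s) (fun i => a (c (nth 0%N s i)))).
  rewrite -snorm_sorted// /snorm.
  transitivity (nrm (\sum_(j <- s) a (c j) *: e j)).
    rewrite big_filter -(big_mkord predT (fun j => (if J j then a (c j) else 0) *: e j)).
    rewrite [in RHS]big_mkcond /index_iota subn0; congr nrm; apply: eq_bigr => j _.
    by case: (J j); rewrite ?scale0r.
  by rewrite (big_nth 0%N) big_mkord.
rewrite -{1}(size_map c s) -snorm_sorted// size_map /snorm.
transitivity (nrm (\sum_(j <- map c s) a j *: e j)).
  rewrite (big_nth 0%N) size_map big_mkord; congr nrm; apply: eq_bigr => i _.
  by rewrite (nth_map 0%N).
have -> : \sum_(j <- map c s) a j *: e j =
    \sum_(j <- [seq j <- iota 0 m | j \in map c s]) a j *: e j.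
  congr bigop; apply: (irr_sorted_eq ltn_trans ltnn) => //.
    by apply: sorted_filter (iota_ltn_sorted _ _); exact: ltn_trans.
  move=> j; rewrite mem_filter mem_iota add0n; case: (boolP (j \in _)) => // /mapP[i + ->].
  by move=> /sn/andP[i_n Ji]; rewrite cm.
rewrite -(big_mkord predT (fun j => (if j \in map c s then a j else 0) *: e j)).
rewrite big_filter big_mkcond /index_iota subn0; congr nrm; apply: eq_bigr => j _.
by case: ifP => _; rewrite ?scale0r.
Qed.

End FiniteSums.

(** Over q full periods each residue is met q times. *)
Lemma sum_modn_period (M : nmodType) (s o q : nat) (f : nat -> M) : (0 < s)%N ->
  \sum_(t < q * s) f ((o + t) %% s)%N = (\sum_(i < s) f i) *+ q.
Proof.
move=> s0; have per r : \sum_(t < s) f ((r + t) %% s)%N = \sum_(i < s) f i.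
  case: s s0 => // s _; elim: r => [|r <-].
    by apply: eq_bigr => i _; rewrite add0n modn_small.
  rewrite big_ord_recr [RHS]big_ord_recl /= addrC addSnnS modnDr addn0; congr (_ + _).
  by apply: eq_bigr => i _; rewrite addSnnS.
elim: q => [|q IH]; first by rewrite mul0n big_ord0.
rewrite mulSn addnC -(big_mkord predT (fun t => f ((o + t) %% s)%N)).
rewrite (big_cat_nat (n := (q * s)%N)) ?leq_addr//= big_mkord IH mulrSr; congr (_ + _).
rewrite -{1}[(q * s)%N]add0n big_addn addKn big_mkord -(per o); apply: eq_bigr => i _.
by rewrite /= addnA [X in (X %% _)%N]addnC modnMDl.
Qed.

Section FiniteSumsContinued.
Context {R : realType} {k : scalar_kind} {V : normedModType (scalars R k)}.
Notation F := (scalars R k).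
Variable e : nat -> V.
Hypothesis eS : sign_invariant_spreading e.
Notation snorm := (snorm e).

Lemma snorm_relocate_le n m a (c : nat -> nat) (J : pred nat) :
  (forall i j, (i < j < n)%N -> J i -> J j -> (c i < c j)%N) ->
  (forall j, (j < n)%N -> J j -> (c j < m)%N) ->
  snorm n (fun j => if J j then a (c j) else 0) <= snorm m a.
Proof.
move=> cI cm; rewrite (snorm_relocate eS a cI cm).
exact: (snorm_mask eS m a (fun i => i \in _)).
Qed.

Lemma snorm_mono m n a : (m <= n)%N -> snorm m a <= snorm n a.
Proof.
move=> mn; apply: (@snorm_relocate_le _ _ a id predT); first by move=> i j /andP[].
by move=> j jm _; exact: leq_trans mn.
Qed.

Lemma snorm_extend m n a : (m <= n)%N -> (forall j, (m <= j < n)%N -> a j = 0) ->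
  snorm n a = snorm m a.
Proof.
move=> mn a0; congr nrm; rewrite -!(big_mkord predT (fun j => a j *: e j)).
rewrite (big_cat_nat (leq0n _) mn)//= [X in _ + X]big_nat_cond [X in _ + X]big1 ?addr0// =>
  j /andP[/a0-> _].
by rewrite scale0r.
Qed.

(** The fundamental function of the sequence e. *)
Definition lam (m : nat) : R := snorm m (fun=> 1).

Lemma lamE m : lam m = nrm (\sum_(j < m) e j).
Proof. by rewrite /lam /snorm; under eq_bigr do rewrite scale1r. Qed.

Lemma lam_ge0 m : 0 <= lam m. Proof. exact: snorm_ge0. Qed.

Lemma lam_mono m n : (m <= n)%N -> lam m <= lam n. Proof. exact: snorm_mono. Qed.

Lemma lamD m n : lam (m + n) <= lam m + lam n.
Proof.
rewrite /lam {1}/snorm big_split_ord (le_trans (ler_nrmD _ _))// lerD2l /=.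
by rewrite -(@snorm_spread _ _ _ e eS n (fun=> 1) (addn m))// => i j; rewrite ltn_add2l.
Qed.

Lemma lam_spread m (phi : nat -> nat) : {homo phi : i j / (i < j)%N} ->
  nrm (\sum_(j < m) e (phi j)) = lam m.
Proof.
move=> phiI; rewrite -[RHS](snorm_spread eS m (fun=> 1) phiI).
by under [in RHS]eq_bigr do rewrite scale1r.
Qed.

Lemma lam_sign m (s : nat -> bool) : nrm (\sum_(j < m) (-1) ^+ s j *: e j) = lam m.
Proof.
rewrite -[RHS](snorm_sign eS m (fun=> 1) s).
by congr nrm; apply: eq_bigr => j _; rewrite mulr1.
Qed.

Lemma snorm_set n (A : pred nat) (s := [seq j <- iota 0 n | A j]) (b : nat -> F) :
  snorm n (fun j => if A j then b j else 0) = snorm (size s) (fun i => b (nth 0%N s i)).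
Proof.
have s_sorted : sorted ltn s by apply: sorted_filter (iota_ltn_sorted _ _); exact: ltn_trans.
rewrite -(snorm_sorted eS)//.
have -> : \sum_(i < size s) b (nth 0%N s i) *: e (nth 0%N s i) = \sum_(j <- s) b j *: e j.
  by rewrite (big_nth 0%N) big_mkord.
rewrite big_filter /snorm -(big_mkord predT (fun j => (if A j then b j else 0) *: e j)).
rewrite [in RHS]big_mkcond /index_iota subn0; congr nrm; apply: eq_bigr => j _.
by case: (A j); rewrite ?scale0r.
Qed.

Lemma snorm_indicator n (A : pred nat) :
  snorm n (fun j => if A j then 1 else 0) = lam (count A (iota 0 n)).
Proof. by rewrite (snorm_set n A (fun=> 1)) size_filter. Qed.

(** The interval of the partition that contains j starts at lo j and has sz j
elements; the last two axioms say that the data depend only on the interval. *)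
Record interval_partition (lo sz : nat -> nat) : Prop := {
  lo_le : forall j, (lo j <= j)%N;
  lt_lo_sz : forall j, (j < lo j + sz j)%N;
  lo_block : forall j i, (lo j <= i < lo j + sz j)%N -> lo i = lo j;
  sz_block : forall j i, (lo j <= i < lo j + sz j)%N -> sz i = sz j }.

Definition average (lo sz : nat -> nat) (a : nat -> F) (j : nat) : F :=
  (sz j)%:R^-1 * \sum_(i < sz j) a (lo j + i)%N.

Section Average.
Variables (lo sz : nat -> nat).
Hypothesis P : interval_partition lo sz.

Lemma sz_gt0 j : (0 < sz j)%N.
Proof. by have := lo_le P j; have := lt_lo_sz P j; lia. Qed.

(** Distinct intervals of the partition are ordered like any two of their
points. *)
Lemma block_lt i j i' j' : lo i <> lo j -> (lo i <= i' < lo i + sz i)%N ->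
  (lo j <= j' < lo j + sz j)%N -> (i < j)%N -> (i' < j')%N.
Proof.
move=> ij /andP[_ i'i] /andP[jj' _] ltij; rewrite (leq_trans i'i)// (leq_trans _ jj')//.
have [//|ji] := leqP (lo i + sz i) (lo j); exfalso.
have [lij|lji] := ltnP (lo i) (lo j).
  apply: ij; have <- : lo (lo j) = lo i by apply: (lo_block P); rewrite (ltnW lij).
  by apply: (lo_block P); rewrite leqnn -ltn_subLR ?leqnn// subnn sz_gt0.
apply: ij; apply: (lo_block P); rewrite (leq_trans lji (lo_le P i)).
exact: ltn_trans ltij (lt_lo_sz P j).
Qed.

(** The rotation by t of every interval is the sum of two pieces, the indices
that wrap around and those that do not; on each of them it is increasing, so
each costs at most the norm of a. *)
Lemma snorm_shift n t a : (forall j, (j < n)%N -> (lo j + sz j <= n)%N) ->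
  snorm n (fun j => a (lo j + (j - lo j + t) %% sz j)%N) <= 2 * snorm n a.
Proof.
move=> nP; pose r j := (t %% sz j)%N.
have rs j : (r j < sz j)%N by rewrite ltn_mod sz_gt0.
pose J j := (j - lo j + r j < sz j)%N.
have modE j : ((j - lo j + t) %% sz j)%N = (if J j then j - lo j + r j else j - lo j + r j - sz j)%N.
  have oj : (j - lo j < sz j)%N by have := lt_lo_sz P j; have := lo_le P j; lia.
  rewrite -modnDmr -/(r j) /J; case: ltnP => [/modn_small//|le].
  by rewrite -{1}(subnK le) modnDr modn_small//; have := rs j; lia.
have inblock j : (lo j <= lo j + (j - lo j + t) %% sz j < lo j + sz j)%N.
  by rewrite leq_addr ltn_add2l ltn_mod sz_gt0.
have cn j : (j < n)%N -> (lo j + (j - lo j + t) %% sz j < n)%N.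
  by move=> /nP; apply: leq_trans; case/andP: (inblock j).
pose c j := (lo j + (j - lo j + t) %% sz j)%N.
have cI (b : bool) i j : (i < j < n)%N -> J i = b -> J j = b -> (c i < c j)%N.
  move=> /andP[ij _] Ji Jj; have [lij|lij] := eqVneq (lo i) (lo j); last first.
    by apply: block_lt (inblock i) (inblock j) ij; exact/eqP.
  have sij : sz j = sz i.
    apply/esym/(sz_block P); rewrite -lij; have := lt_lo_sz P j; have := lo_le P i.
    by rewrite -lij; lia.
  have rij : r j = r i by rewrite /r sij.
  rewrite /c !modE Ji Jj lij sij rij.
  move: Ji Jj; rewrite /J lij sij rij.
  have := lo_le P i; have := lo_le P j; rewrite lij.
  by case: b; lia.
rewrite (@eq_snorm _ _ _ _ _ _ (fun j => (if J j then a (c j) else 0) +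
    (if ~~ J j then a (c j) else 0))); last first.
  by move=> j _; rewrite -/(c j); case: (J j); rewrite ?addr0 ?add0r.
rewrite (le_trans (snormD _ _ _ _))// mulr_natl mulr2n lerD// snorm_relocate_le//.
- by move=> i j ijn; apply: cI.
- by move=> j jn _; exact: cn.
- by move=> i j ijn /negbTE Ji /negbTE Jj; apply: (cI false).
- by move=> j jn _; exact: cn.
Qed.

(** If the length of every interval divides L, averaging over the rotations by
t = 0, ..., L - 1 replaces a by its means. *)
Lemma snorm_average n a : (forall j, (j < n)%N -> (lo j + sz j <= n)%N) ->
  snorm n (average lo sz a) <= 2 * snorm n a.
Proof.
move=> nP; pose L := (\prod_(j < n) sz j)%N.
have L0 : (0 < L)%N by rewrite prodn_gt0// => j; exact: sz_gt0.
have F0 m : (0 < m)%N -> m%:R != 0 :> F by rewrite pnatr_eq0; case: m.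
have avgE j : (j < n)%N -> average lo sz a j =
    L%:R^-1 * \sum_(t < L) a (lo j + (j - lo j + t) %% sz j)%N.
  move=> jn; have /dvdnP[q Lq] : (sz j %| L)%N.
    by rewrite /L (bigD1 (Ordinal jn))//= dvdn_mulr.
  have q0 : (0 < q)%N by move: L0; rewrite Lq muln_gt0 => /andP[].
  rewrite Lq (sum_modn_period _ _ (fun i => a (lo j + i)%N)) ?sz_gt0//.
  rewrite -[X in _ = _ * X]mulr_natl /average mulrA natrM invfM; congr (_ * _).
  by rewrite [in RHS]mulrAC mulVf ?mul1r// F0.
rewrite (eq_snorm e (b := fun j => L%:R^-1 * \sum_(t < L) a (lo j + (j - lo j + t) %% sz j)%N))//.
rewrite snormZ -(rmorph_nat (emb : {rmorphism R -> F})) -fmorphV abs_emb normfV normr_nat.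
rewrite mulrC ler_pdivrMr ?ltr0n//; apply: le_trans (snorm_sum _ _ _ _ _) _.
rewrite -[X in _ <= _ * X%:R](card_ord L) mulr_natr -sumr_const.
by apply: ler_sum => t _; exact: snorm_shift.
Qed.

End Average.

(** Averaging over m positions, after the values have been packed next to each
other and padded with zeros: it plays the role of Holder's inequality with the
fundamental function of the dual. *)
Lemma sum_abs_le n m (a : nat -> F) (A : pred nat) : (count A (iota 0 n) <= m)%N ->
  lam m * \sum_(j < n | A j) abs (a j) <= 4 * m%:R * snorm n a.
Proof.
move=> Am; case: m Am => [|m Am].
  rewrite leqn0 => /eqP A0; rewrite big1 ?mulr0 ?mul0r// => j Aj; exfalso.
  have : has A (iota 0 n) by apply/hasP; exists (nat_of_ord j); rewrite ?mem_iota /=.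
  by rewrite has_count A0.
set M := m.+1; set s := [seq j <- iota 0 n | A j].
have sM : (size s <= M)%N by rewrite size_filter.
pose b i := if (i < size s)%N then emb (abs (a (nth 0%N s i))) else 0 : F.
pose lo j := if (j < M)%N then 0%N else j; pose sz j := if (j < M)%N then M else 1%N.
have P : interval_partition lo sz.
  split=> [j|j|j i|j i]; rewrite /lo /sz; case: (ltnP j M) => jM; try lia;
    case: (ltnP i M) => iM; lia.
have sE : \sum_(j < n | A j) abs (a j) = \sum_(i < size s) abs (a (nth 0%N s i)).
  transitivity (\sum_(j <- s) abs (a j)); last by rewrite (big_nth 0%N) big_mkord.
  by rewrite big_filter -(big_mkord A (fun j => abs (a j))) /index_iota subn0.
have bE : \sum_(i < M) b i = emb (\sum_(i < size s) abs (a (nth 0%N s i))).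
  rewrite -(big_mkord predT b) (big_cat_nat (leq0n _) sM)//= [X in _ + X]big_nat_cond.
  rewrite [X in _ + X]big1 ?addr0; last first.
    by move=> i; rewrite andbT => /andP[si _]; rewrite /b ltnNge si.
  by rewrite big_mkord rmorph_sum; apply: eq_bigr => i _; rewrite /b ltn_ord.
have MP j : (j < M)%N -> (lo j + sz j <= M)%N by move=> jM; rewrite /lo /sz jM.
have := snorm_average P b MP.
rewrite (@eq_snorm _ _ _ _ _ _ (fun=> M%:R^-1 * emb (\sum_(j < n | A j) abs (a j)) * 1));
  last first.
  by move=> j jM; rewrite /average /sz /lo jM mulr1 sE -bE.
rewrite snormZ -/(lam M) absM abs_emb ger0_norm ?sumr_ge0//; last by move=> *; exact: abs_ge0.
rewrite -(rmorph_nat (emb : {rmorphism R -> F})) -fmorphV abs_emb normfV normr_nat.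
have bs : snorm M b <= 2 * snorm n a.
  rewrite (snorm_extend sM) => [|j /andP[sj _]]; last by rewrite /b ltnNge sj.
  rewrite (le_trans (y := 2 * snorm (size s) (fun i => a (nth 0%N s i))))//.
    rewrite -[2]mulr1 snorm_dominated// => i i_s.
    by rewrite /b i_s abs_emb mul1r ger0_norm ?abs_ge0.
  by rewrite ler_pM2l ?ltr0n// -(snorm_set n A) snorm_mask.
move=> avgb.
have H : lam M * (\sum_(j < n | A j) abs (a j)) <= 2 * snorm M b * M%:R.
  by rewrite -ler_pdivrMr ?ltr0n// mulrC [lam M * _]mulrC mulrA.
rewrite (le_trans H)// [leRHS]mulrAC ler_pM2r ?ltr0n//.
by have := bs; lra.
Qed.

End FiniteSumsContinued.

(** * Dyadic blocks and regularity of the fundamental function *)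

(** The index of the dyadic block that contains j, the block of level l being
the interval from 2^l - 1 to 2^(l+1) - 2. *)
Definition level (j : nat) : nat := trunc_log 2 j.+1.

Lemma levelP k j : ((2 ^ k).-1 <= j < (2 ^ k.+1).-1)%N = (level j == k).
Proof.
have lo := trunc_logP (n := j.+1) (p := 2) isT isT.
have hi := trunc_log_ltn (p := 2) j.+1 isT.
apply/idP/eqP => [kj|<-]; last by rewrite /level; lia.
by apply: trunc_log_eq => //; have := expn_gt0 2 k; lia.
Qed.

Lemma level_start k i : (i < 2 ^ k)%N -> level ((2 ^ k).-1 + i) = k.
Proof. by move=> ik; apply/eqP; rewrite -levelP expnS; lia. Qed.

Lemma level_lt N j : (level j < N)%N = (j < (2 ^ N).-1)%N.
Proof.
have := levelP (level j) j; rewrite eqxx => /andP[lo hi].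
have N0 := expn_gt0 2 N; apply/idP/idP => H.
  by have := leq_pexp2l (isT : 0 < 2)%N H; lia.
rewrite ltnNge; apply/negP => NL.
by have := leq_pexp2l (isT : 0 < 2)%N NL; lia.
Qed.

Lemma big_level (M : nmodType) N (f : nat -> M) :
  \sum_(j < (2 ^ N).-1) f j = \sum_(k < N) \sum_(i < 2 ^ k) f ((2 ^ k).-1 + i)%N.
Proof.
elim: N => [|N IH]; first by rewrite !big_ord0.
rewrite big_ord_recr /= -IH.
have -> : ((2 ^ N.+1).-1 = (2 ^ N).-1 + 2 ^ N)%N by rewrite expnS; have := expn_gt0 2 N; lia.
by rewrite big_split_ord.
Qed.

Lemma big_level_cond (M : nmodType) N k (f : nat -> M) : (k < N)%N ->
  \sum_(j < (2 ^ N).-1 | level j == k) f j = \sum_(i < 2 ^ k) f ((2 ^ k).-1 + i)%N.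
Proof.
move=> kN; rewrite big_mkcond (big_level N (fun j => if level j == k then f j else 0)).
rewrite (bigD1 (Ordinal kN))//= [X in _ + X]big1 ?addr0.
  by apply: eq_bigr => i _; rewrite level_start ?eqxx.
move=> l lk; rewrite big1// => i _; rewrite level_start// ifF//.
by apply: contra_neqF lk => /eqP lk; apply/val_inj.
Qed.

(** Within a window of s terms the sum is at most s times the last one, and
the terms before the window lose a factor 2. *)
Lemma geometric_partial_sum (R : realType) (u : nat -> R) (s : nat) : (forall n, 0 <= u n) ->
  (forall n, u n <= u n.+1) -> (forall n, 2 * u n <= u (n + s)%N) -> (0 < s)%N ->
  forall l, \sum_(k < l.+1) u k <= 2 * s%:R * u l.
Proof.
move=> u0 uS us s0; have umono m n : (m <= n)%N -> u m <= u n.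
  by move=> mn; apply: (homo_leq (@lexx _ _) (@le_trans _ _) uS).
have win m t : (t <= s)%N -> \sum_(k < t) u (m + k)%N <= s%:R * u (m + t).-1.
  move=> ts; case: t ts => [|t] ts; first by rewrite big_ord0 mulr_ge0.
  rewrite (le_trans (y := \sum_(k < t.+1) u (m + t)%N))//.
    by apply: ler_sum => i _; apply: umono; rewrite leq_add2l -ltnS.
  by rewrite sumr_const card_ord -[_ *+ t.+1]mulr_natl addnS ler_wpM2r// ler_nat.
elim/ltn_ind => l IH; have [ls|sl] := ltnP l s.
  have := win 0%N l.+1 ls; rewrite add0n /= => /le_trans-> //.
  rewrite -mulrA ler_peMl ?mulr_ge0//; lra.
have -> : l.+1 = ((l - s).+1 + s)%N by lia.
rewrite big_split_ord /=.
have ls : (l - s < l)%N by lia.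
have {}IH := IH _ ls; have W := win (l - s).+1 s (leqnn s); have U := us (l - s)%N.
have E : (l - s + s = l)%N by lia.
rewrite E in U; rewrite addSn /= E in W.
have S := ler_wpM2l (ler0n R s) U; nra.
Qed.

Lemma geometric_tail_sum (R : realType) (u : nat -> R) (s : nat) : (forall n, 0 <= u n) ->
  (forall n, u n.+1 <= u n) -> (forall n, 2 * u (n + s)%N <= u n) -> (0 < s)%N ->
  forall t m, \sum_(k < t) u (m + k)%N <= 2 * s%:R * u m.
Proof.
move=> u0 uS us s0; have umono m n : (m <= n)%N -> u n <= u m.
  by move=> mn; apply: (@homo_leq R u (fun x y => y <= x)) mn => // x y z xy /le_trans; apply.
have win m t : (t <= s)%N -> \sum_(k < t) u (m + k)%N <= s%:R * u m.
  move=> ts; rewrite (le_trans (y := \sum_(k < t) u m))//.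
    by apply: ler_sum => i _; apply: umono; rewrite leq_addr.
  by rewrite sumr_const card_ord -[_ *+ t]mulr_natl ler_wpM2r// ler_nat.
elim/ltn_ind => t IH m; have [ts|st] := leqP t s.
  by rewrite (le_trans (win m t ts))// -mulrA ler_peMl ?mulr_ge0//; lra.
have -> : t = (s + (t - s))%N by lia.
rewrite big_split_ord /=; have ts : (t - s < t)%N by lia.
have {}IH := IH _ ts (m + s)%N; have W := win m s (leqnn s); have U := us m.
under [X in _ + X <= _]eq_bigr do rewrite addnA.
have S := ler_wpM2l (ler0n R s) U; nra.
Qed.

Section Regularity.
Context {R : realType} {k : scalar_kind} {V : normedModType (scalars R k)}.
Notation F := (scalars R k).
Variable e : nat -> V.
Hypothesis eS : sign_invariant_spreading e.
Hypothesis e0 : 0 < lam e 1.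
Notation snorm := (snorm e).
Notation lam := (lam e).

Lemma lam_gt0 m : (0 < m)%N -> 0 < lam m.
Proof. by move=> m0; apply: lt_le_trans e0 _; apply: lam_mono. Qed.

Definition lower_regular := exists C, forall l, \sum_(i < l.+1) lam (2 ^ i) <= C * lam (2 ^ l).

(** The sum on the left bounds the X-part of [mixed_norm]; the two hypotheses
say that g lives on blocks that are at least as long as its support is
large. *)
Definition sparse_summable := exists C, forall N n (g : nat -> F),
  (forall j, (j < (2 ^ n).-1)%N -> g j = 0) ->
  (count (fun j => g j != 0%R) (iota 0 (2 ^ N).-1) <= 2 ^ n)%N ->
  \sum_(l < N) lam (2 ^ l) / (2 ^ l)%:R * \sum_(i < 2 ^ l) abs (g ((2 ^ l).-1 + i)%N)
  <= C * snorm (2 ^ N).-1 g.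

(** By [sum_abs_le] the entries of g in one block add up to at most
4 2^n / lam(2^n) times its norm, and the ratios lam(2^l) / 2^l sum to a multiple
of the one at l = n. *)
Lemma sparse_summable_of_geometric s : (0 < s)%N ->
  (forall n, lam (2 ^ (n + s)) <= 2 ^+ s / 2 * lam (2 ^ n)) -> sparse_summable.
Proof.
move=> s0 us; pose u n := lam (2 ^ n) / (2 ^ n)%:R.
have p0 n : 0 < (2 ^ n)%:R :> R by rewrite ltr0n expn_gt0.
have u0 n : 0 < u n by rewrite divr_gt0// lam_gt0 ?expn_gt0.
have uS n : u n.+1 <= u n.
  rewrite /u ler_pdivrMr// mulrAC ler_pdivlMr// expnS natrM mulrA ler_pM2r//.
  by rewrite mulr_natr mulr2n mul2n -addnn lamD.
have uss n : 2 * u (n + s)%N <= u n.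
  rewrite /u mulrA ler_pdivrMr// mulrAC ler_pdivlMr// [X in _ <= _ * X%:R]expnD natrM (natrX _ 2 s).
  by have := ler_wpM2r (ltW (p0 n)) (us n); lra.
exists (8 * s%:R) => N n g g0 gn.
have block l : (l < N)%N -> \sum_(i < 2 ^ l) abs (g ((2 ^ l).-1 + i)%N) <= 4 / u n * snorm (2 ^ N).-1 g.
  move=> lN; rewrite -(big_level_cond (fun j => abs (g j)) lN).
  rewrite (bigID (fun j : 'I__ => g j != 0))/= [X in _ + X]big1 ?addr0; last first.
    by move=> j /andP[_]; rewrite negbK => /eqP->; rewrite abs0.
  have l0 : 0 < lam (2 ^ n) by rewrite lam_gt0 ?expn_gt0.
  have -> : 4 / u n * snorm (2 ^ N).-1 g = 4 * (2 ^ n)%:R * snorm (2 ^ N).-1 g / lam (2 ^ n).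
    by rewrite /u; field; rewrite !gt_eqF ?p0.
  rewrite ler_pdivlMr// mulrC.
  rewrite (sum_abs_le eS g (A := fun j => (level j == l) && (g j != 0)))//.
  by rewrite (leq_trans _ gn)// sub_count// => j /= /andP[].
have [nN|Nn] := ltnP n N; last first.
  rewrite big1 ?mulr_ge0 ?snorm_ge0// => l _; rewrite big1 ?mulr0// => i _.
  rewrite g0 ?abs0// -level_lt level_start// (leq_trans _ Nn)//.
rewrite -(big_mkord predT (fun l => u l * \sum_(i < 2 ^ l) abs (g ((2 ^ l).-1 + i)%N))).
rewrite (big_cat_nat (leq0n n) (ltnW nN))//= [X in X + _]big_nat_cond big1 ?add0r; last first.
  move=> l /andP[/andP[_ ln] _]; rewrite big1 ?mulr0// => i _.
  by rewrite g0 ?abs0// -level_lt level_start.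
have -> : N = ((N - n) + n)%N by lia.
rewrite -{1}[n]add0n big_addn addnK big_mkord.
have T := geometric_tail_sum (fun n => ltW (u0 n)) uS uss s0 (N - n) n.
apply: (@le_trans _ _ (\sum_(l < N - n) u (n + l)%N * (4 / u n * snorm (2 ^ (N - n + n)).-1 g))).
  apply: ler_sum => l _; rewrite addnC; apply: ler_wpM2l; first exact: ltW.
  by rewrite (_ : N - n + n = N)%N ?block//; have := ltn_ord l; lia.
have S0 := snorm_ge0 e (2 ^ (N - n + n)).-1 g.
have U0 : 0 <= 4 / u n * snorm (2 ^ (N - n + n)).-1 g by rewrite mulr_ge0// divr_ge0// ltW.
rewrite -mulr_suml (le_trans (ler_wpM2r U0 T))// le_eqVlt; apply/orP; left; apply/eqP.
by field; rewrite gt_eqF.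
Qed.

Lemma lower_regular_of_geometric s : (0 < s)%N ->
  (forall n, 2 * lam (2 ^ n) <= lam (2 ^ (n + s))) -> lower_regular.
Proof.
move=> s0 us; exists (2 * s%:R) => l.
apply: (geometric_partial_sum (u := fun n => lam (2 ^ n)%N)) => // n; first exact: lam_ge0.
by apply: lam_mono => //; rewrite leq_exp2l.
Qed.

End Regularity.

(** * Nontrivial type makes the fundamental function regular *)

Lemma big_ord_mul (M : nmodType) r m (f : nat -> M) :
  \sum_(j < r * m) f j = \sum_(i < r) \sum_(j < m) f (i * m + j)%N.
Proof.
elim: r => [|r IH]; first by rewrite !big_ord0.
by rewrite big_ord_recr /= -IH mulSn addnC big_split_ord.
Qed.

(** This is where p > 1 is used. *)
Lemma sublinear_powR (R : realType) (K p : R) : 1 < p -> 0 < K ->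
  exists n0 : nat, forall n : nat, (n0 < n)%N -> K * n%:R `^ p^-1 <= n%:R.
Proof.
move=> p1 K0; have p0 : 0 < p by lra.
have q0 : 0 < 1 - p^-1 by rewrite subr_gt0 invf_lt1.
exists (Num.truncn (K `^ (1 - p^-1)^-1)) => n Kn.
have n0 : 0 < n%:R :> R by rewrite ltr0n; lia.
have {}Kn : K `^ (1 - p^-1)^-1 <= n%:R.
  by rewrite (le_trans (ltW (truncnS_gt _)))// ler_nat.
have : K <= n%:R `^ (1 - p^-1).
  have {1}-> : K = (K `^ (1 - p^-1)^-1) `^ (1 - p^-1).
    by rewrite -powRrM mulVf ?lt0r_neq0// powRr1// ltW.
  by rewrite ge0_ler_powR ?nnegrE ?powR_ge0// ltW.
move=> /(ler_wpM2r (powR_ge0 n%:R p^-1))/le_trans; apply.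
by rewrite -powRD; [rewrite subrK powRr1// ltW|rewrite (lt0r_neq0 n0) implybT].
Qed.

Section RademacherType.
Context {R : realType} {k : scalar_kind} {V : normedModType (scalars R k)}.
Notation F := (scalars R k).
Variable e : nat -> V.
Hypothesis eS : sign_invariant_spreading e.
Hypothesis e0 : 0 < lam e 1.
Notation snorm := (snorm e).
Notation lam := (lam e).
Variable p : R.
Hypotheses (p1 : 1 < p) (Vp : has_type V p).

(** The averages over signs in the definition of type collapse when all signed
sums are bounded below by the same M. *)
Lemma type_bound : exists2 C, 0 < C & forall n (f : 'I_n -> V) (M B : R),
  0 <= M -> 0 <= B ->
  (forall s : {ffun 'I_n -> bool}, M <= nrm (\sum_(i < n) (-1) ^+ s i *: f i)) ->
  (forall i, nrm (f i) <= B) -> M <= C * n%:R `^ p^-1 * B.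
Proof.
have p0 : 0 < p by exact: lt_trans p1.
have pK (x : R) : 0 <= x -> (x `^ p) `^ p^-1 = x.
  by move=> x0; rewrite -powRrM divff ?gt_eqF// powRr1.
have pow_le (q x y : R) : 0 <= q -> 0 <= x -> x <= y -> x `^ q <= y `^ q.
  by move=> q0 x0 xy; rewrite ge0_ler_powR// nnegrE// (le_trans x0).
have pi0 : 0 <= p^-1 by rewrite invr_ge0 ltW.
case: Vp => C CP; exists (`|C| + 1); first by rewrite ltr_wpDl.
move=> n f M B M0 B0 fM fB.
have powR_sum : (\sum_(i < n) nrm (f i) `^ p) `^ p^-1 <= n%:R `^ p^-1 * B.
  rewrite -[X in _ * X]pK// -powRM ?powR_ge0//; apply: (pow_le) => //.
    by apply: sumr_ge0 => i _; exact: powR_ge0.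
  rewrite mulr_natl -[X in _ *+ X]card_ord -sumr_const; apply: ler_sum => i _.
  by apply: (pow_le); [exact: ltW|exact: nrm_ge0|].
rewrite -[leLHS]pK//; apply: (le_trans (le_trans _ (CP n f))).
  have two0 : 0 < 2 ^+ n :> R by rewrite exprn_gt0.
  apply: (pow_le) => //; first exact: powR_ge0.
  rewrite ler_pdivlMl//.
  have -> : 2 ^+ n * M `^ p = \sum_(s : {ffun 'I_n -> bool}) M `^ p.
    by rewrite sumr_const card_ffun card_bool card_ord -natrX mulr_natl.
  by apply: ler_sum => s _; apply: (pow_le) => //; exact: ltW.
rewrite -mulrA (le_trans (ler_wpM2r _ (ler_norm C))) ?powR_ge0//.
by rewrite ler_pM ?powR_ge0 ?lerDl.
Qed.

(** Type applied to 2^s consecutive blocks of equal length: all signed sums of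
the blocks have the same norm. *)
Lemma lam_upper_regular : exists2 s, (0 < s)%N &
  forall n, lam (2 ^ (n + s)) <= 2 ^+ s / 2 * lam (2 ^ n).
Proof.
have [C C0 CP] := type_bound.
have [n0 n0P] := sublinear_powR p1 (mulr_gt0 (ltr0n R 2) C0).
exists n0.+1 => // n; set s := n0.+1; set r := (2 ^ s)%N; set m := (2 ^ n)%N.
have nr : (n0 < r)%N by rewrite (ltn_trans (ltnSn n0))// ltn_expl.
pose f (i : 'I_r) := \sum_(j < m) e (i * m + j)%N.
have fB i : nrm (f i) <= lam m.
  by rewrite (lam_spread eS m (phi := addn (i * m)))// => x y; rewrite ltn_add2l.
have fM (s' : {ffun 'I_r -> bool}) : lam (2 ^ (n + s)) <= nrm (\sum_(i < r) (-1) ^+ s' i *: f i).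
  pose t i := odflt false (omap s' (insub i)).
  rewrite -(lam_sign eS _ (fun j => t (j %/ m)%N)) le_eqVlt; apply/orP; left; apply/eqP.
  rewrite addnC expnD -/m -/r (big_ord_mul r m (fun j => (-1) ^+ t (j %/ m)%N *: e j)); congr nrm.
  apply: eq_bigr => i _; rewrite scaler_sumr; apply: eq_bigr => j _.
  by rewrite divnMDl ?expn_gt0// divn_small// addn0 /t valK.
have := CP _ f _ _ (lam_ge0 e _) (lam_ge0 e m) fM fB.
move=> /le_trans; apply; rewrite ler_wpM2r ?lam_ge0//.
by have := n0P r nr; rewrite natrX; lra.
Qed.

(** Index 2^s consecutive blocks of length m by the sign vectors of length s and
let f_l be the sum of the blocks with signs given by the l-th entry.  Each f_l
has norm lam(2^s m).  In a signed sum of the f_l, the block indexed by these very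
signs has coefficient s, so the norm is at least s lam(m).  Type then forces
lam(2^s m) to be large compared with lam(m). *)
Lemma lam_lower_regular : exists2 s, (0 < s)%N &
  forall n, 2 * lam (2 ^ n) <= lam (2 ^ (n + s)).
Proof.
have [C C0 CP] := type_bound.
have [n0 n0P] := sublinear_powR p1 (mulr_gt0 (ltr0n R 2) C0).
exists n0.+1 => // n; set s := n0.+1; set r := (2 ^ s)%N; set m := (2 ^ n)%N.
pose T : finType := {ffun 'I_s -> bool}.
have cT : size (enum T) = r by rewrite -cardT card_ffun card_bool card_ord.
pose tau j : T := nth [ffun=> false] (enum T) (j %/ m)%N.
pose f (l : 'I_s) := \sum_(j < r * m) (-1) ^+ tau j l *: e j.
have rmE : (2 ^ (n + s) = r * m)%N by rewrite addnC expnD.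
have fB l : nrm (f l) <= lam (r * m) by rewrite -(lam_sign eS _ (fun j => tau j l)).
have fM (s' : T) : s%:R * lam m <= nrm (\sum_(l < s) (-1) ^+ s' l *: f l).
  pose c j : F := \sum_(l < s) (-1) ^+ s' l * (-1) ^+ tau j l.
  have -> : \sum_(l < s) (-1) ^+ s' l *: f l = \sum_(j < r * m) c j *: e j.
    under eq_bigr do rewrite scaler_sumr.
    rewrite exchange_big; apply: eq_bigr => j _; rewrite scaler_suml.
    by apply: eq_bigr => l _; rewrite scalerA.
  (* The block indexed by the signs themselves. *)
  pose q := index s' (enum T).
  have qr : (q < r)%N by rewrite -cT index_mem mem_enum.
  have := @snorm_relocate_le _ _ _ e eS m (r * m)%N c (addn (q * m)) predT.
  rewrite (@eq_snorm _ _ _ _ _ _ (fun=> s%:R * 1)); last first.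
    move=> j jm; rewrite mulr1 /c /tau divnMDl ?expn_gt0// divn_small// addn0.
    rewrite nth_index ?mem_enum//; under eq_bigr do rewrite -signr_addb addbb.
    by rewrite sumr_const card_ord.
  rewrite snormZ -(rmorph_nat (emb : {rmorphism R -> F})) abs_emb normr_nat; apply.
    by move=> i j /andP[ij _] _ _; rewrite ltn_add2l.
  move=> j jm _; rewrite -ltn_subRL -mulnBl (leq_trans jm)// leq_pmull// subn_gt0//.
have := CP _ f _ _ (mulr_ge0 (ler0n R s) (lam_ge0 e m)) (lam_ge0 e _) fM fB.
rewrite rmE; have := n0P s (ltnSn n0); have s0 : 0 < s%:R :> R by rewrite ltr0n.
move: (_ `^ _) (lam_ge0 e (r * m)) => x L0 H1 H2.
rewrite -(ler_pM2l s0); apply: le_trans (_ : 2 * (C * x * lam (r * m)) <= _); first by lra.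
by have := ler_wpM2r L0 H1; lra.
Qed.

Lemma type_regular : lower_regular e /\ sparse_summable e.
Proof.
split.
  by have [s s0 sP] := lam_lower_regular; exact: lower_regular_of_geometric sP.
by have [s s0 sP] := lam_upper_regular; exact: sparse_summable_of_geometric sP.
Qed.

End RademacherType.

(** * The norm that couples block means with another basis *)

Lemma count_iota_lt n M : (count (fun j => j < n)%N (iota 0 M) <= n)%N.
Proof.
rewrite -size_filter -{2}(size_iota 0 n); apply: uniq_leq_size.
  by rewrite filter_uniq// iota_uniq.
by move=> j; rewrite mem_filter !mem_iota /= => /andP[].
Qed.

Lemma count_level N l : (l < N)%N -> count (fun j => level j == l) (iota 0 (2 ^ N).-1) = (2 ^ l)%N.
Proof.
move=> lN; rewrite -sum1_count -{1}[(2 ^ N).-1]subn0.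
rewrite (big_mkord (fun j => level j == l) (fun=> 1%N)).
by rewrite (big_level_cond (fun=> 1%N) lN) sum1_card card_ord.
Qed.

Lemma ler_sum_truncate (R : numDomainType) (u : nat -> R) N n : (forall i, 0 <= u i) ->
  \sum_(i < N) (if (i < n)%N then u i else 0) <= \sum_(i < n) u i.
Proof.
move=> u0; have [Nn|nN] := leqP N n; last first.
  by rewrite -big_mkcond /= (big_ord_widen N u (ltnW nN)).
rewrite -(subnKC Nn) [leRHS]big_split_ord /= ler_wpDr ?sumr_ge0// ler_sum// => i _.
by case: ifP.
Qed.

Lemma dyadic_partition :
  interval_partition (fun j => (2 ^ level j).-1) (fun j => (2 ^ level j)%N).
Proof.
have P j := levelP (level j) j; have E l := expnS 2 l; have E0 l := expn_gt0 2 l.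
split=> [j|j|j i|j i]; have := P j; rewrite eqxx => /andP[lo hi].
- by [].
- have := E (level j); lia.
- move=> ij; suff -> : level i = level j by [].
  by apply/eqP; rewrite -levelP; have := E (level j); lia.
- move=> ij; suff -> : level i = level j by [].
  by apply/eqP; rewrite -levelP; have := E (level j); lia.
Qed.

Section Core.
Context {R : realType} {k : scalar_kind} {V W : normedModType (scalars R k)}.
Notation F := (scalars R k).
Variable e : nat -> V.
Hypothesis eS : sign_invariant_spreading e.
Hypothesis e0 : 0 < lam e 1.
Notation snorm := (snorm e).
Notation lam := (lam e).
Hypothesis lam_lower : lower_regular e.
Hypothesis sparse : sparse_summable e.

Variables (x : nat -> W) (K c C : R).
Hypotheses (c0 : 0 < c) (xc : forall j, c <= nrm (x j)) (xC : forall j, nrm (x j) <= C).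
Hypothesis xK : forall m n (a : nat -> F), (m <= n)%N ->
  nrm (\sum_(j < m) a j *: x j) <= K * nrm (\sum_(j < n) a j *: x j).

Definition mean (l : nat) (a : nat -> F) : F :=
  (2 ^ l)%:R^-1 * \sum_(i < 2 ^ l) a ((2 ^ l).-1 + i)%N.

Definition centered (a : nat -> F) (j : nat) : F := a j - mean (level j) a.

(** The norm of the Dilworth-Kalton-Kutzarova method.  The weight
lam(2^l) gives the indicator of block l its norm in S times the norm of x_l. *)
Definition mixed_norm (N : nat) (a : nat -> F) : R := snorm (2 ^ N).-1 (centered a) +
  nrm (\sum_(l < N) (emb (lam (2 ^ l)) * mean l a) *: x l).

Definition mask (G : pred nat) (a : nat -> F) (j : nat) : F := if G j then a j else 0.

Lemma norm_bound_ge0 : 0 <= C.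
Proof. exact: le_trans (nrm_ge0 _) (xC 0). Qed.

Lemma basis_constant_ge1 : 1 <= K.
Proof.
have := xK (fun=> 1) (leqnn 1); rewrite big_ord_recl big_ord0 addr0 scale1r.
have : 0 < nrm (x 0) by exact: lt_le_trans (xc 0).
by move=> x0; rewrite -{1}[nrm _]mul1r ler_pM2r.
Qed.

Lemma exp2_gt0 l : 0 < (2 ^ l)%:R :> R. Proof. by rewrite ltr0n expn_gt0. Qed.

Lemma abs_natV n : abs (n%:R^-1 : F) = n%:R^-1.
Proof. by rewrite -(rmorph_nat (emb : {rmorphism R -> F})) -fmorphV abs_emb normfV normr_nat. Qed.

Lemma eq_mean N l a b : (l < N)%N -> (forall j, (j < (2 ^ N).-1)%N -> a j = b j) ->
  mean l a = mean l b.
Proof.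
move=> lN ab; congr (_ * _); apply: eq_bigr => i _; apply: ab.
by rewrite -level_lt level_start.
Qed.

Lemma meanD l a b : mean l (fun j => a j + b j) = mean l a + mean l b.
Proof. by rewrite /mean big_split mulrDr. Qed.

Lemma meanN l a : mean l (fun j => - a j) = - mean l a.
Proof. by rewrite /mean sumrN mulrN. Qed.

Lemma mean_const l b : mean l (fun=> b) = b.
Proof.
by rewrite /mean sumr_const card_ord -[b *+ _]mulr_natl mulrA mulVf ?mul1r ?pnatr_eq0 -?lt0n ?expn_gt0.
Qed.

Lemma mean_level l (f : nat -> F) : mean l (fun j => f (level j)) = f l.
Proof.
rewrite -[RHS](mean_const l); congr (_ * _).
by apply: eq_bigr => i _; rewrite level_start.
Qed.

Lemma mean_centered l a : mean l (centered a) = 0.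
Proof.
rewrite /centered meanD (meanN l (fun j => mean (level j) a)).
by rewrite (mean_level l (fun i => mean i a)) subrr.
Qed.

Lemma abs_mean_le l a : abs (mean l a) <= (2 ^ l)%:R^-1 * \sum_(i < 2 ^ l) abs (a ((2 ^ l).-1 + i)%N).
Proof. by rewrite absM abs_natV ler_wpM2l ?invr_ge0 ?ler0n// ler_abs_sum. Qed.

Lemma eq_mixed_norm N a b : (forall j, (j < (2 ^ N).-1)%N -> a j = b j) -> mixed_norm N a = mixed_norm N b.
Proof.
move=> ab; rewrite /mixed_norm; congr (_ + _); last congr nrm; first 1 last.
  by apply: eq_bigr => l _; rewrite (eq_mean (N := N) _ ab).
apply: eq_snorm => j jN; rewrite /centered ab// (eq_mean (N := N) _ ab)//.
by rewrite level_lt.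
Qed.

Lemma mixed_norm_ge0 N a : 0 <= mixed_norm N a.
Proof. by rewrite addr_ge0 ?nrm_ge0 ?snorm_ge0. Qed.

Lemma mixed_normD N a b : mixed_norm N (fun j => a j + b j) <= mixed_norm N a + mixed_norm N b.
Proof.
rewrite /mixed_norm [leRHS]addrACA lerD//.
  rewrite (le_trans _ (snormD _ _ _ _))// le_eqVlt; apply/orP; left; apply/eqP.
  by apply: eq_snorm => j _; rewrite /centered meanD opprD addrACA.
rewrite (le_trans _ (ler_nrmD _ _))// -big_split /= le_eqVlt; apply/orP; left; apply/eqP.
by congr nrm; apply: eq_bigr => l _; rewrite meanD mulrDr scalerDl.
Qed.

Lemma mixed_normN N a : mixed_norm N (fun j => - a j) = mixed_norm N a.
Proof.
rewrite /mixed_norm; congr (_ + _).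
  transitivity (snorm (2 ^ N).-1 (fun j => -1 * centered a j)).
    by apply: eq_snorm => j _; rewrite /centered meanN mulN1r opprD.
  by rewrite snormZ absN abs1 mul1r.
rewrite -nrmN -sumrN; congr nrm; apply: eq_bigr => l _.
by rewrite meanN mulrN scaleNr opprK.
Qed.

Lemma mixed_normB N a b : mixed_norm N (fun j => a j - b j) <= mixed_norm N a + mixed_norm N b.
Proof. by rewrite -(mixed_normN N b) mixed_normD. Qed.

Lemma mixed_norm0 N : mixed_norm N (fun=> 0) = 0.
Proof.
rewrite /mixed_norm big1 ?nrm0 ?addr0 => [|l _]; last by rewrite mean_const mulr0 scale0r.
rewrite (@eq_snorm _ _ _ _ _ _ (fun=> 0)) ?snorm0// => j _.
by rewrite /centered mean_const subr0.
Qed.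

Lemma snorm_means N a : snorm (2 ^ N).-1 (fun j => mean (level j) a) <= 2 * snorm (2 ^ N).-1 a.
Proof.
apply: (snorm_average eS dyadic_partition a (n := (2 ^ N).-1)) => j.
rewrite -level_lt => jN; have := leq_pexp2l (isT : 0 < 2)%N jN; rewrite expnS.
by have := expn_gt0 2 (level j); lia.
Qed.

Lemma snorm_centered N a : snorm (2 ^ N).-1 (centered a) <= 3 * snorm (2 ^ N).-1 a.
Proof.
rewrite (le_trans (snormB e _ a (fun j => mean (level j) a)))//.
by have := snorm_means N a; lra.
Qed.

Lemma lam_mean_le N l a : (l < N)%N -> lam (2 ^ l) * abs (mean l a) <= 4 * snorm (2 ^ N).-1 a.
Proof.
move=> lN; have := @sum_abs_le _ _ _ e eS (2 ^ N).-1 (2 ^ l) a (fun j => level j == l).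
rewrite count_level// leqnn => /(_ isT); rewrite (big_level_cond (fun j => abs (a j)) lN) => H.
have H1 := ler_wpM2l (lam_ge0 e (2 ^ l)) (abs_mean_le l a).
rewrite (le_trans H1)// mulrCA ler_pdivrMl ?exp2_gt0//; lra.
Qed.

(** The l-th coordinate functional of x is bounded, by the basis constant. *)
Lemma mixed_norm_mean N l a : (l < N)%N -> lam (2 ^ l) * abs (mean l a) <= 2 * K / c * mixed_norm N a.
Proof.
move=> lN; pose b i := emb (lam (2 ^ i)) * mean i a.
have K0 : 0 <= K by have := basis_constant_ge1; lra.
have H : nrm (b l *: x l) <= 2 * K * mixed_norm N a.
  have -> : b l *: x l = \sum_(i < l.+1) b i *: x i - \sum_(i < l) b i *: x i.
    by rewrite big_ord_recr /= addrAC subrr add0r.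
  have wK : K * nrm (\sum_(i < N) b i *: x i) <= K * mixed_norm N a.
    by rewrite ler_wpM2l// lerDr snorm_ge0.
  have := ler_nrmB (\sum_(i < l.+1) b i *: x i) (\sum_(i < l) b i *: x i).
  have := xK b lN; have := xK b (ltnW lN); lra.
rewrite mulrAC ler_pdivlMr//; apply: le_trans H.
rewrite nrmZ /b absM abs_emb ger0_norm ?lam_ge0// ler_wpM2l ?mulr_ge0 ?abs_ge0 ?lam_ge0//.
Qed.

Lemma mixed_norm_le_means N a : mixed_norm N a <= 3 * snorm (2 ^ N).-1 a +
  C * \sum_(l < N) lam (2 ^ l) * abs (mean l a).
Proof.
rewrite lerD ?snorm_centered// (le_trans (ler_nrm_sum _ _ _))// mulr_sumr.
apply: ler_sum => l _; rewrite nrmZ absM abs_emb ger0_norm ?lam_ge0// mulrC.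
by rewrite ler_wpM2r// mulr_ge0 ?lam_ge0 ?abs_ge0.
Qed.

Lemma mixed_norm_le N a : mixed_norm N a <= 3 * snorm (2 ^ N).-1 a +
  C * \sum_(l < N) lam (2 ^ l) / (2 ^ l)%:R * \sum_(i < 2 ^ l) abs (a ((2 ^ l).-1 + i)%N).
Proof.
rewrite (le_trans (mixed_norm_le_means N a))// lerD2l ler_wpM2l ?norm_bound_ge0//.
by apply: ler_sum => l _; rewrite -mulrA ler_wpM2l ?lam_ge0// abs_mean_le.
Qed.

Lemma mixed_norm_sparse : exists2 D, 0 <= D & forall N n a,
  (forall j, (level j < n)%N -> a j = 0) ->
  (count (fun j => a j != 0%R) (iota 0 (2 ^ N).-1) <= 2 ^ n)%N ->
  mixed_norm N a <= D * snorm (2 ^ N).-1 a.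
Proof.
have [D DP] := sparse; exists (3 + C * `|D|); first by rewrite addr_ge0 ?mulr_ge0 ?norm_bound_ge0.
move=> N n a a0 an; rewrite (le_trans (mixed_norm_le N a))//
  [leRHS]mulrDl lerD2l -[leRHS]mulrA ler_wpM2l ?norm_bound_ge0//.
rewrite (le_trans (DP N n a _ an))//; last by rewrite ler_wpM2r ?snorm_ge0 ?ler_norm.
by move=> j jn; rewrite a0// level_lt.
Qed.

Lemma snorm_le_indicator n (A : pred nat) (b : nat -> F) t : 0 <= t ->
  (forall j, (j < n)%N -> abs (b j) <= if A j then t else 0) ->
  snorm n b <= 2 * t * lam (count A (iota 0 n)).
Proof.
move=> t0 bt; rewrite -(snorm_indicator eS) snorm_dominated// => j jn.
by rewrite (le_trans (bt j jn))//; case: (A j); rewrite ?abs1 ?abs0 ?mulr1 ?mulr0.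
Qed.

(** Blocks that are not longer than A contribute at most the sum of the
lam(2^l), which [lower_regular] bounds by a multiple of the last one; on the
longer ones the sequence is sparse. *)
Lemma mixed_norm_upper : exists2 D, 0 <= D & forall N (A : pred nat) (b : nat -> F) t, 0 <= t ->
  (forall j, (j < (2 ^ N).-1)%N -> abs (b j) <= if A j then t else 0) ->
  mixed_norm N b <= D * t * lam (count A (iota 0 (2 ^ N).-1)).
Proof.
have [D1 D10 sp] := mixed_norm_sparse; have [D2 low] := lam_lower.
exists (6 + C * `|D2| + 2 * D1).
  by rewrite !addr_ge0 ?mulr_ge0 ?norm_bound_ge0.
move=> N A b t t0 bt; set m := count A _; set M := (2 ^ N).-1.
have [m0|m0] := posnP m.
  rewrite (@eq_mixed_norm _ _ (fun=> 0)) ?mixed_norm0 ?mulr_ge0 ?lam_ge0 ?addr_ge0 ?mulr_ge0 ?norm_bound_ge0//.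
  move=> j jM; apply/eqP; rewrite -abs_eq0 eq_le abs_ge0 andbT (le_trans (bt j jM))//.
  case: ifP => // Aj; exfalso; have : has A (iota 0 M) by apply/hasP; exists j; rewrite ?mem_iota.
  by rewrite has_count -/m m0.
set n := (trunc_log 2 m).
have mn : (m <= 2 ^ n.+1)%N by rewrite ltnW// trunc_log_ltn.
have nm : (2 ^ n <= m)%N by rewrite trunc_logP.
pose b1 := mask (fun j => level j < n.+1)%N b; pose b2 := mask (fun j => n < level j)%N b.
have b1t j : (j < M)%N -> abs (b1 j) <= if A j then t else 0.
  by move=> /bt; rewrite /b1 /mask; case: (_ < _)%N => // _; rewrite abs0; case: ifP.
have b2t j : (j < M)%N -> abs (b2 j) <= if A j then t else 0.
  by move=> /bt; rewrite /b2 /mask; case: (_ < _)%N => // _; rewrite abs0; case: ifP.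
have W2 : mixed_norm N b2 <= D1 * (2 * t * lam m).
  rewrite (le_trans (sp N n.+1 b2 _ _))//; last 1 first.
  - by rewrite ler_wpM2l// snorm_le_indicator.
  - by move=> j jn; rewrite /b2 /mask ltnNge -ltnS jn.
  apply: leq_trans mn; rewrite /m -!size_filter; apply: uniq_leq_size.
    by rewrite filter_uniq// iota_uniq.
  move=> j; rewrite !mem_filter => /andP[+ jM]; rewrite jM andbT; apply: contra_neqT => Aj.
  have := b2t j; rewrite (negbTE Aj) => H; apply/eqP; rewrite -abs_eq0 eq_le abs_ge0 andbT H//.
  by move: jM; rewrite mem_iota.
have W1 : mixed_norm N b1 <= 3 * (2 * t * lam m) + C * (`|D2| * lam m * t).
  rewrite (le_trans (mixed_norm_le_means N b1))//
    lerD ?ler_wpM2l ?norm_bound_ge0 ?snorm_le_indicator//.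
  apply: (@le_trans _ _ (\sum_(l < N) if (l < n.+1)%N then lam (2 ^ l) * t else 0)).
    apply: ler_sum => l _; rewrite (le_trans (ler_wpM2l _ (abs_mean_le l b1))) ?lam_ge0//.
    case: ifP => ln.
      rewrite ler_wpM2l ?lam_ge0// ler_pdivrMl ?exp2_gt0// -[in leRHS](card_ord (2 ^ l)).
      rewrite mulr_natl -sumr_const; apply: ler_sum => i _.
      rewrite (le_trans (b1t _ _))//; first by rewrite -level_lt level_start.
      by case: ifP.
    rewrite big1 ?mulr0// => i _; rewrite /b1 /mask level_start// ln abs0//.
  have lt0 i : 0 <= lam (2 ^ i) * t by rewrite mulr_ge0 ?lam_ge0.
  apply: le_trans (ler_sum_truncate N n.+1 lt0) _.
  rewrite -mulr_suml ler_wpM2r// (le_trans (low n))//.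
  rewrite (le_trans (ler_wpM2r (lam_ge0 _ _) (ler_norm _)))// ler_wpM2l//.
  exact: lam_mono.
have bE j : (j < M)%N -> b j = b1 j + b2 j.
  by rewrite /b1 /b2 /mask ltnS => _; case: leqP => _; rewrite ?addr0 ?add0r.
rewrite (eq_mixed_norm bE) (le_trans (mixed_normD _ _ _))// (le_trans (lerD W1 W2))//.
rewrite le_eqVlt; apply/orP; left; apply/eqP; ring.
Qed.

Lemma count_level_lt N n : (count (fun j => level j < n)%N (iota 0 N) <= (2 ^ n).-1)%N.
Proof. by rewrite (eq_count (level_lt n)) count_iota_lt. Qed.

(** The level n separates the two regimes.  It is the larger of two numbers:
the level a from which on all means are at most t/2, and the level b at which
blocks become at least as long as the number of entries of G found beyond a. *)
Lemma core_decomposition : exists2 D, 0 <= D & forall N h (G : pred nat) t, 0 <= t ->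
  has G (iota 0 (2 ^ N).-1) ->
  (forall j, (j < (2 ^ N).-1)%N -> G j -> t <= abs (h j)) ->
  exists n, let G' := fun j => G j && (n <= level j)%N in
    [/\ t * lam (2 ^ n) <= D * mixed_norm N h,
        snorm (2 ^ N).-1 (mask G' h) <= D * mixed_norm N h &
        (count G' (iota 0 (2 ^ N).-1) <= 2 ^ n)%N].
Proof.
set D := 2 * K / c; have K1 := basis_constant_ge1.
have D0 : 0 <= D by rewrite divr_ge0 ?mulr_ge0// ltW// (lt_le_trans _ K1).
exists (16 + 4 * D); first by rewrite addr_ge0// mulr_ge0.
move=> N h G t t0 hasG hG; set M := (2 ^ N).-1; set X := mixed_norm N h.
have X0 : 0 <= X := mixed_norm_ge0 N h.
have DX0 : 0 <= D * X by rewrite mulr_ge0.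
pose small n := `[< forall l, (n <= l < N)%N -> abs (mean l h) <= t / 2 >].
(* Beyond the level N there is no mean to bound. *)
have [] := @ex_minnP small; first by exists N; apply/asboolP => l; lia.
move=> a /asboolP a_small a_min.
pose Ga j := G j && (a <= level j)%N.
pose ga := mask Ga h.
have ga_le : snorm M ga <= 4 * X.
  apply: (@le_trans _ _ (2 * 2 * snorm M (centered h))).
    apply: snorm_dominated => // j jM; rewrite /ga /mask; case: ifP; last first.
      by rewrite abs0 mulr_ge0 ?abs_ge0.
    move=> /andP[Gj aj]; have := hG j jM Gj.
    have := a_small (level j); rewrite aj level_lt jM => /(_ isT).
    have := ler_absB (centered h j) (- mean (level j) h).
    by rewrite absN opprK /centered subrK; lra.
  have : snorm M (centered h) <= X by rewrite lerDl nrm_ge0.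
  by lra.
set m := count Ga (iota 0 M).
have tm : t * lam m <= 8 * X.
  have <- : snorm M (fun j => emb t * (if Ga j then 1 else 0)) = t * lam m.
    by rewrite snormZ abs_emb ger0_norm// (snorm_indicator eS).
  apply: (@le_trans _ _ (2 * 1 * snorm M ga)); last by lra.
  apply: snorm_dominated => // j jM; rewrite mul1r /ga /mask -/(Ga j).
  case: ifP => [/andP[Gj _]|_]; last by rewrite mulr0 abs0.
  by rewrite mulr1 abs_emb ger0_norm// hG.
have ta : (0 < a)%N -> t * lam (2 ^ a) <= 4 * (D * X).
  case: (a) a_min => // a' a_min _.
  have : ~~ small a' by apply/negP => /a_min; rewrite ltnn.
  move=> /asboolPn/existsNP[l /not_implyP[/andP[al lN]]] /negP; rewrite -ltNge => tl.
  have H1 : lam (2 ^ a'.+1) <= 2 * lam (2 ^ l).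
    rewrite expnS mul2n -addnn (le_trans (lamD eS _ _))// mulr_natl mulr2n lerD// lam_mono//;
    by rewrite leq_exp2l.
  have H2 := mixed_norm_mean h lN; rewrite -/D -/X in H2.
  have H3 := ler_wpM2l t0 H1; have H4 := ler_wpM2l (lam_ge0 e (2 ^ l)) (ltW tl).
  by lra.
(* If there is no entry beyond a then a > 0, because G is not empty. *)
pose b := if m == 0%N then 0%N else (trunc_log 2 m).+1.
have mb : (m <= 2 ^ b)%N.
  by rewrite /b; case: eqP => [->//|_]; rewrite ltnW// trunc_log_ltn.
have tb : (0 < b)%N -> t * lam (2 ^ b) <= 16 * X.
  rewrite /b; have [//|m0 _] := posnP m.
  have H1 : lam (2 ^ (trunc_log 2 m).+1) <= 2 * lam m.
    rewrite expnS mul2n -addnn (le_trans (lamD eS _ _))// mulr_natl mulr2n lerD// lam_mono//;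
    by rewrite trunc_logP.
  by have H3 := ler_wpM2l t0 H1; lra.
have ab : (0 < a)%N || (0 < b)%N.
  case: posnP => //= a0; have : (0 < m)%N.
    rewrite -has_count; apply: sub_has hasG => j Gj; rewrite /= /Ga Gj a0//.
  by rewrite /b lt0n => /negbTE->.
exists (maxn a b) => G'.
have G'a j : G' j -> Ga j by rewrite /G' /Ga geq_max => /andP[-> /andP[->]].
split.
- have [|ba] := leqP b a; last by have := tb (leq_ltn_trans (leq0n _) ba); lra.
  move=> ba; have : (0 < a)%N by case/orP: ab => // /leq_trans; apply.
  by move=> /ta; lra.
- rewrite (le_trans (y := snorm M ga))//; last by lra.
  rewrite (@eq_snorm _ _ _ _ _ _ (fun j => if G' j then ga j else 0)) ?snorm_mask// => j _.
  by rewrite /ga /mask; case: ifP => // /G'a ->.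
- apply: leq_trans (_ : m <= _)%N; first exact: sub_count.
  by rewrite (leq_trans mb)// leq_exp2l// leq_maxr.
Qed.

(** At most 2^n entries lie below the level n of [core_decomposition], and at
most 2^n beyond. *)
Lemma mixed_norm_lower : exists2 D, 0 <= D & forall N h (G : pred nat) t, 0 <= t ->
  (forall j, (j < (2 ^ N).-1)%N -> G j -> t <= abs (h j)) ->
  t * lam (count G (iota 0 (2 ^ N).-1)) <= D * mixed_norm N h.
Proof.
have [D D0 core] := core_decomposition; exists (2 * D); first by rewrite mulr_ge0.
move=> N h G t t0 hG; have [hasG|noG] := boolP (has G (iota 0 (2 ^ N).-1)); last first.
  move: noG; rewrite has_count -leqNgt leqn0 => /eqP ->.
  by rewrite /lam /snorm big_ord0 nrm0 mulr0 !mulr_ge0 ?mixed_norm_ge0.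
have [n [tn _ cn]] := core N h G t t0 hasG hG.
have : lam (count G (iota 0 (2 ^ N).-1)) <= lam (2 ^ n) + lam (2 ^ n).
  apply: le_trans (lamD eS _ _); apply: lam_mono => //.
  have := count_level_lt (2 ^ N).-1 n; have := expn_gt0 2 n.
  have := count_predUI (fun j => level j < n)%N (fun j =>
    G j && (n <= level j)%N) (iota 0 (2 ^ N).-1).
  have : (count G (iota 0 (2 ^ N).-1) <= count (predU (fun j => level j < n)%N
      (fun j => G j && (n <= level j)%N)) (iota 0 (2 ^ N).-1))%N.
    by apply: sub_count => j /= ->; case: ltnP.
  lia.
by move=> /(ler_wpM2l t0); lra.
Qed.

(** Cutting at the end of a block does not change the means of the blocks that
are kept. *)
Lemma mixed_norm_level_lt N n h : mixed_norm N (mask (fun j =>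
  level j < n)%N h) <= (1 + K) * mixed_norm N h.
Proof.
have K1 := basis_constant_ge1; pose b l := emb (lam (2 ^ l)) * mean l h.
have S0 := snorm_ge0 e (2 ^ N).-1 (centered h).
suff H : mixed_norm N (mask (fun j => level j < n)%N h) <=
    snorm (2 ^ N).-1 (centered h) + K * nrm (\sum_(l < N) b l *: x l).
  rewrite (le_trans H)// /mixed_norm -/b; move: (nrm_ge0 (\sum_(l < N) b l *: x l)).
  move: (snorm _ _) S0 (nrm _) => s s0 r r0; have := mulr_ge0 (le_trans ler01 K1) s0; nra.
have mE l : mean l (mask (fun j => level j < n)%N h) = if (l < n)%N then mean l h else 0.
  case: ifP => ln; rewrite /mean; last rewrite big1 ?mulr0//.
    by congr (_ * _); apply: eq_bigr => i _; rewrite /mask level_start// ln.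
  by move=> i _; rewrite /mask level_start// ln.
rewrite /mixed_norm lerD//.
  rewrite (@eq_snorm _ _ _ _ _ _ (fun j => if (level j < n)%N then centered h j else 0)).
    exact: (snorm_mask eS _ _ (fun j => level j < n)%N).
  by move=> j _; rewrite /centered mE /mask; case: ifP; rewrite ?subr0.
have -> : \sum_(l < N) (emb (lam (2 ^ l)) * mean l (mask (fun j => (level j < n)%N) h)) *: x l =
    \sum_(l < minn n N) b l *: x l.
  rewrite (big_ord_widen N (fun l => b l *: x l) (geq_minr n N)) [RHS]big_mkcond.
  apply: eq_bigr => l _; rewrite mE leq_min ltn_ord andbT.
  by case: ifP; rewrite ?mulr0 ?scale0r.
exact/xK/geq_minr.
Qed.

(** Below the level n of [core_decomposition], h restricted to G is h minus
entries of size at most t, whose number is less than 2^n; beyond n it is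
sparse. *)
Lemma mixed_norm_greedy : exists2 D, 0 <= D & forall N h (G : pred nat) t, 0 <= t ->
  (forall j, (j < (2 ^ N).-1)%N -> G j -> t <= abs (h j)) ->
  (forall j, (j < (2 ^ N).-1)%N -> ~~ G j -> abs (h j) <= t) ->
  mixed_norm N (mask G h) <= D * mixed_norm N h.
Proof.
have [D1 D10 core] := core_decomposition; have [D2 D20 up] := mixed_norm_upper.
have [D3 D30 sp] := mixed_norm_sparse; have K1 := basis_constant_ge1.
have K0 : 0 <= K by lra.
have D0 : 0 <= 1 + K + D2 * D1 + D3 * D1 by rewrite !addr_ge0// ?mulr_ge0.
exists (1 + K + D2 * D1 + D3 * D1) => //.
move=> N h G t t0 hG hGc; have W0 := mixed_norm_ge0 N h.
have [hasG|noG] := boolP (has G (iota 0 (2 ^ N).-1)); last first.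
  rewrite (@eq_mixed_norm _ _ (fun=> 0)) ?mixed_norm0 ?mulr_ge0// => j jM.
  by move/hasPn : noG => /(_ j); rewrite mem_iota jM /mask => /(_ isT)/negbTE->.
have [n [tn gn cn]] := core N h G t t0 hasG hG.
set G' := (fun j => G j && _) in gn cn.
(* The restriction of h to G is u - v up to level n, and mask G' h beyond. *)
pose u := mask (fun j => level j < n)%N h.
pose v := mask (fun j => ~~ G j && (level j < n)%N) h.
rewrite (@eq_mixed_norm _ _ (fun j => (u j - v j) + mask G' h j)); last first.
  move=> j _; rewrite /u /v /mask /G'; case: (G j); case: ltnP => //=;
  by rewrite ?subrr ?subr0 ?addr0 ?add0r.
apply: le_trans (mixed_normD _ (fun j => u j - v j) _) _.
have Hu : mixed_norm N u <= (1 + K) * mixed_norm N h := mixed_norm_level_lt N n h.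
have Hv : mixed_norm N v <= D2 * D1 * mixed_norm N h.
  have := up N (fun j => ~~ G j && (level j < n)%N) v t t0.
  move=> /(_ _)/le_trans; apply=> [j jM|].
    rewrite /v /mask; case: ifP => [/andP[Gj _]|_]; last by rewrite abs0.
    exact: hGc.
  rewrite -mulrA -[leRHS]mulrA ler_wpM2l// (le_trans _ tn)// ler_wpM2l//.
  apply: lam_mono => //; apply: leq_trans (leq_trans (count_level_lt (2 ^ N).-1 n) (leq_pred _)).
  by apply: sub_count => j /andP[].
have Hg : mixed_norm N (mask G' h) <= D3 * D1 * mixed_norm N h.
  rewrite (le_trans (sp N n _ _ _))//.
  - by move=> j jn; rewrite /mask /G' leqNgt jn andbF.
  - apply: leq_trans cn; apply: sub_count => j /=; rewrite /mask.
    by case: ifP; rewrite ?eqxx.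
  - by rewrite -mulrA ler_wpM2l.
have := mixed_normB N u v; lra.
Qed.

(** Full blocks are kept by [mixed_norm_level_lt]; in the block that is cut, the
mean and the centered part are restricted separately. *)
Lemma mixed_norm_prefix : exists2 D, 0 <= D & forall N m a, (m <= (2 ^ N).-1)%N ->
  mixed_norm N (mask (fun j => j < m)%N a) <= D * mixed_norm N a.
Proof.
have [D2 D20 up] := mixed_norm_upper; have K1 := basis_constant_ge1.
have K0 : 0 <= K by lra.
set D := 2 * K / c; have D0 : 0 <= D by rewrite divr_ge0 ?mulr_ge0// ltW.
exists (1 + K + D2 * D + (3 + C * 4)); first by rewrite !addr_ge0// mulr_ge0// norm_bound_ge0.
move=> N m a; have W0 := mixed_norm_ge0 N a.
rewrite leq_eqVlt => /orP[/eqP->|mM].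
  rewrite (@eq_mixed_norm _ _ a); last by move=> j jM; rewrite /mask jM.
  rewrite ler_peMl//; have := mulr_ge0 D20 D0; have := norm_bound_ge0; nra.
set n := level m; have nN : (n < N)%N by rewrite level_lt.
pose I j := (level j == n) && (j < m)%N.
pose u := mask (fun j => level j < n)%N a; pose v := mask I (fun=> mean n a).
pose w := mask I (centered a).
rewrite (@eq_mixed_norm _ _ (fun j => (u j + v j) + w j)); last first.
  move=> j _; rewrite /u /v /w /mask /I /centered.
  have /andP[nm mn] : ((2 ^ n).-1 <= m < (2 ^ n.+1).-1)%N by rewrite levelP.
  have := level_lt n j; have := level_lt n.+1 j; rewrite ltnS.
  case: (ltngtP (level j) n) => jn /=.
  - by move=> _ /esym jn'; rewrite (leq_trans jn' nm) !addr0.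
  - move=> /esym/negbT; rewrite -leqNgt => mj _; rewrite ifF ?addr0//.
    by apply/negbTE; rewrite -leqNgt (leq_trans (ltnW mn)).
  - by move=> _ _; rewrite add0r jn; case: ifP => _; rewrite ?addr0// addrC subrK.
have Hu : mixed_norm N u <= (1 + K) * mixed_norm N a := mixed_norm_level_lt N n a.
have cI : (count I (iota 0 (2 ^ N).-1) <= 2 ^ n)%N.
  by rewrite -(count_level nN); apply: sub_count => j /andP[].
have Hv : mixed_norm N v <= D2 * D * mixed_norm N a.
  have := up N I v (abs (mean n a)) (abs_ge0 _).
  move=> /(_ _)/le_trans; apply=> [j jM|].
    by rewrite /v /mask; case: ifP; rewrite ?abs0.
  rewrite -mulrA -[leRHS]mulrA ler_wpM2l// (le_trans _ (mixed_norm_mean a nN))// mulrC.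
  by rewrite ler_wpM2r ?abs_ge0// lam_mono.
have Sw : snorm (2 ^ N).-1 w <= mixed_norm N a.
  by rewrite (le_trans (snorm_mask eS _ _ I))// lerDl nrm_ge0.
have Hw : mixed_norm N w <= (3 + C * 4) * mixed_norm N a.
  rewrite (le_trans (mixed_norm_le_means N w))// [leRHS]mulrDl lerD ?ler_wpM2l//
    -mulrA ler_wpM2l ?norm_bound_ge0//.
  rewrite (bigD1 (Ordinal nN))//= [X in _ + X]big1 ?addr0.
    by rewrite (le_trans (lam_mean_le w nN))// ler_wpM2l.
  move=> l ln; suff -> : mean l w = 0 by rewrite abs0 mulr0.
  rewrite /mean big1 ?mulr0// => i _; rewrite /w /mask /I level_start//.
  by case: eqVneq => //= lE; case/eqP: ln; apply: val_inj.
have := mixed_normD N (fun j => u j + v j) w; have := mixed_normD N u v; lra.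
Qed.

End Core.

(** * Schauder bases: coordinates, basis constant, density criterion *)

Section Expansions.
Context {R : realType} {k : scalar_kind} {X : normedModType (scalars R k)}.
Notation F := (scalars R k).
Variable x : nat -> X.

Lemma expandsP (a : nat -> F) f :
  expands_to x a f <-> tends (fun n => \sum_(j < n) a j *: x j) f.
Proof.
rewrite /expands_to; split=> [/tendsP H|H]; last apply/tendsP;
by move=> e e0; have [N NP] := H e e0; exists N => n /NP; rewrite /series /= big_mkord.
Qed.

Lemma tendsD (u v : nat -> X) f g :
  tends u f -> tends v g -> tends (fun n => u n + v n) (f + g).
Proof.
move=> uf vg e e0; have e2 : 0 < e / 2 by rewrite divr_gt0.
have [N NP] := uf _ e2; have [M MP] := vg _ e2.
exists (maxn N M) => n; rewrite geq_max => /andP[/NP un /MP vn].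
by rewrite opprD addrACA (le_lt_trans (ler_nrmD _ _))//; lra.
Qed.

Lemma tendsZ c (u : nat -> X) f : tends u f -> tends (fun n => c *: u n) (c *: f).
Proof.
move=> uf e e0; have c0 : 0 < abs c + 1 by rewrite ltr_wpDl ?abs_ge0.
have [N NP] := uf _ (divr_gt0 e0 c0); exists N => n /NP H.
rewrite -scalerBr nrmZ; apply: (@le_lt_trans _ _ ((abs c + 1) * nrm (u n - f))).
  by rewrite ler_wpM2r ?nrm_ge0// lerDl.
by rewrite mulrC -ltr_pdivlMr.
Qed.

Lemma tends_cst (f : X) : tends (fun=> f) f.
Proof. by move=> e e0; exists 0%N => n _; rewrite subrr nrm0. Qed.

Lemma tends_eq (u v : nat -> X) f N :
  (forall n, (N <= n)%N -> u n = v n) -> tends u f -> tends v f.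
Proof.
move=> uv uf e e0; have [M MP] := uf e e0; exists (maxn N M) => n.
by rewrite geq_max => /andP[/uv<- /MP].
Qed.

Lemma nrm_tends_le (u : nat -> X) f B N :
  tends u f -> (forall n, (N <= n)%N -> nrm (u n) <= B) -> nrm f <= B.
Proof.
move=> uf uB; apply/ler_addgt0Pr => e e0; have [M MP] := uf e e0.
have := MP _ (leq_maxr N M); have := uB _ (leq_maxl N M).
move: (u _) => w wB wf; have := ler_nrmD w (f - w); rewrite addrC subrK nrmB.
by move=> H; rewrite (le_trans H)// lerD// ltW// nrmB.
Qed.

Lemma expands_lin c a b f g : expands_to x a f -> expands_to x b g ->
  expands_to x (fun j => c * a j + b j) (c *: f + g).
Proof.
move=> /expandsP af /expandsP bg; apply/expandsP.
have := tendsD (tendsZ c af) bg; apply: (tends_eq (N := 0)) => n _.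
by rewrite scaler_sumr -big_split /=; apply: eq_bigr => j _; rewrite scalerDl scalerA.
Qed.

Lemma expands_finite (a : nat -> F) n :
  expands_to x (fun j => if (j < n)%N then a j else 0) (\sum_(j < n) a j *: x j).
Proof.
apply/expandsP; apply: (tends_eq (N := n)) (tends_cst _) => m nm.
rewrite (big_ord_widen m (fun j => a j *: x j) nm) big_mkcond; apply: eq_bigr => j _.
by case: ifP; rewrite ?scale0r.
Qed.

Arguments expands_finite a n : clear implicits.

Hypothesis xB : schauder_basis x.

Lemma coordinateP f : expands_to x (coordinate x f) f.
Proof. by have [a [af _]] := xB f; apply: (@xgetPex _ (fun=> 0) [set a | expands_to x a f]);
  exists a. Qed.
Arguments coordinateP f : clear implicits.

Lemma coordinate_unique a f : expands_to x a f -> coordinate x f = a.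
Proof. by have [b [_ bu]] := xB f; move=> af; rewrite -(bu _ af) (bu _ (coordinateP f)). Qed.

Lemma coordinate_lin c f g j :
  coordinate x (c *: f + g) j = c * coordinate x f j + coordinate x g j.
Proof. by rewrite (coordinate_unique (expands_lin (c := c) (coordinateP f) (coordinateP g))). Qed.

Lemma coordinate_finite (a : nat -> F) n j :
  coordinate x (\sum_(j < n) a j *: x j) j = if (j < n)%N then a j else 0.
Proof. by rewrite (coordinate_unique (expands_finite a n)). Qed.

Lemma coordinate_basis j i : coordinate x (x j) i = (i == j)%:R.
Proof.
have {1}-> : x j = \sum_(l < j.+1) (l == j :> nat)%:R *: x l.
  rewrite big_ord_recr /= eqxx scale1r big1 ?add0r// => l _.
  by rewrite ltn_eqF// scale0r.
rewrite (coordinate_finite (fun l => (l == j)%:R)) ltnS.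
by case: ltngtP.
Qed.

Definition partial_sum (n : nat) (f : X) : X := \sum_(j < n) coordinate x f j *: x j.

Lemma partial_sum_lin n c f g :
  partial_sum n (c *: f + g) = c *: partial_sum n f + partial_sum n g.
Proof.
rewrite /partial_sum scaler_sumr -big_split /=; apply: eq_bigr => j _.
by rewrite coordinate_lin scalerDl scalerA.
Qed.

Lemma tends_partial_sum f : tends (partial_sum^~ f) f.
Proof. exact/expandsP/coordinateP. Qed.

Lemma basis_neq0 j : x j != 0.
Proof.
apply/eqP => xj; have := coordinate_finite (fun=> 1) j.+1 j; rewrite ltnSn.
rewrite big_ord_recr /= xj scaler0 addr0 (coordinate_finite (fun=> 1)) ltnn => /eqP.
by rewrite eq_sym oner_eq0.
Qed.

End Expansions.
Arguments coordinateP {R k X x} xB f : rename.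
Arguments expands_finite {R k X} x a n.

Section Completeness.
Context {R : realType}.

Lemma real_cauchy (u : nat -> R) :
  (forall e : R, 0 < e -> exists N, forall m n, (N <= m)%N -> (m <= n)%N ->
     `|u n - u m| < e) ->
  exists l, forall e, 0 < e -> exists N, forall n, (N <= n)%N -> `|u n - l| < e.
Proof. exact: (@cauchy_tends R RealScalars R^o u). Qed.

(** Completeness of the real line, applied to real and imaginary parts. *)
Lemma scalar_cauchy (k : scalar_kind) (u : nat -> scalars R k) :
  (forall e : R, 0 < e -> exists N, forall m n, (N <= m)%N -> (m <= n)%N ->
     abs (u n - u m) < e) ->
  exists l, forall e : R, 0 < e -> exists N, forall n, (N <= n)%N -> abs (u n - l) < e.
Proof.
case: k u => [|u uC]; first exact: real_cauchy.
have absE (z : scalars R ComplexScalars) :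
    [/\ `|complex.Re z| <= abs z, `|complex.Im z| <= abs z &
        abs z <= `|complex.Re z| + `|complex.Im z|].
  case: z => a b; rewrite /abs /=.
  split; first by rewrite -sqrtr_sqr ler_wsqrtr// lerDl sqr_ge0.
    by rewrite -sqrtr_sqr ler_wsqrtr// lerDr sqr_ge0.
  rewrite -[leRHS]ger0_norm ?addr_ge0// -sqrtr_sqr ler_wsqrtr//.
  by rewrite sqrrD !real_normK ?num_real// addrAC lerDl mulrn_wge0// mulr_ge0.
have [|a aP] := @real_cauchy (fun n => complex.Re (u n)).
  move=> e /uC[N NP]; exists N => m n Nm mn; apply: le_lt_trans (NP m n Nm mn).
  by have [+ _ _] := absE (u n - u m); case: (u n) (u m) => [? ?] [].
have [|b bP] := @real_cauchy (fun n => complex.Im (u n)).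
  move=> e /uC[N NP]; exists N => m n Nm mn; apply: le_lt_trans (NP m n Nm mn).
  by have [_ + _] := absE (u n - u m); case: (u n) (u m) => [? ?] [].
exists (Complex a b) => e e0; have e2 : 0 < e / 2 by rewrite divr_gt0.
have [N NP] := aP _ e2; have [M MP] := bP _ e2.
exists (maxn N M) => n; rewrite geq_max => /andP[/NP un /MP vn].
have [_ _ /le_lt_trans] := absE (u n - Complex a b); apply.
by case: (u n) un vn => p q /=; lra.
Qed.

End Completeness.

Lemma geometric_small (R : realType) (C e : R) : 0 < e ->
  exists N, forall n, (N <= n)%N -> C / 2 ^+ n < e.
Proof.
move=> e0; exists (Num.truncn (C / e)).+1 => n Nn.
have p0 : 0 < 2 ^+ n :> R by rewrite exprn_gt0.
rewrite ltr_pdivrMr// mulrC -ltr_pdivrMr//; apply: lt_trans (truncnS_gt _) _.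
by rewrite -natrX ltr_nat (leq_ltn_trans Nn)// ltn_expl.
Qed.

Section LimitExpansion.
Context {R : realType} {k : scalar_kind} {X : normedModType (scalars R k)}.
Notation F := (scalars R k).
Variable x : nat -> X.
Hypothesis x_neq0 : forall j, x j != 0.

Lemma coefficient_le (a : nat -> F) r j :
  (forall n, nrm (\sum_(i < n) a i *: x i) <= r) -> abs (a j) * nrm (x j) <= 2 * r.
Proof.
move=> ar; have := ler_nrmB (\sum_(i < j.+1) a i *: x i) (\sum_(i < j) a i *: x i).
have := ar j; have := ar j.+1.
by rewrite big_ord_recr /= [X in nrm (X - _)]addrC addrK nrmZ; lra.
Qed.

(** The coefficients converge one by one, and the uniform Cauchy condition lets
one exchange the two limits. *)
Lemma expands_limit (a : nat -> nat -> F) (g : nat -> X) (f : X) :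
  (forall i, expands_to x (a i) (g i)) -> tends g f ->
  (forall e : R, 0 < e -> exists I, forall i l, (I <= i)%N -> (i <= l)%N ->
     forall n, nrm (\sum_(j < n) (a l j - a i j) *: x j) <= e) ->
  exists2 b, expands_to x b f &
    forall n, tends (fun i => \sum_(j < n) a i j *: x j) (\sum_(j < n) b j *: x j).
Proof.
move=> ag gf aC.
have x0 j : 0 < nrm (x j) by rewrite nrm_gt0.
have /choice[b bP] : forall j, exists l, forall e, 0 < e -> exists I, forall i,
    (I <= i)%N -> abs (a i j - l) < e.
  move=> j; apply: scalar_cauchy => e e0.
  have [I IP] := aC (e * nrm (x j) / 4) (divr_gt0 (mulr_gt0 e0 (x0 j)) (ltr0n R 4)).
  exists I => i l Ii il; rewrite -(ltr_pM2r (x0 j)).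
  apply: le_lt_trans (coefficient_le (a := fun j => a l j - a i j) j (IP i l Ii il)) _.
  by have := mulr_gt0 e0 (x0 j); lra.
have bT n : tends (fun i => \sum_(j < n) a i j *: x j) (\sum_(j < n) b j *: x j).
  elim: n => [|n IH].
    by apply: (tends_eq (N := 0) _ (tends_cst _)) => i _; rewrite !big_ord0.
  rewrite big_ord_recr /=; apply: (tends_eq (N := 0)
    (u := fun i => \sum_(j < n) a i j *: x j + a i n *: x n)).
    by move=> i _; rewrite big_ord_recr.
  apply: tendsD => // e e0.
  have [I IP] := bP n _ (divr_gt0 e0 (x0 n)); exists I => i /IP.
  by rewrite -scalerBl nrmZ ltr_pdivlMr.
exists b => //; apply/expandsP => e e0; have e4 : 0 < e / 4 by rewrite divr_gt0.
have [I IP] := aC _ e4; have [J JP] := gf _ e4; pose i := maxn I J.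
have [N NP] := (expandsP x (a i) (g i)).1 (ag i) _ e4; exists N => n Nn.
have H1 : nrm (\sum_(j < n) b j *: x j - \sum_(j < n) a i j *: x j) <= e / 4.
  apply: (nrm_tends_le (N := i) (tendsD (bT n) (tends_cst (- \sum_(j < n) a i j *: x j)))).
  move=> l il; have := IP i l (leq_maxl _ _) il n.
  by under eq_bigr do rewrite scalerBl; rewrite sumrB.
have H2 := NP n Nn; have H3 := JP i (leq_maxr _ _).
have := ler_nrmD (\sum_(j < n) b j *: x j - \sum_(j < n) a i j *: x j) (\sum_(j < n) a i j *: x j - g i).
have := ler_nrmD (\sum_(j < n) b j *: x j - g i) (g i - f).
rewrite !addrA !subrK; lra.
Qed.

End LimitExpansion.

Section BasisConstant.
Context {R : realType} {k : scalar_kind} {X : completeNormedModType (scalars R k)}.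
Notation F := (scalars R k).
Variable x : nat -> X.
Hypothesis xB : schauder_basis x.
Notation S := (partial_sum x).

(** These sets are convex, symmetric, and cover the space as r grows. *)
Definition bounded_sums (r : R) (f : X) := forall N, nrm (S N f) <= r.

Lemma bounded_sums_exists f : exists n : nat, bounded_sums n%:R f.
Proof.
have [N NP] := tends_partial_sum xB f (ltr01 : 0 < 1 :> R).
pose b := \sum_(j < N) nrm (S j f) + (nrm f + 1).
have b0 : 0 <= b by rewrite !addr_ge0 ?nrm_ge0// sumr_ge0// => j _; exact: nrm_ge0.
exists (Num.truncn b).+1 => n; apply: le_trans (ltW (truncnS_gt b)).
have [nN|Nn] := ltnP n N.
  rewrite /b (bigD1 (Ordinal nN))//= -addrA lerDl addr_ge0 ?addr_ge0 ?nrm_ge0//.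
  by rewrite sumr_ge0// => j _; exact: nrm_ge0.
have := ler_nrmD (S n f - f) f; rewrite subrK => /le_trans; apply.
rewrite /b addrC ler_wpDl ?sumr_ge0// => [j _|]; first exact: nrm_ge0.
by rewrite lerD2l ltW// NP.
Qed.

Lemma bounded_sums_lin c f g r s : bounded_sums r f -> bounded_sums s g ->
  bounded_sums (abs c * r + s) (c *: f + g).
Proof.
move=> fr gs N; rewrite (partial_sum_lin xB) (le_trans (ler_nrmD _ _))//.
by rewrite lerD// nrmZ ler_wpM2l ?abs_ge0.
Qed.

Lemma bounded_sums0 : bounded_sums 0 0.
Proof.
move=> N; rewrite /partial_sum big1 ?nrm0// => j _.
by have := coordinate_finite xB (fun=> 0) 0 j; rewrite big_ord0 => ->; rewrite scale0r.
Qed.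

Lemma bounded_sumsZ c f r : bounded_sums r f -> bounded_sums (abs c * r) (c *: f).
Proof. by move=> /(bounded_sums_lin c)/(_ bounded_sums0); rewrite !addr0. Qed.

(** Baire's argument.  Otherwise there are nested balls, with radii tending to
0, the n-th one avoiding the vectors with partial sums bounded by n; but the
partial sums of the common point of the balls are bounded. *)
Lemma bounded_sums_dense_in_ball : exists (n : nat) (f : X) (r : R), 0 < r /\
  forall g, nrm (g - f) < r -> forall e, 0 < e ->
    exists2 b, bounded_sums n%:R b & nrm (g - b) < e.
Proof.
apply: contrapT => noball.
pose P (nq : nat * (X * R)) (q' : X * R) := 0 < nq.2.2 ->
  [/\ 0 < q'.2, q'.2 <= nq.2.2 / 2, nrm (q'.1 - nq.2.1) + q'.2 <= nq.2.2 &
      forall b, bounded_sums nq.1%:R b -> q'.2 < nrm (q'.1 - b)].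
have /choice[next nextP] : forall nq, exists q', P nq q'.
  move=> [n [f r]]; rewrite /P /=; have [r0|r0] := pselect (0 < r); last by exists (f, r).
  have [g [gf [e [e0 ge]]]] : exists g, nrm (g - f) < r /\
      exists e, 0 < e /\ forall b, bounded_sums n%:R b -> e <= nrm (g - b).
    apply: contrapT => H; apply: noball; exists n, f, r; split=> // g gf e e0.
    apply: contrapT => H'; apply: H; exists g; split=> //; exists e; split=> // b bn.
    by rewrite leNgt; apply/negP => gb; apply: H'; exists b.
  have m0 : 0 < Num.min e (r - nrm (g - f)) by rewrite lt_min e0 subr_gt0.
  (* Half the room that is left, both to the sphere and to the avoided set. *)
  exists (g, Num.min e (r - nrm (g - f)) / 2) => _ /=.
  have me : Num.min e (r - nrm (g - f)) <= e by rewrite ge_min lexx.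
  have mr : Num.min e (r - nrm (g - f)) <= r - nrm (g - f) by rewrite ge_min lexx orbT.
  have := nrm_ge0 (g - f); split; [lra|lra|lra|move=> b /ge; lra].
pose q := fix q n := if n is n'.+1 then next (n', q n') else (0 : X, 1 : R).
have q0 n : 0 < (q n).2.
  by elim: n => [//|n IH]; have [] := nextP (n, q n) IH.
have qS n := nextP (n, q n) (q0 n); rewrite /= in qS.
have qhalf n : (q n).2 <= 1 / 2 ^+ n.
  elim: n => [|n IH]; first by rewrite expr0 divr1.
  have [_ + _ _] := qS n; move=> /le_trans; apply.
  by rewrite exprSr invfM mulrA ler_pM2r ?invr_gt0.
have qball n m : (n <= m)%N -> nrm ((q m).1 - (q n).1) + (q m).2 <= (q n).2.
  elim: m => [|m IH]; first by rewrite leqn0 => /eqP->; rewrite subrr nrm0 add0r.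
  rewrite leq_eqVlt => /orP[/eqP->|]; first by rewrite subrr nrm0 add0r.
  rewrite ltnS => /IH H; have [_ _ H' _] := qS m.
  have := ler_nrmD ((q m.+1).1 - (q m).1) ((q m).1 - (q n).1).
  by rewrite addrA subrK /=; lra.
have [|l ql] := @cauchy_tends R k X (fun n => (q n).1).
  move=> e e0; have [N NP] := geometric_small 1 e0; exists N => m n Nm mn.
  have := qball m n mn; have := qhalf m; have := NP m Nm; have := q0 n.
  by lra.
have lq n : nrm (l - (q n).1) <= (q n).2.
  apply: (nrm_tends_le (N := n) (tendsD ql (tends_cst (- (q n).1)))) => m nm.
  by have := qball n m nm; have := q0 m; lra.
have [n nl] := bounded_sums_exists l.
have [_ _ _ /(_ l nl)] := qS n.
by have := lq n.+1; rewrite nrmB /= => H /lt_le_trans/(_ H); rewrite ltxx.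
Qed.

(** By symmetry and convexity the ball may be centered at the origin, and by
homogeneity the bound may be taken proportional to the norm. *)
Lemma bounded_sums_dense : exists2 M, 0 < M & forall g e, 0 < e ->
  exists2 b, bounded_sums (M * nrm g) b & nrm (g - b) < e.
Proof.
have [n [f [r [r0 nf]]]] := bounded_sums_dense_in_ball.
have small g : nrm g < r -> forall e, 0 < e ->
    exists2 b, bounded_sums (2 * n%:R) b & nrm (g - b) < e.
  move=> gr e e0; have e2 : 0 < e / 2 by rewrite divr_gt0.
  have [|b1 b1n b1e] := nf (f + g) _ _ e2; first by rewrite addrAC subrr add0r.
  have [|b2 b2n b2e] := nf f _ _ e2; first by rewrite subrr nrm0.
  exists (-1 *: b2 + b1).
    by have := bounded_sums_lin (-1) b2n b1n; rewrite absN abs1 mul1r mulr_natl mulr2n.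
  rewrite scaleN1r; have := ler_nrmB (f + g - b1) (f - b2).
  by rewrite (_ : f + g - b1 - (f - b2) = g - (- b2 + b1));
    [lra|by rewrite opprB addrC -!addrA addKr opprD opprK addrCA].
exists (4 * n%:R / r + 1); first by rewrite ltr_wpDl// divr_ge0 ?mulr_ge0// ltW.
move=> g e e0; have [->|g0] := eqVneq g 0.
  by exists 0; rewrite ?subrr ?nrm0 ?mulr0//; exact: bounded_sums0.
have ng : 0 < nrm g by rewrite nrm_gt0.
pose c := r / (2 * nrm g); have c0 : 0 < c by rewrite divr_gt0 ?mulr_gt0.
have [|b bn be] := small (emb c *: g) _ (c * e) (mulr_gt0 c0 e0).
  rewrite nrmZ abs_emb gtr0_norm// /c invfM mulrA mulfVK ?gt_eqF//.
  by rewrite ltr_pdivrMr// ltr_pMr// ltr1n.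
have ec : emb c != 0 :> F by rewrite emb_neq0// gt_eqF.
exists ((emb c)^-1 *: b).
  move=> N; apply: le_trans (bounded_sumsZ (emb c)^-1 bn N) _.
  rewrite -fmorphV abs_emb gtr0_norm ?invr_gt0//
    /c invf_div [leRHS]mulrDl mul1r ler_wpDr ?nrm_ge0//.
  by rewrite le_eqVlt; apply/orP; left; apply/eqP; field; rewrite gt_eqF.
have -> : g - (emb c)^-1 *: b = (emb c)^-1 *: (emb c *: g - b).
  by rewrite scalerBr scalerA mulVf// scale1r.
by rewrite nrmZ -fmorphV abs_emb gtr0_norm ?invr_gt0// mulrC ltr_pdivrMr// mulrC.
Qed.

(** As in the open mapping theorem: g is approximated successively, with
errors halved at each step, by vectors b_n with controlled partial sums.  The
partial sums of the series of the b_n then converge uniformly, so that the limit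
of the expansions is the expansion of g. *)
Lemma partial_sum_bounded : exists2 M, 0 < M & forall g N, nrm (S N g) <= M * nrm g.
Proof.
have [M M0 dense] := bounded_sums_dense.
exists (2 * M); first by rewrite mulr_gt0.
move=> g; have [->|g0] := eqVneq g 0.
  by move=> N; rewrite nrm0 mulr0; exact: bounded_sums0.
have ng : 0 < nrm g by rewrite nrm_gt0.
set rho := nrm g in ng *.
pose P (nh : nat * X) (b : X) := nrm nh.2 <= rho / 2 ^+ nh.1 ->
  bounded_sums (M * (rho / 2 ^+ nh.1)) b /\ nrm (nh.2 - b) <= rho / 2 ^+ nh.1.+1.
have /choice[pick pickP] : forall nh, exists b, P nh b.
  move=> [n h]; rewrite /P /=.
  have e0 : 0 < rho / 2 ^+ n.+1 by rewrite divr_gt0// exprn_gt0.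
  have [b bh he] := dense h _ e0; exists b => hn; split; last exact: ltW.
  by move=> N; rewrite (le_trans (bh N))// ler_pM2l.
pose h := fix h n := if n is n'.+1 then h n' - pick (n', h n') else g.
have hn n : nrm (h n) <= rho / 2 ^+ n.
  by elim: n => [|n IH]; [rewrite expr0 divr1|have [] := pickP (n, h n) IH].
pose b n := pick (n, h n).
have bn n : bounded_sums (M * (rho / 2 ^+ n)) (b n) by have [] := pickP (n, h n) (hn n).
pose s n := \sum_(i < n) b i.
have sE n : g - s n = h n.
  elim: n => [|n IH]; first by rewrite /s big_ord0 subr0.
  by rewrite /s big_ord_recr /= opprD addrA IH.
have tail m n : (m <= n)%N -> bounded_sums (2 * M * rho / 2 ^+ m - 2 * M * rho / 2 ^+ n) (s n - s m).
  elim: n => [|n IH]; first by rewrite leqn0 => /eqP->; rewrite !subrr; exact: bounded_sums0.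
  rewrite leq_eqVlt => /orP[/eqP->|]; first by rewrite !subrr; exact: bounded_sums0.
  rewrite ltnS => /IH H N; have := bounded_sums_lin 1 (bn n) H N.
  have -> : s n.+1 - s m = b n + (s n - s m).
    by rewrite {1}/s big_ord_recr /= -/(s n) addrAC addrC.
  rewrite scale1r abs1 mul1r => /le_trans; apply.
  rewrite le_eqVlt; apply/orP; left; apply/eqP; rewrite exprS.
  by field; rewrite ?expf_neq0.
have tail_le m n : (m <= n)%N -> bounded_sums (2 * M * rho / 2 ^+ m) (s n - s m).
  move=> mn N; rewrite (le_trans (tail m n mn N))// gerBl divr_ge0 ?mulr_ge0// ltW//.
have coordB f f' j : coordinate x (f - f') j = coordinate x f j - coordinate x f' j.
  by rewrite addrC -scaleN1r (coordinate_lin xB) mulN1r addrC.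
have C0 : 0 <= 2 * M * rho by rewrite !mulr_ge0// ltW.
have [||a ag aT] := @expands_limit R k X x (basis_neq0 xB) (fun i => coordinate x (s i)) s g
    (fun i => coordinateP xB (s i)).
- move=> e e0; have [I IP] := geometric_small rho e0; exists I => i /IP.
  by rewrite nrmB sE; apply: le_lt_trans.
- move=> e e0; have [I IP] := geometric_small (2 * M * rho) e0.
  exists I => i l Ii il n; apply: le_trans (ltW (IP i Ii)); apply: le_trans (tail_le i l il n).
  by rewrite le_eqVlt; apply/orP; left; apply/eqP; congr nrm; apply: eq_bigr => j _; rewrite coordB.
move=> N; rewrite /partial_sum (coordinate_unique xB ag).
apply: (nrm_tends_le (N := 0) (aT N)) => n _.
by have := tail_le 0%N n (leq0n n) N; rewrite {2}/s big_ord0 subr0 expr0 divr1.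
Qed.

Lemma basis_constant : exists2 K, 0 < K & forall m n (a : nat -> F), (m <= n)%N ->
  nrm (\sum_(j < m) a j *: x j) <= K * nrm (\sum_(j < n) a j *: x j).
Proof.
have [M M0 MP] := partial_sum_bounded; exists M => // m n a mn.
apply: le_trans (MP _ m); rewrite le_eqVlt; apply/orP; left; apply/eqP; congr nrm.
apply: eq_bigr => j _; rewrite (coordinate_finite xB a).
by rewrite (leq_trans (ltn_ord j) mn).
Qed.

End BasisConstant.

(** Existence comes from approximants, whose expansions are uniformly Cauchy by
the basis constant; uniqueness because all partial sums of an expansion of 0
are bounded by the late ones. *)
Lemma schauder_of_dense (R : realType) (k : scalar_kind) (X : normedModType (scalars R k))
  (x : nat -> X) (K : R) : (forall j, x j != 0) ->
  (forall m n (a : nat -> scalars R k), (m <= n)%N ->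
     nrm (\sum_(j < m) a j *: x j) <= K * nrm (\sum_(j < n) a j *: x j)) ->
  (forall f e, 0 < e -> exists n (a : nat -> scalars R k),
     nrm (f - \sum_(j < n) a j *: x j) < e) ->
  schauder_basis x.
Proof.
move=> x0 xK dense f.
have K0 : 0 < K.
  have := xK 1%N 1%N (fun=> 1) (leqnn 1); rewrite big_ord1 scale1r.
  by have := x0 0%N; rewrite -nrm_gt0 => n0; rewrite -{1}[nrm _]mul1r ler_pM2r//; lra.
have expand : exists a, expands_to x a f.
  have /choice[na naP] : forall i : nat, exists na : nat * (nat -> scalars R k),
      nrm (f - \sum_(j < na.1) na.2 j *: x j) < 1 / 2 ^+ i.
    move=> i; have e0 : 0 < 1 / 2 ^+ i :> R by rewrite divr_gt0// exprn_gt0.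
    by have [n [a na]] := dense f _ e0; exists (n, a).
  pose g i := \sum_(j < (na i).1) (na i).2 j *: x j.
  have [||a af _] := expands_limit x0 (fun i => expands_finite x (na i).2 (na i).1) (f := f).
  - move=> e e0; have [I IP] := geometric_small 1 e0; exists I => i /IP.
    by rewrite nrmB; apply: lt_trans.
  - move=> e e0; have [I IP] := geometric_small 1 (divr_gt0 e0 (mulr_gt0 (ltr0n R 2) K0)).
    exists I => i l Ii il n; pose b j := (if (j < (na l).1)%N then (na l).2 j else 0) -
      (if (j < (na i).1)%N then (na i).2 j else 0).
    pose M := maxn n (maxn (na l).1 (na i).1).
    have bE : \sum_(j < M) b j *: x j = g l - g i.
      rewrite /b; under eq_bigr do rewrite scalerBl; rewrite sumrB; congr (_ - _); rewrite /g.
        rewrite (big_ord_widen M (fun j => (na l).2 j *: x j)) ?leq_max ?leqnn ?orbT//.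
        by rewrite [RHS]big_mkcond; apply: eq_bigr => j _; case: ifP; rewrite ?scale0r.
      rewrite (big_ord_widen M (fun j => (na i).2 j *: x j)) ?leq_max ?leqnn ?orbT//.
      by rewrite [RHS]big_mkcond; apply: eq_bigr => j _; case: ifP; rewrite ?scale0r.
    apply: le_trans (xK n M b (leq_maxl _ _)) _; rewrite bE.
    have := naP l; have := naP i; rewrite -!/(g _) => H1 H2.
    have := IP i Ii; have := IP l (leq_trans Ii il); rewrite ltr_pdivlMr ?mulr_gt0// => H3.
    rewrite ltr_pdivlMr ?mulr_gt0// => H4.
    have := ler_nrmB (f - g i) (f - g l); rewrite opprB [f - g i + _]addrC addrA subrK => H5.
    have H6 := ler_wpM2l (ltW K0) (le_trans H5 (ltW (ltrD H1 H2))).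
    by rewrite (le_trans H6)//; lra.
  by exists a.
have [a af] := expand; exists a; split=> // b bf.
have : expands_to x (fun j => -1 * a j + b j) 0.
  by have := expands_lin (c := -1) af bf; rewrite scaleN1r addNr.
move=> /expandsP ab0; apply/funext => j.
suff : abs (- a j + b j) * nrm (x j) <= 2 * 0.
  rewrite mulr0 pmulr_lle0 ?nrm_gt0// => ab; apply/esym/eqP; rewrite -subr_eq0 addrC.
  by rewrite -abs_eq0 eq_le ab abs_ge0.
apply: (coefficient_le (a := fun j => - a j + b j)) => n.
apply/ler_addgt0Pr => e e0; rewrite add0r.
have [N NP] := ab0 _ (divr_gt0 e0 K0); pose m := maxn n N.
rewrite (le_trans (xK n m (fun j => - a j + b j) (leq_maxl _ _)))// mulrC -ler_pdivlMr//.
by have := NP m (leq_maxr _ _); rewrite subr0; under eq_bigr do rewrite mulN1r; exact: ltW.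
Qed.

(** * Bounded linear maps *)

Section BoundedMaps.
Context {R : realType} {k : scalar_kind}.
Notation F := (scalars R k).

Definition bounded_map (V W : normedModType F) (T : V -> W) :=
  exists2 C : R, 0 <= C & forall f, nrm (T f) <= C * nrm f.

Lemma continuous_bounded_map (V W : normedModType F) (T : {linear V -> W}) :
  continuous T -> bounded_map T.
Proof.
move=> /linear_bounded_continuous/linear_boundedP/pinfty_ex_gt0[r /emb_gt0[s s0 ->] TP].
exists s; first exact: ltW.
by move=> f; have := TP f; rewrite !norm_emb -rmorphM emb_le.
Qed.

Lemma bounded_mapD (V W : normedModType F) (T U : V -> W) :
  bounded_map T -> bounded_map U -> bounded_map (T \+ U).
Proof.
move=> [C C0 CT] [D D0 DU]; exists (C + D); first exact: addr_ge0.
by move=> f; rewrite /= (le_trans (ler_nrmD _ _))// mulrDl lerD.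
Qed.

Lemma bounded_mapN (V W : normedModType F) (T : V -> W) :
  bounded_map T -> bounded_map (\- T).
Proof. by move=> [C C0 CT]; exists C => // f; rewrite /= nrmN. Qed.

Lemma bounded_map_comp (U V W : normedModType F) (T : V -> W) (T' : U -> V) :
  bounded_map T -> bounded_map T' -> bounded_map (T \o T').
Proof.
move=> [C C0 CT] [D D0 DT']; exists (C * D); first exact: mulr_ge0.
by move=> f; rewrite /= (le_trans (CT _))// -mulrA ler_wpM2l.
Qed.

Lemma bounded_map_id (V : normedModType F) : bounded_map (@idfun V).
Proof. by exists 1 => // f; rewrite mul1r. Qed.

Lemma bounded_map_tends (V W : normedModType F) (T : {linear V -> W}) (u : nat -> V) f :
  bounded_map T -> tends u f -> tends (T \o u) (T f).
Proof.
move=> [C C0 CT] uf e e0; have C1 : 0 < C + 1 by rewrite ltr_wpDl.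
have [N NP] := uf _ (divr_gt0 e0 C1); exists N => n /NP; rewrite ltr_pdivlMr// => H.
rewrite /= -linearB; apply: le_lt_trans (CT _) (le_lt_trans _ H).
by rewrite mulrC ler_wpM2l ?nrm_ge0// lerDl.
Qed.

Section OnBasis.
Context {V : normedModType F} {e : nat -> V}.
Hypothesis eB : schauder_basis e.

Lemma bounded_linear_ext (W : normedModType F) (T U : {linear V -> W}) :
  bounded_map T -> bounded_map U -> (forall j, T (e j) = U (e j)) -> T =1 U.
Proof.
move=> Tb Ub TU f; have fS := tends_partial_sum eB f.
apply: tends_unique (bounded_map_tends Tb fS) _.
apply: (tends_eq (N := 0) _ (bounded_map_tends Ub fS)) => n _ /=.
rewrite !linear_sum; apply: eq_bigr => j _; rewrite !linearZ.
by rewrite /= TU.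
Qed.

(** The image of f is the limit of the images of its partial sums. *)
Lemma linear_extension (W : completeNormedModType F) (w : nat -> W) (C : R) : 0 <= C ->
  (forall n (a : nat -> F),
     nrm (\sum_(j < n) a j *: w j) <= C * nrm (\sum_(j < n) a j *: e j)) ->
  exists2 T : {linear V -> W}, bounded_map T & forall j, T (e j) = w j.
Proof.
move=> C0 wC; have C1 : 0 < C + 1 by rewrite ltr_wpDl.
pose u f n := \sum_(j < n) coordinate e f j *: w j.
have /choice[T TP] : forall f, exists l, tends (u f) l.
  move=> f; apply: cauchy_tends => r r0.
  have r2 : 0 < r / (C + 1) / 2 by rewrite !divr_gt0.
  have [N NP] := tends_partial_sum eB f r2; exists N => m n Nm mn.
  pose b j := if (j < m)%N then 0 else coordinate e f j.
  have bE (M : normedModType F) (z : nat -> M) : \sum_(j < n) b j *: z j =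
      \sum_(j < n) coordinate e f j *: z j - \sum_(j < m) coordinate e f j *: z j.
    rewrite (big_ord_widen n (fun j => coordinate e f j *: z j) mn) [X in _ - X]big_mkcond.
    rewrite -sumrB; apply: eq_bigr => j _; rewrite /b.
    by case: ifP; rewrite ?scale0r ?subrr ?subr0.
  rewrite /u -bE; apply: le_lt_trans (wC n b) _; rewrite bE.
  have H1 := NP n (leq_trans Nm mn); have H2 := NP m Nm.
  have := ler_nrmB (partial_sum e n f - f) (partial_sum e m f - f).
  rewrite opprB addrA subrK => H3.
  have {}H3 : nrm (partial_sum e n f - partial_sum e m f) < r / (C + 1) by lra.
  apply: le_lt_trans (_ : (C + 1) * (nrm (partial_sum e n f - partial_sum e m f)) < _).
    by rewrite ler_wpM2r ?nrm_ge0// lerDl.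
  by rewrite mulrC -ltr_pdivlMr.
have Tlin : linear T.
  move=> c f g; apply: tends_unique (TP _) _.
  apply: (tends_eq (N := 0) _ (tendsD (tendsZ c (TP f)) (TP g))) => n _.
  rewrite /u scaler_sumr -big_split /=; apply: eq_bigr => j _.
  by rewrite (coordinate_lin eB) scalerDl scalerA.
have Te j : T (e j) = w j.
  apply: tends_unique (TP _) _; apply: (tends_eq (N := j.+1) _ (tends_cst _)) => n jn.
  rewrite /u (bigD1 (Ordinal jn))//= (coordinate_basis eB) eqxx scale1r big1 ?addr0// => i ij.
  rewrite (coordinate_basis eB) (_ : (i == j :> nat) = false) ?scale0r//.
  by apply: contra_neqF ij => /eqP ij; apply: val_inj.
pose T' : {linear V -> W} := HB.pack T (GRing.isLinear.Build _ _ _ _ T Tlin).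
exists T' => //; exists C => // f.
apply/ler_addgt0Pr => r r0.
have [N NP] := tends_partial_sum eB f (divr_gt0 r0 C1).
apply: (nrm_tends_le (N := N) (TP f)) => n Nn; apply: le_trans (wC n _) _.
have := NP n Nn; rewrite ltr_pdivlMr// => H.
have := ler_nrmD (partial_sum e n f - f) f; rewrite subrK => H1.
have := ler_wpM2l C0 H1; have := nrm_ge0 (partial_sum e n f - f).
by rewrite -/(partial_sum e n f); move: H; lra.
Qed.

End OnBasis.
End BoundedMaps.

(** * A self-similar partition of the indices *)

(** Writing j + 1 in base 2, skip0 inserts a digit 0 after the leading digit and
skip1 inserts a digit 1.  This splits the positive indices into two copies of
all the indices. *)
Definition skip0 (j : nat) : nat := (j + 2 ^ level j)%N.
Definition skip1 (j : nat) : nat := (j + 2 ^ (level j).+1)%N.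

Lemma level_bounds j : ((2 ^ level j).-1 <= j < (2 ^ (level j).+1).-1)%N.
Proof. by rewrite levelP. Qed.

Lemma level_eq l j : ((2 ^ l).-1 <= j < (2 ^ l.+1).-1)%N -> level j = l.
Proof. by rewrite levelP => /eqP. Qed.

Lemma leq_level i j : (i <= j)%N -> (level i <= level j)%N.
Proof. by move=> ij; apply: leq_trunc_log. Qed.

Lemma skip0_mono : {homo skip0 : i j / (i < j)%N}.
Proof.
move=> i j ij; rewrite /skip0.
by have := leq_pexp2l (isT : 0 < 2)%N (leq_level (ltnW ij)); lia.
Qed.

Lemma skip1_mono : {homo skip1 : i j / (i < j)%N}.
Proof.
move=> i j ij; rewrite /skip1 !expnS.
by have := leq_pexp2l (isT : 0 < 2)%N (leq_level (ltnW ij)); lia.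
Qed.

Lemma level_skip0 j : level (skip0 j) = (level j).+1.
Proof. by apply: level_eq; have := level_bounds j; rewrite /skip0 !expnS;
  have := expn_gt0 2 (level j); lia. Qed.

Lemma level_skip1 j : level (skip1 j) = (level j).+1.
Proof. by apply: level_eq; have := level_bounds j; rewrite /skip1 !expnS;
  have := expn_gt0 2 (level j); lia. Qed.

Lemma skip0_neq_skip1 i j : skip0 i != skip1 j.
Proof.
apply/eqP => ij; have := level_skip0 i; rewrite ij level_skip1 => -[lij].
move: ij; rewrite /skip0 /skip1 lij expnS.
by have := level_bounds i; have := level_bounds j; rewrite lij !expnS; lia.
Qed.

Lemma skip0_neq0 i : skip0 i != 0%N.
Proof. by rewrite /skip0; have := expn_gt0 2 (level i); lia. Qed.

Lemma skip1_neq0 i : skip1 i != 0%N.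
Proof. by rewrite /skip1; have := expn_gt0 2 (level i).+1; lia. Qed.

Variant skip_spec : nat -> Prop :=
| Skip_zero : skip_spec 0
| Skip_skip0 i : skip_spec (skip0 i)
| Skip_skip1 i : skip_spec (skip1 i).

Lemma skipP j : skip_spec j.
Proof.
have := level_bounds j; case lE: (level j) => [|l].
  by rewrite expn1 /= ltnS leqn0 => /eqP->; constructor.
rewrite !expnS; have l0 := expn_gt0 2 l => jl.
have [jlo|jhi] := ltnP j (3 * 2 ^ l).-1.
  have li : level (j - 2 ^ l) = l by apply: level_eq; rewrite expnS; lia.
  have -> : j = skip0 (j - 2 ^ l) by rewrite /skip0 li; lia.
  by constructor.
have li : level (j - 2 ^ l.+1) = l by apply: level_eq; rewrite expnS; lia.
have -> : j = skip1 (j - 2 ^ l.+1) by rewrite /skip1 li expnS; lia.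
by constructor.
Qed.

(** The number with the complementary binary digits of j + 1.  Its leading
digit stands at the first digit 0 of j + 1, and a further digit 1 in front does
not change it. *)
Definition depth (j : nat) : nat := ((2 ^ (level j).+1).-2 - j)%N.

(** The interval of j consists of the indices of the same level whose digits
agree with those of j + 1 up to the first digit 0 included; it is a single point
if all the digits are 1.  Thus skip1 maps intervals onto intervals, and the
intervals in the range of skip0 are the images of the dyadic blocks. *)
Definition nested_size (j : nat) : nat :=
  if depth j == 0%N then 1%N else (2 ^ trunc_log 2 (depth j))%N.

Definition nested_start (j : nat) : nat :=
  if depth j == 0%N then j else (2 ^ (level j).+1 - 1 - 2 ^ (trunc_log 2 (depth j)).+1)%N.

Lemma depth_skip1 j : depth (skip1 j) = depth j.
Proof.
rewrite /depth level_skip1 /skip1 !expnS.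
by have := level_bounds j; rewrite expnS; have := expn_gt0 2 (level j); lia.
Qed.

Lemma depth_skip0 j : depth (skip0 j) = (2 ^ level j + depth j)%N.
Proof.
rewrite /depth level_skip0 /skip0 !expnS.
by have := level_bounds j; rewrite expnS; have := expn_gt0 2 (level j); lia.
Qed.

Lemma depth_lt j : (depth j < 2 ^ level j)%N.
Proof.
rewrite /depth; have := level_bounds j; rewrite expnS.
by have := expn_gt0 2 (level j); lia.
Qed.

Lemma trunc_log_depth_skip0 j : trunc_log 2 (depth (skip0 j)) = level j.
Proof.
apply: trunc_log_eq => //; rewrite depth_skip0 expnS; have := depth_lt j; lia.
Qed.

Lemma nested_size_skip0 j : nested_size (skip0 j) = (2 ^ level j)%N.
Proof.
rewrite /nested_size trunc_log_depth_skip0 depth_skip0 ifF//.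
by have := expn_gt0 2 (level j); lia.
Qed.

Lemma nested_start_skip0 j : nested_start (skip0 j) = skip0 (2 ^ level j).-1.
Proof.
have lE : level (2 ^ level j).-1 = level j.
  by rewrite -[X in level X]addn0 level_start// expn_gt0.
rewrite /nested_start trunc_log_depth_skip0 depth_skip0 ifF.
  by rewrite level_skip0 /skip0 lE !expnS; have := expn_gt0 2 (level j); lia.
by have := expn_gt0 2 (level j); lia.
Qed.

Lemma nested_size_skip1 j : nested_size (skip1 j) = nested_size j.
Proof. by rewrite /nested_size depth_skip1. Qed.

Lemma depth_bounds j (t := trunc_log 2 (depth j)) : depth j != 0%N ->
  (2 ^ t <= depth j < 2 * 2 ^ t)%N /\ (2 * 2 ^ t <= 2 ^ level j)%N.
Proof.
move=> d0; have d1 : (0 < depth j)%N by rewrite lt0n.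
rewrite -expnS; have td : (2 ^ t <= depth j < 2 ^ t.+1)%N by exact: trunc_log_bounds.
split=> //; rewrite leq_exp2l// ltnNge; apply/negP => lt.
by have := leq_pexp2l (isT : 0 < 2)%N lt; have := depth_lt j; lia.
Qed.

Lemma nested_block j i : (nested_start j <= i < nested_start j + nested_size j)%N ->
  [/\ level i = level j, nested_start i = nested_start j & nested_size i = nested_size j].
Proof.
rewrite /nested_start /nested_size; have lb := level_bounds j.
case: eqVneq => [d0|d0]; first by move=> ij; have -> : i = j by [lia]; rewrite d0.
have [] := depth_bounds d0; set t := trunc_log 2 (depth j); rewrite !expnS => td tl ij.
move: lb; rewrite expnS => lb.
have li : level i = level j by apply: level_eq; rewrite expnS; lia.
have di : (2 ^ t <= depth i < 2 ^ t.+1)%N by rewrite /depth li !expnS; lia.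
have -> : (depth i == 0%N) = false by have := expn_gt0 2 t; lia.
by rewrite (trunc_log_eq _ di)// li ?expnS.
Qed.

Lemma nested_partition : interval_partition nested_start nested_size.
Proof.
split=> [j|j|j i /nested_block[]|j i /nested_block[]]//;
  rewrite /nested_start ?/nested_size; case: eqVneq => [_|d0]; try lia;
  have [] := depth_bounds d0; set t := trunc_log 2 (depth j);
  by rewrite /depth !expnS; have := level_bounds j; rewrite expnS; lia.
Qed.

Lemma nested_start_skip1 j i : (i < nested_size j)%N ->
  (nested_start (skip1 j) + i = skip1 (nested_start j + i))%N.
Proof.
move=> ij; have [|l _ _] := @nested_block j (nested_start j + i).
  by rewrite leq_addr ltn_add2l.
rewrite {2}/skip1 l /nested_start depth_skip1 level_skip1.
case: eqVneq => [d0|d0]; first by rewrite /skip1; lia.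
have [] := depth_bounds d0; set t := trunc_log 2 (depth j); rewrite !expnS; lia.
Qed.

(** * Absorbing the block-centered part *)

Section Operators.
Context {R : realType} {k : scalar_kind} {S : completeNormedModType (scalars R k)}.
Notation F := (scalars R k).
Variable e : nat -> S.
Hypothesis eS : sign_invariant_spreading e.
Hypothesis eB : schauder_basis e.

Lemma spreading_map (phi : nat -> nat) : {homo phi : i j / (i < j)%N} ->
  exists2 T : {linear S -> S}, bounded_map T & forall j, T (e j) = e (phi j).
Proof.
move=> phiI; apply: (linear_extension eB (w := e \o phi) (C := 1)) => // n a.
by rewrite mul1r (snorm_spread eS).
Qed.

Lemma homo_leq_self (phi : nat -> nat) : {homo phi : i j / (i < j)%N} -> forall i, (i <= phi i)%N.
Proof. by move=> phiI; elim=> // i IH; apply: leq_ltn_trans IH (phiI _ _ _). Qed.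

(** On finite sums the map forgets the entries off the range of phi and packs the
others together; neither operation increases the norm. *)
Lemma unspreading_map (phi : nat -> nat) : {homo phi : i j / (i < j)%N} ->
  exists2 T : {linear S -> S}, bounded_map T &
    (forall j, T (e (phi j)) = e j) /\ (forall j, (forall i, phi i != j) -> T (e j) = 0).
Proof.
move=> phiI; have phi_le := homo_leq_self phiI.
pose w j := \sum_(i < j.+1 | phi i == j) e i.
have phi_inj : injective phi.
  by move=> i j ij; case: (ltngtP i j) => // /phiI; rewrite ij ltnn.
have wphi j : w (phi j) = e j.
  have jj : (j < (phi j).+1)%N by rewrite ltnS.
  rewrite /w (bigD1 (Ordinal jj))//= big1 ?addr0// => i /andP[/eqP/phi_inj ij].
  by case/eqP; exact: val_inj.
have w0 j : (forall i, phi i != j) -> w j = 0.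
  by move=> H; rewrite /w big1// => i ij; have := H i; rewrite ij.
have [n a|T TB Te] := @linear_extension R k S e eB S w 1 ler01; last first.
  by exists T => //; split=> j; rewrite Te; [exact: wphi|move=> /w0].
rewrite mul1r.
have -> : \sum_(j < n) a j *: w j = \sum_(i < n) (if (phi i < n)%N then a (phi i) else 0) *: e i.
  transitivity (\sum_(j < n) \sum_(i < n | phi i == j) a j *: e i).
    apply: eq_bigr => j _; rewrite /w scaler_sumr.
    rewrite (big_ord_widen_cond n (fun i => phi i == j) (fun i => a j *: e i) (ltn_ord j)).
    apply: eq_bigl => i; rewrite ltnS; case: eqP => //= <-; exact: phi_le.
  rewrite (exchange_big_dep xpredT)//=; apply: eq_bigr => i _; case: ifPn => [pn|pn].
    rewrite (bigD1 (Ordinal pn))//= big1 ?addr0// => j /andP[/eqP ij].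
    by case/eqP; apply: val_inj.
  rewrite scale0r big1// => j /eqP ij; move: pn; rewrite ij ltn_ord//.
apply: (@snorm_relocate_le _ _ _ e eS n n a phi (fun i => phi i < n)%N) => //.
by move=> i j /andP[ij _] _ _; exact: phiI.
Qed.

Section Averaging.
Variables (lo sz : nat -> nat).
Hypothesis P : interval_partition lo sz.

Lemma big_block (M : nmodType) n j (f : nat -> M) : (lo j + sz j <= n)%N ->
  \sum_(i < sz j) f (lo j + i)%N = \sum_(i < n | lo i == lo j) f i.
Proof.
move=> jn; rewrite -(big_mkord (fun i => lo i == lo j) f).
have mid : (lo j <= lo j + sz j)%N by rewrite leq_addr.
rewrite (big_cat_nat (leq0n _) (leq_trans mid jn))//= (big_cat_nat mid jn)//=.
rewrite [X in X + _]big_nat_cond [X in X + _]big1 ?add0r; last first.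
  move=> i /andP[/andP[_ ij] /eqP lij]; have := lo_le P i; rewrite lij; lia.
rewrite [X in _ + X]big_nat_cond [X in _ + X]big1 ?addr0; last first.
  move=> i /andP[/andP[ji _] /eqP lij]; exfalso.
  have := lt_lo_sz P i; have := lt_lo_sz P (lo j); have Ij : (lo j <= lo j < lo j + sz j)%N.
    by rewrite leqnn /= -{1}[lo j]addn0 ltn_add2l (sz_gt0 P).
  have : sz i = sz (lo i).
    apply/esym/(sz_block P); rewrite leqnn /= -{1}[lo i]addn0 ltn_add2l (sz_gt0 P)//.
  rewrite lij (sz_block P Ij); lia.
transitivity (\sum_(lo j <= i < lo j + sz j) f i).
  rewrite -[X in \sum_(X <= _ < _) _]add0n big_addn addKn big_mkord.
  by apply: eq_bigr => i _; rewrite addnC.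
rewrite [LHS]big_nat_cond [RHS]big_nat_cond; apply: eq_bigl => i.
by apply: andb_id2l => ij; rewrite (lo_block P ij) eqxx.
Qed.

Lemma block_aligned n j : (j < lo n + sz n)%N -> (lo j + sz j <= lo n + sz n)%N.
Proof.
move=> jn; have [ln|ln] := eqVneq (lo j) (lo n); last first.
  have jlt : (j < n)%N.
    rewrite ltnNge; apply/negP => nj; case/eqP: ln; apply: (lo_block P).
    by rewrite jn andbT (leq_trans (lo_le P n)).
  have := @block_lt lo sz P j n (lo j + sz j).-1 (lo n) (elimN eqP ln).
  have s1 := sz_gt0 P j; have s2 := sz_gt0 P n => H.
  by have := H _ _ jlt; lia.
have : (lo n <= j < lo n + sz n)%N by rewrite jn andbT -ln (lo_le P).
by move=> /(sz_block P) ->; rewrite ln.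
Qed.

(** The map sends e_j to the mean of its interval; it takes the coefficients of
a finite sum to their means, so [snorm_average] applies. *)
Lemma averaging_map : exists2 T : {linear S -> S}, bounded_map T &
  forall j, T (e j) = (sz j)%:R^-1 *: \sum_(i < sz j) e (lo j + i)%N.
Proof.
pose w j := (sz j)%:R^-1 *: \sum_(i < sz j) e (lo j + i)%N.
apply: (linear_extension eB (w := w) (C := 2)) => // n a.
pose m := (lo n + sz n)%N; have nm : (n <= m)%N by rewrite ltnW// (lt_lo_sz P).
pose b j := if (j < n)%N then a j else 0.
have bE (z : nat -> S) : \sum_(j < n) a j *: z j = \sum_(j < m) b j *: z j.
  rewrite (big_ord_widen m (fun j => a j *: z j) nm) big_mkcond; apply: eq_bigr => j _.
  by rewrite /b; case: ifP; rewrite ?scale0r.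
have mP j : (j < m)%N -> (lo j + sz j <= m)%N by exact: block_aligned.
have sz_same i j : lo i = lo j -> sz i = sz j.
  move=> lij; have inb l : (lo l <= lo l < lo l + sz l)%N.
    by rewrite leqnn -{1}[lo l]addn0 ltn_add2l (sz_gt0 P).
  by rewrite -(sz_block P (inb i)) lij (sz_block P (inb j)).
rewrite !bE.
have -> : \sum_(j < m) b j *: w j = \sum_(j < m) average lo sz b j *: e j.
  transitivity (\sum_(j < m) \sum_(i < m | lo i == lo j) (b j / (sz j)%:R) *: e i).
    apply: eq_bigr => j _; rewrite /w (big_block e (mP j (ltn_ord j))) scalerA.
    by rewrite scaler_sumr.
  rewrite (exchange_big_dep xpredT)//=; apply: eq_bigr => i _.
  rewrite /average (big_block b (mP i (ltn_ord i))) mulr_sumr scaler_suml.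
  under [RHS]eq_bigl do rewrite eq_sym.
  by apply: eq_bigr => j /eqP/sz_same->; rewrite mulrC.
exact: (snorm_average eS P b mP).
Qed.

End Averaging.

(** S is isomorphic to S + Q(S), the inverse isomorphisms being
(f, g) -> A f + D g and f -> (B f, C f).  With E and D the spreading maps along
skip1 and skip0, P the averaging map of the nested partition and M that of the
dyadic one, P E = E P and P D = D M.  The map f -> f - P f + E (P f) moves the
means along skip1 and keeps the rest; its range consists of the sequences
supported off 0 whose skip0 part has mean zero on blocks.  B and C read off the
two parts of the image, and A is the inverse on the first part. *)
Lemma absorb_centered : exists A B C D Q : {linear S -> S},
  [/\ [/\ bounded_map A, bounded_map B, bounded_map C, bounded_map D & bounded_map Q],
      forall j, Q (e j) = e j - (2 ^ level j)%:R^-1 *: \sum_(i < 2 ^ level j) e ((2 ^ level j).-1 + i)%N,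
      [/\ forall f, B (A f) = f, forall f, C (A f) = 0,
          forall f, B (D (Q f)) = 0 & forall f, C (D (Q f)) = Q f],
      forall f, A (B f) + D (C f) = f &
      forall f, Q (C f) = C f].
Proof.
have [E Eb Ee] := spreading_map skip1_mono.
have [D Db De] := spreading_map skip0_mono.
have [RE REb [REe RE0]] := unspreading_map skip1_mono.
have [RD RDb [RDd RD0]] := unspreading_map skip0_mono.
have [P Pb Pe] := averaging_map nested_partition.
have [M Mb Me] := averaging_map dyadic_partition.
have cb (T U : {linear S -> S}) : bounded_map T -> bounded_map U -> bounded_map (T \o U).
  exact: bounded_map_comp.
have ext2 (T T' U U' : {linear S -> S}) : bounded_map T -> bounded_map T' -> bounded_map U ->
    bounded_map U' -> (forall j, T (T' (e j)) = U (U' (e j))) -> forall f, T (T' f) = U (U' f).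
  move=> Tb T'b Ub U'b H f.
  exact: (bounded_linear_ext eB (T := T \o T') (U := U \o U') (cb _ _ Tb T'b) (cb _ _ Ub U'b) H).
have RE_E f : RE (E f) = f.
  by apply: (ext2 RE E idfun idfun) => //;
    [exact: bounded_map_id|exact: bounded_map_id|move=> j; rewrite Ee REe].
have RD_D f : RD (D f) = f.
  by apply: (ext2 RD D idfun idfun) => //;
    [exact: bounded_map_id|exact: bounded_map_id|move=> j; rewrite De RDd].
have zb : bounded_map (\0 : {linear S -> S}) by exists 0 => // f; rewrite nrm0 mul0r.
have RD_E f : RD (E f) = 0.
  apply: (ext2 RD E \0 idfun) => //; first exact: bounded_map_id.
  by move=> j; rewrite Ee RD0// => i; exact: skip0_neq_skip1.
have RE_D f : RE (D f) = 0.
  apply: (ext2 RE D \0 idfun) => //; first exact: bounded_map_id.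
  by move=> j; rewrite De RE0// => i; rewrite eq_sym; exact: skip0_neq_skip1.
have P_E f : P (E f) = E (P f).
  apply: (ext2 P E E P) => // j; rewrite Ee !Pe [RHS]linearZ /= [in RHS]linear_sum nested_size_skip1; congr (_ *: _).
  by apply: eq_bigr => i _; rewrite Ee nested_start_skip1.
have P_D f : P (D f) = D (M f).
  apply: (ext2 P D D M) => // j; rewrite De Pe Me [RHS]linearZ /= [in RHS]linear_sum nested_size_skip0; congr (_ *: _).
  apply: eq_bigr => i _; rewrite De nested_start_skip0 /skip0; congr e.
  have -> : level ((2 ^ level j).-1 + i) = level j by rewrite level_start.
  have -> : level (2 ^ level j).-1 = level j by rewrite -[X in level X]addn0 level_start ?expn_gt0.
  lia.
have idem (lo sz : nat -> nat) (T : {linear S -> S}) : interval_partition lo sz -> bounded_map T ->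
    (forall j, T (e j) = (sz j)%:R^-1 *: \sum_(i < sz j) e (lo j + i)%N) -> forall f, T (T f) = T f.
  move=> part Tb Te; apply: (ext2 T T T idfun) => //; first exact: bounded_map_id.
  move=> j; rewrite /= {1}Te [LHS]linearZ /= [in LHS]linear_sum [RHS]Te.
  have ij i : (i < sz j)%N -> (lo j <= lo j + i < lo j + sz j)%N by rewrite leq_addr ltn_add2l.
  under eq_bigr => i _.
    rewrite Te (sz_block part (ij i (ltn_ord i))) (lo_block part (ij i (ltn_ord i))).
    over.
  rewrite sumr_const card_ord -[X in _ *: X = _]scaler_nat scalerA mulVf ?scale1r//.
  by rewrite pnatr_eq0 -lt0n (sz_gt0 part).
have PP := idem _ _ P nested_partition Pb Pe; have MM := idem _ _ M dyadic_partition Mb Me.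
have P0 : P (e 0%N) = e 0%N.
  by rewrite Pe /nested_start /nested_size /= big_ord1 addn0 invr1 scale1r.
have RE_0 : RE (e 0%N) = 0 by apply: RE0 => i; exact: skip1_neq0.
have RD_0 : RD (e 0%N) = 0 by apply: RD0 => i; exact: skip0_neq0.
have RE_P f : RE (P f) = P (RE f).
  apply: (ext2 RE P P RE) => // j; case: (skipP j) => [|i|i].
  - by rewrite P0 RE_0 linear0.
  - by rewrite -De P_D !RE_D linear0.
  - by rewrite -Ee P_E !RE_E.
have RD_P f : RD (P f) = M (RD f).
  apply: (ext2 RD P M RD) => // j; case: (skipP j) => [|i|i].
  - by rewrite P0 RD_0 linear0.
  - by rewrite -De P_D !RD_D.
  - by rewrite -Ee P_E !RD_E linear0.
have decomp f : E (RE (f - P f)) + D (RD (f - P f)) = f - P f.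
  pose Id : {linear S -> S} := idfun.
  pose L : {linear S -> S} := (E \o RE) \+ (D \o RD).
  pose N : {linear S -> S} := Id \+ (\- P).
  have Nb : bounded_map N by apply: bounded_mapD (bounded_map_id S) (bounded_mapN Pb).
  have Lb : bounded_map L by apply: bounded_mapD; exact: cb.
  apply: (ext2 L N Id N) => //; first exact: bounded_map_id.
  move=> j; rewrite /L /N /Id /=; case: (skipP j) => [|i|i].
  - by rewrite P0 subrr !linear0 addr0.
  - by rewrite -De P_D -linearB RE_D RD_D linear0 add0r.
  - by rewrite -Ee P_E -linearB RE_E RD_E linear0 addr0.
pose A : {linear S -> S} := (E \+ P) \+ (\- (E \o P)).
pose B : {linear S -> S} := (RE \+ (\- (RE \o P))) \+ P.
pose C : {linear S -> S} := RD \+ (\- (RD \o P)).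
pose Q : {linear S -> S} := (idfun : {linear S -> S}) \+ (\- M).
have AE f : A f = E f + P f - E (P f) by [].
have BE f : B f = RE (f - P f) + P f by rewrite linearB.
have CE f : C f = RD (f - P f) by rewrite linearB.
have QE f : Q f = f - M f by [].
have Pcentered f : P (f - P f) = 0 by rewrite linearB PP subrr.
have PA f : P (A f) = P f by rewrite AE linearB linearD !P_E !PP addrAC subrr add0r.
have PDQ f : P (D (Q f)) = 0 by rewrite P_D QE linearB MM subrr linear0.
exists A, B, C, D, Q; split.
- by split=> //; do ?[apply: bounded_mapD]; do ?[apply: bounded_mapN]; do ?[exact: cb];
  do ?[exact: bounded_map_id].
- by move=> j; rewrite QE Me.
- split=> f.
  + rewrite BE PA linearB AE linearB linearD !RE_E.
    by rewrite addrAC subrK addrK.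
  + by rewrite CE PA linearB AE linearB linearD !RD_E add0r subr0 subrr.
  + by rewrite BE PDQ subr0 RE_D addr0.
  + by rewrite CE PDQ subr0 RD_D.
- move=> f; rewrite AE BE CE; set u := f - P f.
  have Pu : P u = 0 := Pcentered f.
  rewrite (linearD P) -RE_P Pu linear0 add0r PP (linearD E).
  by rewrite [_ + P f]addrAC addrK addrAC decomp /u subrK.
- by move=> f; rewrite QE CE -RD_P Pcentered linear0 subr0.
Qed.

End Operators.

Section ComplementedAbsorption.
Context {R : realType} {k : scalar_kind}.
Notation F := (scalars R k).
Context {S X : completeNormedModType F}.
Variable e : nat -> S.
Hypothesis eS : sign_invariant_spreading e.
Hypothesis eB : schauder_basis e.

(** T is invertible onto the range of P, so P factors through it. *)
Lemma left_inverse (P : {linear X -> X}) (T : {linear S -> X}) (c : R) :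
  bounded_map P -> range T = range P -> 0 < c -> (forall s, c * nrm s <= nrm (T s)) ->
  exists2 V : {linear X -> S}, bounded_map V & forall z, T (V z) = P z.
Proof.
move=> [C C0 PC] TP c0 cT.
have Tinj s s' : T s = T s' -> s = s'.
  move=> ss'; apply/eqP; rewrite -subr_eq0 -nrm_eq0 eq_le nrm_ge0 andbT.
  by rewrite -(pmulr_rle0 _ c0) (le_trans (cT _))// linearB ss' subrr nrm0.
have /choice[V VP] : forall z, exists s, T s = P z.
  move=> z; have : range P (P z) by exists z.
  by rewrite -TP => -[s _ <-]; exists s.
have Vlin : linear V by move=> a u v; apply: Tinj; rewrite linearP !VP linearP.
pose V' : {linear X -> S} := HB.pack V (GRing.isLinear.Build _ _ _ _ V Vlin).
exists V' => //; exists (C / c); first by rewrite divr_ge0// ltW.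
move=> z; rewrite mulrAC ler_pdivlMr// mulrC (le_trans (cT _))//.
by rewrite (VP z) PC.
Qed.

(** X is T(S) + ker P.  Replacing S by S + Q(S) in the first summand gives
X + Q(S), with inverse isomorphisms (s, z) -> U s + W z and z -> (q z, G z). *)
Lemma complemented_absorption : isomorphic_to_complemented_subspace S X ->
  exists (U : {linear S -> X}) (W G : {linear X -> X}) (q : {linear X -> S}) (Q : {linear S -> S}),
  [/\ [/\ bounded_map U, bounded_map W, bounded_map G, bounded_map q & bounded_map Q],
      forall j, Q (e j) = e j - (2 ^ level j)%:R^-1 *: \sum_(i < 2 ^ level j) e ((2 ^ level j).-1 + i)%N,
      (forall s z, q (U (Q s) + W z) = Q s) /\ (forall s z, G (U (Q s) + W z) = z),
      forall z, U (q z) + W (G z) = z &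
      forall z, Q (q z) = q z].
Proof.
move=> [P [T [Pcont PP TP [c [C [c0 cTC]]]]]].
have Pb := continuous_bounded_map Pcont.
have Tb : bounded_map T.
  exists `|C| => // f; rewrite (le_trans (cTC f).2)// ler_wpM2r ?nrm_ge0//.
  exact: ler_norm.
have [V Vb TV] := left_inverse Pb TP c0 (fun s => (cTC s).1).
have PT s : P (T s) = T s.
  have : range P (T s) by rewrite -TP; exists s.
  by move=> [z _ <-]; rewrite PP.
have VT s : V (T s) = s.
  apply/eqP; rewrite -subr_eq0 -nrm_eq0 eq_le nrm_ge0 andbT -(pmulr_rle0 _ c0).
  by rewrite (le_trans (cTC _).1)// linearB TV PT subrr nrm0.
have VP z : V (z - P z) = 0 by rewrite -[LHS]VT TV linearB PP subrr linear0.
have [A [B [K [D [Q [[Ab Bb Kb Db Qb] Qe [BA KA BDQ KDQ] AB QK]]]]]] := absorb_centered eS eB.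
pose Id : {linear X -> X} := idfun.
pose U : {linear S -> X} := T \o D.
pose W : {linear X -> X} := (Id \+ (\- P)) \+ (T \o A \o V).
pose G : {linear X -> X} := (Id \+ (\- P)) \+ (T \o B \o V).
pose q : {linear X -> S} := K \o V.
have cb (L M N : normedModType F) (f : {linear M -> N}) (g : {linear L -> M}) :
  bounded_map f -> bounded_map g -> bounded_map (f \o g) by exact: bounded_map_comp.
exists U, W, G, q, Q.
have WE z : W z = (z - P z) + T (A (V z)) by [].
have GE z : G z = (z - P z) + T (B (V z)) by [].
have UE s : U s = T (D s) by [].
have qE z : q z = K (V z) by [].
have Vsum s z : V (U (Q s) + W z) = D (Q s) + A (V z).
  by rewrite UE WE (linearD V) (linearD V (_ - _)) VP !VT add0r.
have Psum z s : P (z - P z + T s) = T s by rewrite linearD PT linearB PP subrr add0r.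
have Vsum2 z s : V (z - P z + T s) = s by rewrite linearD VP VT add0r.
split=> //.
- have IPb : bounded_map (Id \+ (\- P)) by apply: bounded_mapD (bounded_map_id X) (bounded_mapN Pb).
  split=> //; first exact: cb.
  + by apply: bounded_mapD => //; apply: (cb) => //; exact: cb.
  + by apply: bounded_mapD => //; apply: (cb) => //; exact: cb.
  + exact: cb.
- split=> s z; first by rewrite qE Vsum linearD KDQ KA addr0.
  rewrite GE Vsum (linearD B) BDQ BA add0r TV.
  have -> : U (Q s) + W z = z - P z + T (D (Q s) + A (V z)).
    by rewrite UE WE (linearD T) addrCA.
  by rewrite Psum addrK subrK.
- move=> z; rewrite UE qE WE GE Psum Vsum2 addrK addrC -addrA -linearD AB TV.
  by rewrite subrK.
- by move=> z; rewrite qE QK.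
Qed.

End ComplementedAbsorption.

(** * From threshold estimates to almost greedy bases *)

Lemma count_split (T : Type) (A B : pred T) (s : seq T) :
  count A s = (count (fun j => A j && ~~ B j) s + count (fun j => A j && B j) s)%N.
Proof. by elim: s => //= j s ->; case: (A j); case: (B j) => /=; lia. Qed.

Section ThresholdBounds.
Context {R : realType} {k : scalar_kind} {X : completeNormedModType (scalars R k)}.
Notation F := (scalars R k).
Variables (y : nat -> X) (L : nat -> R) (D : R).
Hypotheses (D0 : 0 <= D) (L_mono : forall m n, (m <= n)%N -> L m <= L n) (L0 : 0 <= L 0) (L1 : 0 < L 1).
Notation snorm := (snorm y).
Hypothesis y_upper : forall n (A : pred nat) (b : nat -> F) t, 0 <= t ->
  (forall j, (j < n)%N -> abs (b j) <= if A j then t else 0) ->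
  snorm n b <= D * t * L (count A (iota 0 n)).
Hypothesis y_lower : forall n (h : nat -> F) (G : pred nat) t, 0 <= t ->
  (forall j, (j < n)%N -> G j -> t <= abs (h j)) ->
  t * L (count G (iota 0 n)) <= D * snorm n h.
Hypothesis y_greedy : forall n (h : nat -> F) (G : pred nat) t, 0 <= t ->
  (forall j, (j < n)%N -> G j -> t <= abs (h j)) ->
  (forall j, (j < n)%N -> ~~ G j -> abs (h j) <= t) ->
  snorm n (mask G h) <= D * snorm n h.
Hypothesis y_prefix : forall m n (a : nat -> F), (m <= n)%N -> snorm m a <= D * snorm n a.
Hypothesis y_dense : forall f (r : R), 0 < r -> exists n (a : nat -> F),
  nrm (f - \sum_(j < n) a j *: y j) < r.

Lemma snorm_unit j n : (j < n)%N -> snorm n (fun i => (i == j)%:R) = nrm (y j).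
Proof.
move=> jn; rewrite /snorm (bigD1 (Ordinal jn))//= eqxx scale1r big1 ?addr0// => i ij.
by rewrite (_ : (i == j :> nat) = false) ?scale0r//; apply: contra_neqF ij => /eqP ij;
  apply: val_inj.
Qed.

Lemma count_unit j n : (j < n)%N -> count (fun i => i == j) (iota 0 n) = 1%N.
Proof. by move=> jn; rewrite -/(count (pred1 j) _) count_uniq_mem ?iota_uniq// mem_iota jn. Qed.

Lemma unit_upper j : nrm (y j) <= D * L 1.
Proof.
rewrite -(snorm_unit (ltnSn j)) -[D]mulr1 -(count_unit (ltnSn j)).
by apply: y_upper => // i _; case: eqP => _; rewrite ?abs1 ?abs0.
Qed.

(** In particular the vectors do not vanish and D is positive. *)
Lemma unit_lower j : L 1 <= D * nrm (y j).
Proof.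
rewrite -(snorm_unit (ltnSn j)) -[leLHS]mul1r -(count_unit (ltnSn j)).
by apply: y_lower => // i _ ->; rewrite abs1.
Qed.

Lemma threshold_constant_gt0 : 0 < D.
Proof.
rewrite lt0r D0 andbT; apply/eqP => D00; have := unit_lower 0.
by rewrite D00 mul0r leNgt L1.
Qed.

Lemma threshold_basis : banach_basis y.
Proof.
have D1 := threshold_constant_gt0; split.
  apply: (schauder_of_dense (K := D)) => // j.
  by rewrite -nrm_gt0 -(pmulr_rgt0 _ D1) (lt_le_trans L1 (unit_lower j)).
split.
  apply: (@lt_le_trans _ _ (L 1 / D)%:E); first by rewrite lte_fin divr_gt0.
  apply: le_ereal_inf_tmp => _ [j _ <-].
  by rewrite lee_fin ler_pdivrMr// mulrC unit_lower.
apply: (@le_lt_trans _ _ (D * L 1)%:E); last exact: ltry.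
apply: ge_ereal_sup => _ [j _ <-].
by rewrite lee_fin unit_upper.
Qed.

Let yB : schauder_basis y := threshold_basis.1.

Lemma coord_proj_finite (A : set nat) f n :
  (forall j, j \in A -> (n <= j)%N -> coordinate y f j = 0) ->
  coord_proj y A f = \sum_(j < n) mask (fun i => i \in A) (coordinate y f) j *: y j.
Proof.
move=> An; rewrite /coord_proj; apply/cvg_lim => //; apply/tendsP.
apply: (tends_eq (N := n) _ (tends_cst _)) => m nm; rewrite /series /= big_mkord.
rewrite (big_ord_widen m (fun j => mask (fun i => i \in A) (coordinate y f) j *: y j) nm).
rewrite big_mkcond; apply: eq_bigr => j _; rewrite /mask.
case: ifPn => [jn|]; first by case: ifP; rewrite ?scale0r.
by rewrite -leqNgt => nj; case: ifP => // jA; rewrite An ?scale0r.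
Qed.

Lemma fset_bound (A : {fset nat}) : exists n, forall j, j \in A -> (j < n)%N.
Proof.
exists (\max_(j <- A) j).+1 => j jA; rewrite ltnS.
exact: (@leq_bigmax_seq _ _ _ (fun j => j)).
Qed.

Lemma count_fset (A : {fset nat}) n : (forall j, j \in A -> (j < n)%N) ->
  count [in A] (iota 0 n) = #|` A|.
Proof.
move=> An; rewrite -size_filter cardfE cardE -(size_map val).
apply/perm_size/uniq_perm; first by rewrite filter_uniq// iota_uniq.
  by rewrite map_inj_uniq ?enum_uniq//; exact: val_inj.
move=> j; rewrite mem_filter mem_iota /= add0n; apply/andP/mapP => [[jA _]|[i _ ->]].
  by exists [` jA]%fset; rewrite ?mem_enum.
by rewrite /= fsvalP; split=> //; apply: An; exact: fsvalP.
Qed.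

Lemma exists_min_abs (G : {fset nat}) (a : nat -> F) : G != fset0 ->
  exists2 i, i \in G & forall j, j \in G -> abs (a i) <= abs (a j).
Proof.
move=> /fset0Pn[i0 i0G].
have := @arg_minP _ R G [` i0G]%fset xpredT (fun i : G => abs (a (val i))) isT.
case=> i _ iP; exists (val i); first exact: fsvalP.
by move=> j jG; exact: (iP [` jG]%fset isT).
Qed.

(** With h = f - S_A f, one has f - S_G f = h - S_(G minus A) h + S_(A minus G) f.
For t the least modulus of a coefficient on G, the set G minus A is a greedy set of h at the
threshold t.  The last term has at most as many coefficients as there are elements in
G minus A, all of modulus at most t, so it is bounded by t L(card (G minus A)), hence by h again. *)
Lemma threshold_almost_greedy : almost_greedy y.
Proof.
have [M M0 MP] := partial_sum_bounded yB.
exists (1 + (D + D * D) * M) => f A G AG aG.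
have [n nP] : exists n, (forall j, j \in A -> (j < n)%N) /\ (forall j, j \in G -> (j < n)%N).
  have [nA nAP] := fset_bound A; have [nG nGP] := fset_bound G; exists (maxn nA nG).
  by split=> j jS; rewrite leq_max ?(nAP j jS) ?(nGP j jS) ?orbT.
case: nP => nA nG; pose a := coordinate y f.
have projE (B : {fset nat}) : (forall j, j \in B -> (j < n)%N) ->
    coord_proj y [set` B] f = \sum_(j < n) mask [in B] a j *: y j.
  move=> nB; rewrite (coord_proj_finite (n := n)); first last.
    by move=> j; rewrite mem_setE => /nB jn; rewrite leqNgt jn.
  by apply: eq_bigr => j _; rewrite /mask mem_setE.
rewrite (projE A nA) (projE G nG).
set h := f - \sum_(j < n) mask [in A] a j *: y j.
pose hc j := if (j < n)%N then (if j \in A then 0 else a j) else a j.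
have hn : snorm n hc <= M * nrm h.
  apply: le_trans (MP h n); rewrite le_eqVlt; apply/orP; left; apply/eqP; congr nrm.
  apply: eq_bigr => j _; congr (_ *: _); rewrite /h addrC -scaleN1r (coordinate_lin yB).
  rewrite (coordinate_finite yB (mask [in A] a)) /hc ltn_ord mulN1r /mask /=.
  by case: ifP; rewrite ?oppr0 ?add0r// addNr.
pose u j := if (j \in G) && (j \notin A) then a j else 0.
pose v j := if (j \in A) && (j \notin G) then a j else 0.
have -> : f - \sum_(j < n) mask [in G] a j *: y j =
    h - \sum_(j < n) u j *: y j + \sum_(j < n) v j *: y j.
  rewrite /h -!addrA; congr (_ + _); rewrite -!sumrN -!big_split /=; apply: eq_bigr => j _.
  rewrite -!scaleNr -!scalerDl; congr (_ *: _); rewrite /u /v /mask /=.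
  by case: (_ \in G); case: (_ \in A); rewrite /= ?oppr0 ?addr0 ?add0r ?addNr.
have [G0|G0] := eqVneq G fset0.
  have A0 : A = fset0 by apply/eqP; rewrite -cardfs_eq0 -leqn0 (leq_trans AG)// G0 cardfs0.
  rewrite big1 => [|j _]; last by rewrite /u G0 inE scale0r.
  rewrite big1 => [|j _]; last by rewrite /v A0 inE scale0r.
  rewrite subr0 addr0 ler_peMl ?nrm_ge0// lerDl mulr_ge0 ?(ltW M0)// addr_ge0// mulr_ge0//.
have [i iG imin] := exists_min_abs a G0; pose t := abs (a i).
have t0 : 0 <= t by exact: abs_ge0.
pose G' j := (j \in G) && (j \notin A).
have hG' j : (j < n)%N -> G' j -> t <= abs (hc j).
  by move=> jn /andP[jG jA]; rewrite /hc jn (negbTE jA) imin.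
have hu : nrm (\sum_(j < n) u j *: y j) <= D * snorm n hc.
  have H := @y_greedy n hc G' t t0 hG'.
  have -> : nrm (\sum_(j < n) u j *: y j) = snorm n (mask G' hc).
    apply: eq_snorm => j jn; rewrite /u /mask /G' /hc jn.
    by case: (j \in A); rewrite ?andbF.
  apply: H => j jn; rewrite /G' negb_and negbK /hc jn; case: (boolP (j \in A)) => /= [_ _|jA].
    by rewrite abs0.
  by rewrite orbF => jG; exact: aG.
have hv : nrm (\sum_(j < n) v j *: y j) <= D * (D * snorm n hc).
  have := @y_upper n (fun j => (j \in A) && (j \notin G)) v t t0.
  move=> /(_ _)/le_trans; apply=> [j jn|].
    by rewrite /v; case: ifP => [/andP[_ jG]|_]; rewrite ?abs0//; exact: aG.
  rewrite -mulrA ler_wpM2l// (le_trans _ (y_lower t0 hG'))// ler_wpM2l// L_mono//.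
  have cA := count_fset nA; have cG := count_fset nG.
  have sA := count_split [in A] [in G] (iota 0 n).
  have sG := count_split [in G] [in A] (iota 0 n).
  rewrite (eq_count (fun j => andbC (j \in G) (j \in A))) in sG.
  by move: AG; rewrite -cA -cG sA sG leq_add2r.
apply: le_trans (ler_nrmD _ _) _.
have := ler_nrmB h (\sum_(j < n) u j *: y j).
have := ler_wpM2l D0 hn; have := ler_wpM2l D0 (ler_wpM2l D0 hn).
by move: hu hv; lra.
Qed.


Lemma big_fset_iota (A : {fset nat}) n : (forall j, j \in A -> (j < n)%N) ->
  \sum_(j <- A) y j = \sum_(j < n) mask [in A] (fun=> 1) j *: y j.
Proof.
move=> An; have -> : \sum_(j <- A) y j = \sum_(j <- [seq j <- iota 0 n | j \in A]) y j.
  apply: perm_big; apply: uniq_perm; rewrite ?fset_uniq ?filter_uniq ?iota_uniq// => j.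
  by rewrite mem_filter mem_iota add0n /=; case: (boolP (j \in A)) => // /An ->.
rewrite big_filter big_mkcond -(big_mkord predT (fun j => mask [in A] (fun=> 1) j *: y j)).
rewrite /index_iota subn0; apply: eq_bigr => j _.
by rewrite /mask /=; case: ifP; rewrite ?scale1r ?scale0r.
Qed.

Lemma threshold_fundamental : equivalent (fundamental_function y) (fun m => (L m)%:E).
Proof.
split; exists D => m m0; rewrite /fundamental_function.
  apply: ge_ereal_sup => _ [A Am ->]; rewrite -EFinM lee_fin.
  have [n An] := fset_bound A; rewrite (big_fset_iota An).
  rewrite (le_trans (y_upper (A := [in A]) (t := 1) _ _))// => [j jn|].
    by rewrite /mask; case: ifP; rewrite ?abs1 ?abs0.
  by rewrite mulr1 ler_wpM2l// L_mono// count_fset.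
pose A := [fset j in iota 0 m]%fset.
have Am j : j \in A -> (j < m)%N by rewrite !inE mem_iota.
apply: (@le_trans _ _ (D * nrm (\sum_(j <- A) y j))%:E).
  have mA : \sum_(j <- A) y j = \sum_(j < m) 1 *: y j.
    rewrite (big_fset_iota Am); apply: eq_bigr => j _; congr (_ *: _).
    by rewrite /mask /= !inE mem_iota ltn_ord.
  rewrite lee_fin mA; have := @y_lower m (fun=> 1) xpredT 1 ler01.
  rewrite count_predT size_iota mul1r; apply.
  by move=> j _ _; rewrite abs1.
rewrite EFinM lee_pmul2l ?lte_fin ?threshold_constant_gt0//; apply: ereal_sup_ubound;
  exists A => //.
by rewrite -(count_fset Am) -{2}(size_iota 0 m) count_size.
Qed.

End ThresholdBounds.

(** * The conditional almost greedy basis *)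

Lemma count_iota_restrict (A : pred nat) m n : (m <= n)%N ->
  count (fun j => A j && (j < m)%N) (iota 0 n) = count A (iota 0 m).
Proof.
move=> mn; rewrite -(subnKC mn) iotaD count_cat add0n.
rewrite [X in (_ + X)%N](@eq_in_count _ _ pred0) ?count_pred0 ?addn0.
  by apply: eq_in_count => j; rewrite mem_iota add0n /= => ->; rewrite andbT.
by move=> j; rewrite mem_iota => /andP[mj _]; rewrite /= ltnNge mj andbF.
Qed.

Lemma leq_expn2_pred n : (n <= (2 ^ n).-1)%N.
Proof. by have := ltn_expl n (isT : 1 < 2)%N; lia. Qed.

Section Transfer.
Context {R : realType} {k : scalar_kind}.
Notation F := (scalars R k).
Context {S X : completeNormedModType F}.
Variable e : nat -> S.
Hypotheses (eS : sign_invariant_spreading e) (eB : schauder_basis e) (e0 : 0 < lam e 1).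
Hypotheses (lam_lower : lower_regular e) (sparse : sparse_summable e).
Variables (x : nat -> X) (K c C : R).
Hypotheses (c0 : 0 < c) (xc : forall j, c <= nrm (x j)) (xC : forall j, nrm (x j) <= C).
Hypothesis xK : forall m n (a : nat -> F), (m <= n)%N ->
  nrm (\sum_(j < m) a j *: x j) <= K * nrm (\sum_(j < n) a j *: x j).
Hypothesis xB : schauder_basis x.
Variables (U : {linear S -> X}) (W G : {linear X -> X}) (q : {linear X -> S}) (Q : {linear S -> S}).
Hypotheses (Ub : bounded_map U) (Wb : bounded_map W) (Gb : bounded_map G)
  (qb : bounded_map q) (Qb : bounded_map Q).
Hypothesis Qe : forall j, Q (e j) =
  e j - (2 ^ level j)%:R^-1 *: \sum_(i < 2 ^ level j) e ((2 ^ level j).-1 + i)%N.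
Hypothesis qUW : forall s z, q (U (Q s) + W z) = Q s.
Hypothesis GUW : forall s z, G (U (Q s) + W z) = z.
Hypothesis UqWG : forall z, U (q z) + W (G z) = z.
Hypothesis Qq : forall z, Q (q z) = q z.
Notation lam := (lam e).
Notation mixed_norm := (mixed_norm e x).

(** In the space Q(S) + X, of which U and W are the two embeddings, this is the
unit vector e_j: its centered part, and its block mean 1 / 2^l times lam(2^l)
x_l. *)
Definition conditional_basis (j : nat) : X :=
  U (Q (e j)) + W (emb (lam (2 ^ level j) / (2 ^ level j)%:R) *: x (level j)).
Notation y := conditional_basis.

Lemma centering_sum N (a : nat -> F) :
  Q (\sum_(j < (2 ^ N).-1) a j *: e j) = \sum_(j < (2 ^ N).-1) centered a j *: e j.
Proof.
rewrite linear_sum /centered; under [RHS]eq_bigr do rewrite scalerBl.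
rewrite sumrB; under eq_bigr do rewrite linearZ /= Qe scalerBr.
rewrite sumrB; congr (_ - _).
pose z l := \sum_(i < 2 ^ l) e ((2 ^ l).-1 + i)%N.
rewrite (big_level N (fun j => a j *: ((2 ^ level j)%:R^-1 *: z (level j)))).
rewrite (big_level N (fun j => mean (level j) a *: e j)); apply: eq_bigr => l _.
under eq_bigr do rewrite level_start// scalerA.
under [RHS]eq_bigr do rewrite level_start//.
by rewrite -scaler_suml -scaler_sumr -mulr_suml mulrC.
Qed.

(** In coordinates of Q(S) + X, a finite combination has the two parts whose norms
make up [mixed_norm]. *)
Lemma conditional_basis_sum N (a : nat -> F) : \sum_(j < (2 ^ N).-1) a j *: y j =
  U (Q (\sum_(j < (2 ^ N).-1) a j *: e j)) +
  W (\sum_(l < N) (emb (lam (2 ^ l)) * mean l a) *: x l).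
Proof.
rewrite /y; under eq_bigr do rewrite scalerDr.
rewrite big_split /= !linear_sum; congr (_ + _).
  by apply: eq_bigr => j _; rewrite !linearZ.
rewrite (big_level N (fun j => a j *: W (emb (lam (2 ^ level j) / (2 ^ level j)%:R) *: x (level j)))).
apply: eq_bigr => l _; under eq_bigr do rewrite level_start//.
rewrite -scaler_suml -linearZ /= scalerA /mean mulrA rmorphM fmorphV rmorph_nat.
by rewrite mulrC.
Qed.

Lemma conditional_basis_le : exists2 D, 0 <= D & forall N a,
  snorm y (2 ^ N).-1 a <= D * mixed_norm N a.
Proof.
have [C1 C10 C1P] := Ub; have [C2 C20 C2P] := Wb; exists (C1 + C2); first exact: addr_ge0.
move=> N a; rewrite /snorm conditional_basis_sum centering_sum (le_trans (ler_nrmD _ _))//.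
set u := \sum_(j < _) _; set v := \sum_(l < _) _.
have -> : mixed_norm N a = nrm u + nrm v by [].
have := C1P u; have := C2P v; have := nrm_ge0 u; have := nrm_ge0 v => v0 u0.
have := mulr_ge0 C10 v0; have := mulr_ge0 C20 u0; lra.
Qed.

Lemma conditional_basis_ge : exists2 D, 0 <= D & forall N a,
  mixed_norm N a <= D * snorm y (2 ^ N).-1 a.
Proof.
have [C1 C10 C1P] := qb; have [C2 C20 C2P] := Gb; exists (C1 + C2); first exact: addr_ge0.
move=> N a; set s := \sum_(j < (2 ^ N).-1) a j *: e j.
set v := \sum_(l < N) (emb (lam (2 ^ l)) * mean l a) *: x l.
have -> : mixed_norm N a = nrm (q (U (Q s) + W v)) + nrm (G (U (Q s) + W v)).
  by rewrite qUW GUW centering_sum.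
by rewrite /snorm conditional_basis_sum mulrDl lerD.
Qed.

Lemma conditional_basis_snorm n a : snorm y n a = snorm y (2 ^ n).-1 (mask (fun j => j < n)%N a).
Proof.
rewrite (snorm_extend y (leq_expn2_pred n)) => [|j /andP[nj _]]; last by rewrite /mask ltnNge nj.
by apply: eq_snorm => j jn; rewrite /mask jn.
Qed.

Lemma conditional_basis_threshold : exists2 D, 0 <= D & [/\
  forall n (A : pred nat) (b : nat -> F) t, 0 <= t ->
    (forall j, (j < n)%N -> abs (b j) <= if A j then t else 0) ->
    snorm y n b <= D * t * lam (count A (iota 0 n)),
  forall n (h : nat -> F) (A : pred nat) t, 0 <= t ->
    (forall j, (j < n)%N -> A j -> t <= abs (h j)) ->
    t * lam (count A (iota 0 n)) <= D * snorm y n h,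
  forall n (h : nat -> F) (A : pred nat) t, 0 <= t ->
    (forall j, (j < n)%N -> A j -> t <= abs (h j)) ->
    (forall j, (j < n)%N -> ~~ A j -> abs (h j) <= t) ->
    snorm y n (mask A h) <= D * snorm y n h &
  forall m n (a : nat -> F), (m <= n)%N -> snorm y m a <= D * snorm y n a].
Proof.
have [A1 A10 up] := conditional_basis_le; have [A2 A20 dn] := conditional_basis_ge.
have [B1 B10 H1] := mixed_norm_upper eS e0 lam_lower sparse c0 xC.
have [B2 B20 H2] := mixed_norm_lower eS e0 c0 xc xK.
have [B3 B30 H3] := mixed_norm_greedy eS e0 lam_lower sparse c0 xc xC xK.
have [B4 B40 H4] := mixed_norm_prefix eS e0 lam_lower sparse c0 xc xC xK.
have updn B a b N : 0 <= B -> mixed_norm N b <= B * mixed_norm N a ->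
    snorm y (2 ^ N).-1 b <= A1 * B * A2 * snorm y (2 ^ N).-1 a.
  move=> B0 ba; rewrite (le_trans (up N b))// -!mulrA ler_wpM2l// (le_trans ba)//.
  by rewrite ler_wpM2l.
have D1 : 0 <= A1 * B1 by exact: mulr_ge0.
have D2 : 0 <= B2 * A2 by exact: mulr_ge0.
have D3 : 0 <= A1 * B3 * A2 by rewrite !mulr_ge0.
have D4 : 0 <= A1 * B4 * A2 by rewrite !mulr_ge0.
pose D := A1 * B1 + B2 * A2 + A1 * B3 * A2 + A1 * B4 * A2.
have le1 : A1 * B1 <= D by rewrite /D; lra.
have le2 : B2 * A2 <= D by rewrite /D; lra.
have le3 : A1 * B3 * A2 <= D by rewrite /D; lra.
have le4 : A1 * B4 * A2 <= D by rewrite /D; lra.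
exists D; first by rewrite /D !addr_ge0.
split.
- move=> n A b t t0 bt; rewrite conditional_basis_snorm -(count_iota_restrict A (leq_expn2_pred n)).
  set A' := fun j => A j && _; set b' := mask _ b.
  rewrite (le_trans (up n b'))//; apply: le_trans (_ : A1 * (B1 * t * lam (count A' (iota 0 (2 ^ n).-1))) <= _).
    rewrite ler_wpM2l// H1// => j _; rewrite /b' /mask /A'.
    by case: (ltnP j n) => [/bt|_]; rewrite ?andbT ?andbF ?abs0.
  by rewrite mulrA ler_wpM2r ?lam_ge0// mulrA ler_wpM2r.
- move=> n h A t t0 ht; rewrite conditional_basis_snorm -(count_iota_restrict A (leq_expn2_pred n)).
  set h' := mask _ h; apply: le_trans (H2 n h' _ t t0 _) _.
    by move=> j _ /andP[Aj jn]; rewrite /h' /mask jn ht.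
  apply: le_trans (ler_wpM2l B20 (dn n h')) _.
  by rewrite mulrA ler_wpM2r ?snorm_ge0.
- move=> n h A t t0 ht hA; rewrite (conditional_basis_snorm n (mask A h)) (conditional_basis_snorm n h); pose h' := mask (fun j => j < n)%N h.
  have H : mixed_norm n (mask (fun j => A j && (j < n)%N) h') <= B3 * mixed_norm n h'.
    apply: (H3 n h' _ t t0) => j _; rewrite /h' /mask; first by move=> /andP[Aj jn]; rewrite jn ht.
    by case: (ltnP j n) => [jn|nj]; rewrite ?andbT ?abs0//; exact: hA.
  have := updn _ _ _ _ B30 H.
  rewrite (@eq_snorm _ _ _ _ _ _ (mask (fun j => j < n)%N (mask A h))); last first.
    by move=> j _; rewrite /h' /mask; case: (j < n)%N; case: (A j).
  by move=> /le_trans; apply; rewrite -/h' ler_wpM2r ?snorm_ge0.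
- move=> m n a mn; rewrite (conditional_basis_snorm n).
  have mN : (m <= (2 ^ n).-1)%N by rewrite (leq_trans mn) ?leq_expn2_pred.
  set a' := mask _ a.
  have -> : snorm y m a = snorm y (2 ^ n).-1 (mask (fun j => j < m)%N a').
    rewrite (snorm_extend y mN) => [|j /andP[mj _]]; last by rewrite /mask ltnNge mj.
    by apply: eq_snorm => j jm; rewrite /a' /mask jm (leq_trans jm mn).
  have := updn _ _ _ _ B40 (H4 n m a' mN).
  by move=> /le_trans; apply; rewrite ler_wpM2r ?snorm_ge0.
Qed.

Lemma emb_lam_neq0 l : emb (lam (2 ^ l)) != 0 :> F.
Proof. by rewrite emb_neq0// gt_eqF// (lam_gt0 eS e0)// expn_gt0. Qed.

(** Both components of f are approximated by partial sums.  A centered sequence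
and prescribed means determine a sequence of coefficients. *)
Lemma conditional_basis_dense f (r : R) : 0 < r -> exists n (a : nat -> F),
  nrm (f - \sum_(j < n) a j *: y j) < r.
Proof.
move=> r0; pose s := coordinate e (q f); pose b := coordinate x (G f).
pose a j := centered s j + b (level j) / emb (lam (2 ^ level j)).
have aE l : mean l a = b l / emb (lam (2 ^ l)).
  by rewrite /a meanD mean_centered (mean_level l (fun i => b i / emb (lam (2 ^ i)))) add0r.
have ca j : centered a j = centered s j by rewrite /centered aE addrK.
pose u N := U (Q (partial_sum e (2 ^ N).-1 (q f))) + W (partial_sum x N (G f)).
have uE N : \sum_(j < (2 ^ N).-1) a j *: y j = u N.
  rewrite conditional_basis_sum !centering_sum /u centering_sum; congr (U _ + W _).
    by apply: eq_bigr => j _; rewrite ca.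
  by apply: eq_bigr => l _; rewrite aE mulrC mulfVK ?emb_lam_neq0.
have UQb : bounded_map (U \o Q) by exact: bounded_map_comp.
have uf : tends u f.
  rewrite -[f in tends u f]UqWG -(Qq f); apply: tendsD; last first.
    exact: (bounded_map_tends (T := W) Wb (tends_partial_sum xB (G f))).
  have := bounded_map_tends (T := U \o Q) UQb (tends_partial_sum eB (q f)).
  move=> H r' r'0; have [N NP] := H r' r'0; exists N => n Nn; apply: NP.
  by rewrite (leq_trans Nn)// leq_expn2_pred.
have [N NP] := uf r r0; exists (2 ^ N).-1, a.
by rewrite uE nrmB NP.
Qed.

(** A sequence that is constant on blocks has no centered part. *)
Lemma transfer_sum m (b : nat -> F) : W (\sum_(l < m) b l *: x l) =
  \sum_(j < (2 ^ m).-1) (b (level j) / emb (lam (2 ^ level j))) *: y j.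
Proof.
pose a j := b (level j) / emb (lam (2 ^ level j)).
have aE l : mean l a = b l / emb (lam (2 ^ l)) by rewrite (mean_level l (fun i =>
  b i / emb (lam (2 ^ i)))).
rewrite (conditional_basis_sum m a) centering_sum [X in U X]big1 ?linear0 ?add0r => [|j _];
  last first.
  by rewrite /centered aE subrr scale0r.
by congr (W _); apply: eq_bigr => l _; rewrite aE mulrC mulfVK ?emb_lam_neq0.
Qed.

Hypothesis yB : schauder_basis y.

(** W is an isomorphism onto its range, which carries the projection onto A to
the projection onto the indices whose level is in A. *)
Lemma Lconst_transfer : exists2 D, 0 < D &
  forall m, (Lconst x m <= D%:E * Lconst y (2 ^ m).-1)%E.
Proof.
have [C1 C10 C1P] := Wb; have [C2 C20 C2P] := Gb.
pose D := C2 * C1 + 1; have D0 : 0 < D by rewrite ltr_wpDl// mulr_ge0.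
exists D => // m; apply: ge_ereal_sup => _ [f [A [f0 fm ->]]].
pose b := coordinate x f.
have bm j : (m <= j)%N -> b j = 0.
  by move=> mj; apply/eqP; apply: contraT => bj; have := fm j bj; rewrite /= ltnNge mj.
have fE : f = \sum_(l < m) b l *: x l.
  apply: tends_unique (tends_partial_sum xB f) _;
    apply: (tends_eq (N := m) _ (tends_cst _)) => n mn.
  rewrite (big_ord_widen n (fun l => b l *: x l) mn) big_mkcond; apply: eq_bigr => l _.
  by case: ltnP => // ml; rewrite /b -/(b l) bm ?scale0r.
have SAf : coord_proj x A f = \sum_(l < m) mask (fun i => i \in A) b l *: x l.
  by apply: coord_proj_finite => j _; exact: bm.
pose A' := [set j | level j \in A].
have GW z : G (W z) = z by have := GUW 0 z; rewrite !linear0 add0r.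
have cW j : coordinate y (W f) j = if (j < (2 ^ m).-1)%N then b (level j) / emb (lam (2 ^ level j)) else 0.
  by rewrite {1}fE transfer_sum (coordinate_finite yB (fun j =>
    b (level j) / emb (lam (2 ^ level j)))).
have SAW : coord_proj y A' (W f) = W (coord_proj x A f).
  rewrite SAf transfer_sum (coord_proj_finite (n := (2 ^ m).-1)) => [|j _ mj]; last first.
    by rewrite cW ltnNge mj.
  apply: eq_bigr => j _; rewrite /mask cW ltn_ord; congr (_ *: _).
  have -> : ((j : nat) \in A') = (level j \in A) by apply/idP/idP => [/set_mem|H];
    last exact/mem_set.
  by case: ifP; rewrite ?mul0r.
have nf : 0 < nrm f by rewrite nrm_gt0.
have Wf0 : W f != 0 by apply: contra_neq f0 => Wf; rewrite -(GW f) Wf linear0.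
have nWf : 0 < nrm (W f) by rewrite nrm_gt0.
apply: (@le_trans _ _ (D%:E * (nrm (coord_proj y A' (W f)) / nrm (W f))%:E)%E).
  rewrite -EFinM lee_fin SAW; set z := coord_proj x A f.
  rewrite ler_pdivrMr//.
  have -> : D * (nrm (W z) / nrm (W f)) * nrm f = D * nrm (W z) * nrm f / nrm (W f).
    by rewrite mulrA -!mulrA [_^-1 * _]mulrC.
  rewrite ler_pdivlMr//.
  have H1 := C2P (W z); rewrite GW in H1; have H2 := C1P f.
  have Wz := nrm_ge0 (W z); have z0 := nrm_ge0 z.
  apply: le_trans (ler_pM z0 (ltW nWf) H1 H2) _.
  rewrite /D; have := mulr_ge0 Wz (ltW nf); nra.
rewrite lee_pmul2l ?lte_fin//; apply: ereal_sup_ubound; exists (W f), A'; split=> //.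
by move=> j; rewrite /supp /= cW; case: ifP => //; rewrite eqxx.
Qed.

End Transfer.

(** * The sequence space and the theorem *)

Section SequenceSpaces.
Context {R : realType} {k : scalar_kind}.
Notation F := (scalars R k).
Variable S : sequence_space R k.
Notation e := (unit_vector S).

Lemma subsymmetric_spreading : subsymmetric S -> sign_invariant_spreading e.
Proof.
move=> [_ _ iso] n a s phi phiI.
have [|g /expandsP gP ng] := iso _ _ (fun j => (-1) ^+ s j) phi (expands_finite e a n) _ phiI.
  by move=> j; case: (s j); [right|left].
rewrite /snorm -ng; congr nrm; apply: tends_unique gP.
apply: (tends_eq (N := n) _ (tends_cst _)) => m nm.
rewrite (big_ord_widen m (fun j => ((-1) ^+ s j * a j) *: e (phi j)) nm) big_mkcond.
by apply: eq_bigr => j _; case: ifP; rewrite ?mulr0 ?scale0r.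
Qed.

Section Ell1.
Hypothesis S1 : is_ell1 S.

Lemma nrm_ell1 (f : S) : (nrm f)%:E = (\sum_(0 <= j <oo) (abs (seq_of f j))%:E)%E.
Proof. by case: S1. Qed.

Lemma unit_series i : (\sum_(0 <= j <oo) (abs (unit_seq i j : F))%:E = 1)%E.
Proof.
apply/cvg_lim => //; apply: cvg_near_cst; exists i.+1 => // n /= i_n.
rewrite big_mkord (bigD1 (Ordinal i_n))//= big1 ?adde0.
  by rewrite /unit_seq eqxx abs1.
by move=> j ji; rewrite /unit_seq (_ : (j == i :> nat) = false) ?abs0//;
   apply: contra_neqF ji => /eqP ji; apply: val_inj.
Qed.

Lemma seq_of_unit i : seq_of (e i) = unit_seq i.
Proof.
have [f fi] : exists f : S, seq_of f = unit_seq i.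
  by apply/(S1.1); rewrite unit_series ltry.
exact: (@xgetPex _ 0 [set f : S | seq_of f = unit_seq i] (ex_intro _ f fi)).
Qed.

Lemma seq_of0 j : seq_of (0 : S) j = 0.
Proof.
by have := seq_of_linear (s := S) (-1) 0 0 j; rewrite scaler0 addr0 mulN1r addNr.
Qed.

Lemma nrm_unit i : nrm (e i) = 1.
Proof. by apply: EFin_inj; rewrite nrm_ell1 seq_of_unit unit_series. Qed.

(** Norms of disjointly supported vectors add up. *)
Lemma nrm_add_unit (f : S) c i : seq_of f i = 0 -> nrm (c *: e i + f) = abs c + nrm f.
Proof.
move=> fi; apply: EFin_inj; rewrite EFinD -[abs c]mulr1 -(nrm_unit i) -nrmZ !nrm_ell1.
rewrite -nneseriesD; last 2 first.
  by move=> j _; rewrite lee_fin abs_ge0.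
  by move=> j _; rewrite lee_fin abs_ge0.
apply: eq_eseriesr => j _; rewrite -EFinD; congr (_%:E).
rewrite seq_of_linear -[c *: e i]addr0 seq_of_linear seq_of0 addr0 seq_of_unit /unit_seq.
by case: eqVneq => [->|_]; rewrite ?fi ?mulr0 ?abs0 ?addr0 ?add0r.
Qed.

Lemma ell1_sum n (a : nat -> F) (phi : nat -> nat) : {homo phi : i j / (i < j)%N} ->
  nrm (\sum_(j < n) a j *: e (phi j)) = \sum_(j < n) abs (a j).
Proof.
move=> phiI; elim: n => [|n IH]; first by rewrite !big_ord0 nrm0.
rewrite !big_ord_recr /= [in LHS]addrC nrm_add_unit ?IH 1?addrC//.
have H m : (m <= n)%N -> seq_of (\sum_(j < m) a j *: e (phi j)) (phi n) = 0.
  elim: m => [|m IHm] mn; first by rewrite big_ord0 seq_of0.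
  rewrite big_ord_recr /= addrC seq_of_linear IHm ?(ltnW mn)// seq_of_unit addr0 /unit_seq.
  by rewrite gtn_eqF ?mulr0// phiI.
exact: H.
Qed.

Lemma ell1_snorm n (a : nat -> F) : snorm e n a = \sum_(j < n) abs (a j).
Proof. exact: (ell1_sum n a (phi := id)). Qed.

Lemma ell1_lam n : lam e n = n%:R.
Proof.
rewrite /lam ell1_snorm -[in RHS](card_ord n) -sumr_const.
by apply: eq_bigr => i _; rewrite abs1.
Qed.

Lemma ell1_spreading : sign_invariant_spreading e.
Proof.
move=> n a s phi phiI; rewrite (ell1_sum n (fun j => (-1) ^+ s j * a j) phiI) ell1_snorm;
  apply: eq_bigr => j _.
by rewrite absM; case: (s j); rewrite ?expr1 ?absN abs1 mul1r.
Qed.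

(** The norm of a remainder is the norm of f minus the partial sums of the
absolute values of its entries. *)
Lemma ell1_basis : schauder_basis e.
Proof.
apply: (schauder_of_dense (K := 1)) => [j|m n a mn|f r r0].
- by rewrite -nrm_gt0 nrm_unit.
- by rewrite mul1r; exact: (snorm_mono ell1_spreading).
pose a := seq_of f; pose s n := \sum_(j < n) a j *: e j.
have remainder n : nrm (f - s n) = nrm f - \sum_(j < n) abs (a j).
  elim: n => [|n IH]; first by rewrite /s !big_ord0 !subr0.
  rewrite [in RHS]big_ord_recr /= opprD addrA -IH.
  have -> : f - s n = a n *: e n + (f - s n.+1).
    have -> : s n.+1 = s n + a n *: e n by rewrite /s big_ord_recr.
    by rewrite opprD [RHS]addrC addrA subrK.
  rewrite nrm_add_unit; first by rewrite addrAC subrr add0r.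
  have sn m : seq_of (s m) n = if (n < m)%N then a n else 0.
    elim: m => [|m IHm]; first by rewrite /s big_ord0 seq_of0.
    rewrite /s big_ord_recr /= addrC seq_of_linear -/(s m) IHm seq_of_unit /unit_seq ltnS.
    by case: ltngtP => [||->]; rewrite ?mulr0 ?mulr1 ?addr0 ?add0r.
  by rewrite addrC -scaleN1r seq_of_linear sn ltnSn mulN1r addNr.
suff [n nP] : exists n, nrm f - \sum_(j < n) abs (a j) < r by exists n, a; rewrite remainder.
apply: contrapT => /forallNP H.
suff : ((nrm f)%:E <= (nrm f - r)%:E)%E by rewrite lee_fin lerBrDr gerDl leNgt r0.
rewrite {1}nrm_ell1; apply: lime_le.
  by apply: is_cvg_nneseries => j _ _; rewrite lee_fin abs_ge0.
apply: nearW => n; rewrite sumEFin lee_fin big_mkord.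
by have /negP := H n; rewrite -leNgt /a; lra.
Qed.

Lemma ell1_regular : lower_regular e /\ sparse_summable e.
Proof.
split; [exists 2 => l|exists 1 => N n g _ _].
  under eq_bigr do rewrite ell1_lam; rewrite ell1_lam.
  elim: l => [|l IH]; first by rewrite big_ord1; lra.
  rewrite big_ord_recr /= expnS natrM; lra.
rewrite mul1r ell1_snorm (big_level N (fun j => abs (g j))); apply: ler_sum => l _.
by rewrite ell1_lam divff ?mul1r// pnatr_eq0 -lt0n expn_gt0.
Qed.

End Ell1.

(** All that the construction uses about S. *)
Lemma admissible_cases : is_ell1 S \/ (subsymmetric S /\ nontrivial_type S) ->
  [/\ sign_invariant_spreading e, schauder_basis e, 0 < lam e 1,
      lower_regular e & sparse_summable e].
Proof.
case=> [S1|[Ssub [p [p1 _ Sp]]]].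
  have [low sp] := ell1_regular S1; split=> //.
  - exact: ell1_spreading.
  - exact: ell1_basis.
  - by rewrite ell1_lam// ltr01.
have eS := subsymmetric_spreading Ssub.
have eB : schauder_basis e by case: Ssub => _ [].
have e0 : 0 < lam e 1 by rewrite lamE big_ord1 nrm_gt0 (basis_neq0 eB).
by have [low sp] := type_regular eS e0 p1 Sp.
Qed.

End SequenceSpaces.

Lemma seminormalized_bounds (R : realType) (k : scalar_kind) (X : normedModType (scalars R k))
  (x : nat -> X) : seminormalized x ->
  exists c C, [/\ 0 < c, forall j, c <= nrm (x j) & forall j, nrm (x j) <= C].
Proof.
move=> [x_inf x_sup].
have inf_le j : (ereal_inf (range (fun j => (nrm (x j))%:E)) <= (nrm (x j))%:E)%E.
  by apply: ereal_inf_lbound; exists j.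
have sup_ge j : ((nrm (x j))%:E <= ereal_sup (range (fun j => (nrm (x j))%:E)))%E.
  by apply: ereal_sup_ubound; exists j.
move: (ereal_inf _) (ereal_sup _) inf_le sup_ge x_inf x_sup.
move=> [c| |] [C| |] inf_le sup_ge// c0 _; last 3 first.
- by have := sup_ge 0%N.
- by have := inf_le 0%N.
- by have := inf_le 0%N.
by exists c, C; split => // j; rewrite -lee_fin.
Qed.

Lemma Lconst_ge0 (R : realType) (k : scalar_kind) (X : normedModType (scalars R k))
  (x : nat -> X) m : schauder_basis x -> (0 < m)%N -> (0 <= Lconst x m)%E.
Proof.
move=> xB m0; apply: (@le_trans _ _ (nrm (coord_proj x set0 (x 0%N)) / nrm (x 0%N))%:E).
  by rewrite lee_fin divr_ge0 ?nrm_ge0.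
apply: ereal_sup_ubound; exists (x 0%N), set0; split; rewrite ?(basis_neq0 xB)//.
move=> j; rewrite /supp /= (coordinate_basis xB).
by case: (eqVneq j 0%N) => [->|_]; rewrite ?eqxx.
Qed.

Lemma Lconst_mono (R : realType) (k : scalar_kind) (X : normedModType (scalars R k))
  (x : nat -> X) m n : (m <= n)%N -> (Lconst x m <= Lconst x n)%E.
Proof.
move=> mn; apply: ereal_sup_le => _ [f [A [f0 fm ->]]]; exists f, A; split=> //.
by move=> j /fm /= jm; exact: leq_trans mn.
Qed.

(** For 2^n - 1 <= m < 2^(n+1) - 1 and n > 0 one has ln m <= 2 n, and the doubling
property removes the factor 2. *)
Lemma Lconst_logarithmic (R : realType) (k : scalar_kind) (X : normedModType (scalars R k))
    (x y : nat -> X) (delta : R -> R) (D : R) : schauder_basis x -> 0 < D ->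
  (forall t, 0 <= t -> 0 <= delta t) ->
  (forall s t, 0 <= s -> s <= t -> delta s <= delta t) -> doubling delta ->
  (forall m, (Lconst x m <= D%:E * Lconst y (2 ^ m).-1)%E) ->
  lesssim (fun m => (delta m%:R)%:E) (Lconst x) ->
  lesssim (fun m => (delta (ln m%:R))%:E) (Lconst y).
Proof.
move=> xB D0 delta_ge0 delta_ndecr [B B0 double] xy [C Cx].
exists (B * (`|C| * D)) => m m0.
pose n := trunc_log 2 m.+1.
have /andP[nm mn] : (2 ^ n <= m.+1 < 2 ^ n.+1)%N by exact: trunc_log_bounds.
have n0 : (0 < n)%N by rewrite trunc_log_gt0.
have lnm : ln m%:R <= 2 * n%:R :> R.
  have ln2 : ln 2 <= 1 :> R by have := @le_ln1Dx R 1; rewrite (_ : 1 + 1 = 2) //; apply; lra.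
  have : ln m%:R <= ln (2 ^+ n.+1) :> R.
    by rewrite ler_ln ?posrE ?exprn_gt0 ?ltr0n// -natrX ler_nat; lia.
  rewrite lnXn// => /le_trans; apply; apply: (@le_trans _ _ (1 *+ n.+1));
    first by rewrite lerMn2r ln2 orbT.
  by rewrite -natrM ler_nat; lia.
have H1 : delta (ln m%:R) <= B * delta n%:R.
  rewrite (le_trans (delta_ndecr _ _ _ lnm))//; first by rewrite ln_ge0// ler1n.
  exact: double.
apply: (@le_trans _ _ (B * delta n%:R)%:E); first by rewrite lee_fin.
rewrite EFinM [in leRHS]EFinM -muleA lee_wpmul2l ?lee_fin//.
apply: (le_trans (Cx n n0)).
apply: (@le_trans _ _ (`|C|%:E * Lconst x n)%E).
  by rewrite lee_wpmul2r ?(Lconst_ge0 xB)// lee_fin ler_norm.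
rewrite EFinM -muleA lee_wpmul2l// (le_trans (xy n))// lee_wpmul2l ?lee_fin ?(ltW D0)//.
by apply: Lconst_mono; lia.
Qed.

Theorem theorem4p1 (R : realType) (k : scalar_kind)
    (X : completeNormedModType (scalars R k)) (x : nat -> X)
    (S : sequence_space R k) (delta : R -> R)
    (x_basis : banach_basis x)
    (S_cases : is_ell1 S \/ (subsymmetric S /\ nontrivial_type S))
    (S_compl : isomorphic_to_complemented_subspace S X)
    (delta_ge0 : forall t, 0 <= t -> 0 <= delta t)
    (delta_ndecr : forall s t, 0 <= s -> s <= t -> delta s <= delta t)
    (delta_doubling : doubling delta)
    (delta_L : lesssim (fun m => (delta m%:R)%:E) (Lconst x)) :
  exists y : nat -> X,
    [/\ banach_basis y,
        almost_greedy y,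
        equivalent (fundamental_function y)
          (fun m => (nrm (\sum_(j < m) unit_vector S j))%:E) &
        lesssim (fun m => (delta (ln m%:R))%:E) (Lconst y)].
Proof.
have [xB /seminormalized_bounds[c [C [c0 xc xC]]]] := x_basis.
have [K _ xK] := basis_constant xB.
have [eS eB e0 low sp] := admissible_cases S_cases.
have [U [W [G [q [Q [[Ub Wb Gb qb Qb] Qe [qUW GUW] UqWG Qq]]]]]] :=
  complemented_absorption eS eB S_compl.
pose y := conditional_basis (unit_vector S) x U W Q.
have [D D0 [up dn gr pre]] :=
  conditional_basis_threshold eS e0 low sp c0 xc xC xK Ub Wb Gb qb Qe qUW GUW.
have lam_0 : 0 <= lam (unit_vector S) 0 by exact: lam_ge0.
have lamM m n : (m <= n)%N -> lam (unit_vector S) m <= lam (unit_vector S) n := lam_mono eS (n := n).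
have dense := conditional_basis_dense eS eB e0 xB Ub Wb Qb Qe UqWG Qq.
have yBB := threshold_basis D0 e0 up dn pre dense.
have [E E0 LE] := Lconst_transfer eS e0 xB Wb Gb Qe GUW yBB.1.
exists y; split=> //.
- exact: threshold_almost_greedy D0 lamM e0 up dn gr pre dense.
- have [H1 H2] := threshold_fundamental D0 lamM e0 up dn.
  by split; [case: H1|case: H2] => B BP; exists B => m /BP; rewrite lamE.
- exact: Lconst_logarithmic xB E0 delta_ge0 delta_ndecr delta_doubling LE delta_L.
Qed.
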